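(* Let $q,a,b,k$ be nonzero complex numbers with $|q|<1$, such that no zero factor occurs in any denominator below (including the denominators of the terms of the series) and all the series below converge absolutely. Then $$\frac{(qab/k,kq/b;q)_\infty\,(q,k^2q/a,q^2a,q^2a^2/k^2;q^2)_\infty}{(kq,qa/k;q)_\infty}$$ $$\times\;{}_{12}W_{11}\left(k;\frac{k^2}{ab},\frac{k^2q}{ab},b,bq,\sqrt{aq},-\sqrt{aq},\sqrt{aq^3},-\sqrt{aq^3},\frac{k^2}{a^2};\,q^2,\,\frac{a^2q^2}{k^2}\right)$$ $$=\left(\frac{k^2q}{ab},bq,\frac{a^2bq^2}{k^2},\frac{q^2a}{b};q^2\right)_\infty$$ $$\times\;{}_{12}W_{11}\left(a;\frac{k^2}{ab},b,aq,\frac{k}{a},\frac{kq}{a},a\sqrt{\tfrac{q}{k}},-a\sqrt{\tfrac{q}{k}},a\sqrt{\tfrac{q^3}{k}},-a\sqrt{\tfrac{q^3}{k}};\,q^2,\,\frac{q^2a^2}{k^2}\right)$$ $$+\frac{qa}{k}\,\frac{(1-aq^2)\left(1-\frac{k}{a}\right)}{(1-q)(1-kq)}\left(\frac{k^2}{ab},b,\frac{a^2bq^3}{k^2},\frac{q^3a}{b};q^2\right)_\infty$$ $$\times\;{}_{12}W_{11}\left(aq^2;\frac{k^2q}{ab},bq,aq,\frac{kq}{a},\frac{kq^2}{a},a\sqrt{\tfrac{q^3}{k}},-a\sqrt{\tfrac{q^3}{k}},a\sqrt{\tfrac{q^5}{k}},-a\sqrt{\tfrac{q^5}{k}};\,q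^2,\,\frac{q^2a^2}{k^2}\right).$$
   Context: Notation: $(x;q)_0=1$, $(x;q)_n=\prod_{j=0}^{n-1}(1-xq^j)$, $(x;q)_\infty=\prod_{j\ge 0}(1-xq^j)$, and $(x_1,\dots,x_m;q)_n=(x_1;q)_n\cdots(x_m;q)_n$ for $n$ a nonnegative integer or $\infty$. In expressions such as $k^2/ab$ the whole product after the slash is the denominator. The very-well-poised series with base $p$ (here $p=q^2$) is $${}_{r+1}W_{r}(a_1;a_4,\dots,a_{r+1};p,x)=\sum_{n=0}^{\infty}\frac{(a_1,p\sqrt{a_1},-p\sqrt{a_1},a_4,\dots,a_{r+1};p)_n}{(p,\sqrt{a_1},-\sqrt{a_1},\frac{a_1p}{a_4},\dots,\frac{a_1p}{a_{r+1}};p)_n}\,x^n .$$ Square roots denote fixed choices of complex square root; each occurs together with its negative, so the choice is immaterial. *)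

(* Defs.v *)
(* MathComp world. The definitions are over a numeric field K with the topology
   of its norm; K is meant to be the complex field R[i] for R : realType. *)
From HB Require Import structures.
From mathcomp Require Import all_boot all_order all_algebra.
From mathcomp Require Import all_classical all_reals all_analysis.

Set Implicit Arguments.
Unset Strict Implicit.
Unset Printing Implicit Defensive.

Import Order.TTheory GRing.Theory Num.Theory numFieldNormedType.Exports.
Local Open Scope classical_set_scope.
Local Open Scope ring_scope.

Definition qpoch (K : numFieldType) (x q : K) (n : nat) : K :=
  \prod_(j < n) (1 - x * q ^+ j).

Definition qpochs (K : numFieldType) (xs : seq K) (q : K) (n : nat) : K :=
  \prod_(x <- xs) qpoch x q n.

Definition qpoch_inf (K : numFieldType) (x q : K) : K :=
  limn (fun n => qpoch x q n).

Definition qpochs_inf (K : numFieldType) (xs : seq K) (q : K) : K :=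
  \prod_(x <- xs) qpoch_inf x q.

(* In the very-well-poised series below, [s] lists a_4, ..., a_{r+1}, so that
   r + 1 = 3 + size s, and [sqrt] is the chosen complex square root. *)

Definition vwp_num (K : numFieldType) (sqrt : K -> K)
    (a1 : K) (s : seq K) (p : K) (n : nat) : K :=
  qpochs [:: a1, p * sqrt a1, - p * sqrt a1 & s] p n.

Definition vwp_den (K : numFieldType) (sqrt : K -> K)
    (a1 : K) (s : seq K) (p : K) (n : nat) : K :=
  qpochs [:: p, sqrt a1, - sqrt a1 & [seq a1 * p / y | y <- s]] p n.

Definition vwp_term (K : numFieldType) (sqrt : K -> K)
    (a1 : K) (s : seq K) (p x : K) (n : nat) : K :=
  vwp_num sqrt a1 s p n / vwp_den sqrt a1 s p n * x ^+ n.

Definition vwp (K : numFieldType) (sqrt : K -> K)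
    (a1 : K) (s : seq K) (p x : K) : K :=
  limn (series (vwp_term sqrt a1 s p x)).

(* Nonvanishing of the denominators of all terms. Here n is arbitrary,
   so this says that no factor 1 - y p^j of a denominator is zero. *)
Definition vwp_defined (K : numFieldType) (sqrt : K -> K)
    (a1 : K) (s : seq K) (p : K) : Prop :=
  forall n : nat, vwp_den sqrt a1 s p n != 0.

Definition vwp_abs_cvg (K : numFieldType) (sqrt : K -> K)
    (a1 : K) (s : seq K) (p x : K) : Prop :=
  cvgn [normed series (vwp_term sqrt a1 s p x)].

Definition params1 (K : numFieldType) (sqrt : K -> K)
    (q a b k : K) : seq K :=
  [:: k ^+ 2 / (a * b); k ^+ 2 * q / (a * b); b; b * q;
      sqrt (a * q); - sqrt (a * q); sqrt (a * q ^+ 3); - sqrt (a * q ^+ 3);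
      k ^+ 2 / a ^+ 2].

Definition params2 (K : numFieldType) (sqrt : K -> K)
    (q a b k : K) : seq K :=
  [:: k ^+ 2 / (a * b); b; a * q; k / a; k * q / a;
      a * sqrt (q / k); - a * sqrt (q / k);
      a * sqrt (q ^+ 3 / k); - a * sqrt (q ^+ 3 / k)].

Definition params3 (K : numFieldType) (sqrt : K -> K)
    (q a b k : K) : seq K :=
  [:: k ^+ 2 * q / (a * b); b * q; a * q; k * q / a; k * q ^+ 2 / a;
      a * sqrt (q ^+ 3 / k); - a * sqrt (q ^+ 3 / k);
      a * sqrt (q ^+ 5 / k); - a * sqrt (q ^+ 5 / k)].

(* Main.v *)
Require Import Defs.
From HB Require Import structures.
From mathcomp Require Import all_boot all_order all_algebra complex ring lra zify.
From mathcomp Require Import all_classical all_reals all_analysis.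

(** Put [B = k^2 / (a b)] and [f = a / k], so that [k = B b f] and
[a = B b f^2]; write (x)_n for the shifted factorial in base q.  In the
parameters [B], [b], [f] both sides of the identity are symmetric in [B]
and [b], and they are two evaluations of one double sum over pairs n <= r,
with general term [left_weight r * pair_term r n].

- Summing over n first: by [pair_sum] the inner sum is 0 for odd r and a
  quotient of shifted factorials for r = 2m.  What remains is the series on the
  left ([left_term_even], [left_term_odd]).
- Summing over r = n + s first: by [left_weight_pair_term] the double sum
  factors as a function of n times the s-th term of a q-analogue of Watson's
  3F2 summation with parameters [B q^n] and [b q^n].  That sum is a quotient of
  infinite products ([watson_nonterminating], [watson_terminating]).  The
  remaining sum over n splits by parity into the two series on the right
  ([right_term_even], [right_term_odd]).

The Watson-type sum and the finite sum [pair_sum] have the same origin: their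
terms admit a rational certificate which turns the difference between the term
and a multiple of the term with b replaced by b q^2 (respectively, the terms
for r and r - 2) into a telescoping difference.  For the Watson-type sum, iterating
the resulting two-term recurrence in both parameters drives a and b to 0, where
the sum degenerates into the q-binomial series.

The order of summation matters only through convergence.  If |q f| < 1, a
geometric bound of ratio |q f| and Tannery's theorem justify the exchange
([exchange_nonterminating]).  If |q f| >= 1, the terms of the left series, whose
argument is (q f)^2, tend to 0 only if one of the numerator factors vanishes
([left_diverges]).  There are three ways in which this can happen.  If
[B q^M = 1] or [b q^M = 1], only finitely many n contribute
([exchange_terminating]).  If [a q^(2g+1) = 1], the left and right series
terminate but the sums over s for fixed n diverge, and the identity is reached
by analytic continuation along a discrete set ([exchange_degenerate]): the
substitution of [B / s], [b / s], [f s] with [s = q^(2t)] leaves a unchanged and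
multiplies |q f| by |s|, so the identity is known for large t.  After
normalization by theta functions both sides are rational functions of [q^t], and
a rational function that vanishes at infinitely many points [q^t] vanishes at
t = 0.  The remaining factor, (k^2 / a^2; q^2), can vanish only when
|q f| < 1. *)

Set Implicit Arguments.
Unset Strict Implicit.
Unset Printing Implicit Defensive.

Import Order.TTheory GRing.Theory Num.Theory numFieldNormedType.Exports.
Local Open Scope classical_set_scope.
Local Open Scope ring_scope.
Local Open Scope complex_scope.

(* Discharges a side condition y != 0 of field by a hypothesis x != 0 in which
   x is the same polynomial as y. *)
Ltac nonzero := repeat (apply/andP; split); try assumption;
  match goal with H : is_true (?x != 0) |- is_true (?y != 0) =>
    by rewrite (_ : y = x); [exact: H | ring] end.

(* The identities to be checked by field are products of factors 1 - x, never
   expanded in the proof.  Replacing x |-> 1 - x by an opaque function prevents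
   the normalization from multiplying these factors out. *)
Ltac opaque_factors K := let om := fresh "om" in let omE := fresh "omE" in
  have [om omE] : exists om : K -> K, forall x, 1 - x = om x
    by [exists (fun x => 1 - x)];
  rewrite ?omE; repeat match goal with H : is_true (1 - _ != 0) |- _ => rewrite omE in H end.

(** * Shifted factorials and a telescoping Watson-type summand *)
Section Algebra.
Variable K : numFieldType.
Implicit Types x y z q a b e k : K.

Lemma qpoch0 x q : qpoch x q 0 = 1.
Proof. by rewrite /qpoch big_ord0. Qed.

Lemma qpochS x q n : qpoch x q n.+1 = qpoch x q n * (1 - x * q ^+ n).
Proof. by rewrite /qpoch big_ord_recr. Qed.

Lemma qpochSl x q n : qpoch x q n.+1 = (1 - x) * qpoch (x * q) q n.
Proof.
rewrite /qpoch big_ord_recl expr0 mulr1; congr (_ * _).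
by apply: eq_bigr => j _; rewrite -mulrA -exprS.
Qed.

Lemma qpoch1 x q : qpoch x q 1 = 1 - x.
Proof. by rewrite qpochS qpoch0 mul1r expr0 mulr1. Qed.

Lemma qpochD x q m n :
  qpoch x q (m + n) = qpoch x q m * qpoch (x * q ^+ m) q n.
Proof.
elim: n => [|n IHn]; first by rewrite addn0 qpoch0 mulr1.
by rewrite addnS !qpochS IHn -mulrA -mulrA exprD mulrA.
Qed.

Lemma qpoch_neq0 x q :
  (forall j, 1 - x * q ^+ j != 0) <-> (forall n, qpoch x q n != 0).
Proof.
split=> [h n | h j]; first by apply/prodf_neq0 => j _; apply: h.
by have := h j.+1; rewrite qpochS mulf_eq0 negb_or => /andP[].
Qed.

Lemma qpochSr x q n : (1 - x) * qpoch (x * q) q n = qpoch x q n * (1 - x * q ^+ n).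
Proof. by rewrite -qpochSl qpochS. Qed.

(** The summand, as a function of s, of the very-well-poised form of the
q-analogue of Watson's sum: with l = ab/e and c = abq/e^2 it is the 8phi7 summand
whose parameters are l, a, b, e, sqrt c, - sqrt c and the very-well-poised pair,
at the argument - q/e.  The roots disappear through (c; q^2)_s / (c; q)_s =
(c q^s; q)_s / (cq; q^2)_s, and the denominator (abq; q^2)_s is kept in the product
P, to be instantiated by x |-> (x; q^2)_oo; thus it may vanish without harm. *)
Definition watson_term (P : K -> K) q a b e (s : nat) : K :=
  let l := a * b / e in let c := a * b * q / e ^+ 2 in
  qpoch l q s * (1 - l * (q ^+ s) ^+ 2) / (1 - l)
  * (qpoch a q s * qpoch b q s * qpoch e q s * qpoch (c * q ^+ s) q s)
  / (qpoch q q s * qpoch (b * q / e) q s * qpoch (a * q / e) q s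
     * qpoch (c * q) (q ^+ 2) s)
  * (- q / e) ^+ s * P (a * b * q * (q ^+ s) ^+ 2).

(** The telescoping certificate: a rational multiple of [watson_term].  Its
denominator 1 - b and its numerator 1 - q^s, which makes it vanish at s = 0, are
absorbed in the factorials, so that it remains meaningful for b = 1. *)
Definition watson_cert (P : K -> K) q a b e (s : nat) : K :=
  if s is m.+1 then
  let l := a * b / e in let c := a * b * q / e ^+ 2 in
  b * (1 - q / e) * (1 - l * b * q * (q ^+ s) ^+ 2 / e) / (1 - l)
  * (qpoch l q s * qpoch a q s * qpoch (b * q) q m * qpoch e q s
     * qpoch (c * q * q ^+ s) q m)
  / (qpoch q q m * qpoch (b * q / e) q s.+1 * qpoch (a * q / e) q m
     * qpoch (c * q) (q ^+ 2) s)
  * (- q / e) ^+ s * P (a * b * q * (q ^+ s) ^+ 2)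
  else 0.

(** The quotient of the closed forms of the sums for (a, b) and (a, b q^2). *)
Definition watson_ratio q a b e : K :=
  let l := a * b / e in let c := a * b * q / e ^+ 2 in
  (1 - l * q) * (1 - l * q ^+ 2) * (1 - b * q) * (1 - b * q ^+ 2 / e ^+ 2)
  / ((1 - b * q / e) * (1 - b * q ^+ 2 / e) * (1 - c * q)).

Lemma qpoch_shift2 x q n : (1 - x) * (1 - x * q) * qpoch (x * q ^+ 2) q n =
  qpoch x q n * (1 - x * q ^+ n) * (1 - x * q * q ^+ n).
Proof.
have -> : x * q ^+ 2 = x * q * q by ring.
by rewrite -mulrA qpochSr mulrA qpochSr.
Qed.

Lemma expr_sqr q s : (q ^+ 2) ^+ s = (q ^+ s) ^+ 2.
Proof. by rewrite -!exprM mulnC. Qed.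

Section Telescope.
Variables (P : K -> K) (q a b f : K).
Hypothesis PE : forall x, P x = (1 - x) * P (x * q ^+ 2).
Hypothesis f0 : f != 0.
Hypothesis q1 : forall j, 1 - q * q ^+ j != 0.
Hypothesis l1 : forall j, 1 - a * b * f * q ^+ j != 0.
Hypothesis b1 : forall j, 1 - b * q * f * q ^+ j != 0.
Hypothesis a1 : forall j, 1 - a * q * f * q ^+ j != 0.
Hypothesis c1 : forall j, 1 - a * b * q * f ^+ 2 * q * (q ^+ 2) ^+ j != 0.

(** The shifted term rewritten over the factorials of the unshifted one, so
that both can be compared by rational arithmetic. *)
Lemma watson_term_shift s : watson_ratio q a b f^-1 * watson_term P q a (b * q ^+ 2) f^-1 s =
  let l := a * b * f in let c := a * b * q * f ^+ 2 in let X := q ^+ s in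
  (1 - b * q ^+ 2 * f ^+ 2)
  * qpoch l q s * (1 - l * X) * (1 - l * q * X) * (1 - l * q ^+ 2 * X ^+ 2) / (1 - l)
  * (qpoch a q s * qpoch (b * q) q s * (1 - b * q * X) * qpoch f^-1 q s
     * qpoch (c * q ^+ 2 * X) q s)
  / (qpoch q q s * (qpoch (b * q * f) q s * (1 - b * q * f * X) * (1 - b * q * f * q * X))
     * qpoch (a * q * f) q s * (qpoch (c * q) (q ^+ 2) s * (1 - c * q * X ^+ 2)))
  * (- q * f) ^+ s * P (a * b * q * X ^+ 2 * q ^+ 2).
Proof.
have nq n : qpoch q q n != 0 by exact: (proj1 (qpoch_neq0 _ _) q1 n).
have nb n : qpoch (b * q * f) q n != 0 by exact: (proj1 (qpoch_neq0 _ _) b1 n).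
have na n : qpoch (a * q * f) q n != 0 by exact: (proj1 (qpoch_neq0 _ _) a1 n).
have nc n : qpoch (a * b * q * f ^+ 2 * q) (q ^+ 2) n != 0 by exact: (proj1 (qpoch_neq0 _ _) c1 n).
have [l_0 l_1] := (l1 0%N, l1 1%N); have l_2 := l1 2%N.
have [b_0 b_1] := (b1 0%N, b1 1%N).
have c_0 := c1 0%N.
rewrite ?expr0 ?expr1 in l_0 l_1 l_2 b_0 b_1 c_0.
have bs1 := b1 s; have bs2 := b1 s.+1; have cs := c1 s.
rewrite ?expr_sqr ?exprS in cs bs2.
rewrite /watson_ratio /watson_term /= !exprVn !invrK.
have El : qpoch (a * (b * q ^+ 2) * f) q s = qpoch (a * b * f) q s
   * (1 - a * b * f * q ^+ s) * (1 - a * b * f * q * q ^+ s)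
   / ((1 - a * b * f) * (1 - a * b * f * q)).
  rewrite -qpoch_shift2 [a * (b * q ^+ 2) * f](_ : _ = a * b * f * q ^+ 2); last by ring.
  by field; nonzero.
have Eb : (1 - b * q) * qpoch (b * q ^+ 2) q s = qpoch (b * q) q s * (1 - b * q * q ^+ s).
  by rewrite -qpochSr -mulrA.
have Ebf : qpoch (b * q * f) q s = (1 - b * q * f) * (1 - b * q * f * q) *
   qpoch (b * q ^+ 2 * q * f) q s / ((1 - b * q * f * q ^+ s) * (1 - b * q * f * q * q ^+ s)).
  rewrite [b * q ^+ 2 * q * f](_ : _ = b * q * f * q ^+ 2); last by ring.
  by rewrite qpoch_shift2; field; nonzero.
have Ec : qpoch (a * b * q * f ^+ 2 * q) (q ^+ 2) s =
  (1 - a * b * q * f ^+ 2 * q) * qpoch (a * (b * q ^+ 2) * q * f ^+ 2 * q) (q ^+ 2) s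
  / (1 - a * b * q * f ^+ 2 * q * (q ^+ s) ^+ 2).
  rewrite [a * (b * q ^+ 2) * q * f ^+ 2 * q](_ : _ = a * b * q * f ^+ 2 * q * q ^+ 2); last by ring.
  by rewrite qpochSr expr_sqr; field; nonzero.
have nb' := nb s; have nc' := nc s; have nq' := nq s; have na' := na s.
rewrite Ebf in nb' *; rewrite Ec in nc' *; rewrite El.
move: nb' nc'; rewrite !mulf_eq0 !negb_or => /andP[/andP[_ nb'] _] /andP[/andP[_ nc'] _].
rewrite [a * (b * q ^+ 2) * q * (q ^+ s) ^+ 2](_ : _ = a * b * q * (q ^+ s) ^+ 2 * q ^+ 2); last by ring.
rewrite [a * (b * q ^+ 2) * q * f ^+ 2 * q ^+ s](_ : _ = a * b * q * f ^+ 2 * q ^+ 2 * q ^+ s); last by ring.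
set p := P _.
pose B := qpoch (b * q ^+ 2) q s; rewrite -/B in Eb *.
transitivity ((1 - b * q ^+ 2 * f ^+ 2) * qpoch (a * b * f) q s
  * (1 - a * b * f * q ^+ s) * (1 - a * b * f * q * q ^+ s) * (1 - a * b * f * q ^+ 2 * (q ^+ s)^+2) / (1 - a * b * f)
  * (qpoch a q s * ((1 - b * q) * B) * qpoch f^-1 q s * qpoch (a * b * q * f ^+ 2 * q ^+ 2 * q ^+ s) q s)
  / (qpoch q q s * qpoch (a * q * f) q s * (qpoch (a * (b * q ^+ 2) * q * f ^+ 2 * q) (q ^+ 2) s * (1 - a * b * q * f ^+ 2 * q))
   * (qpoch (b * q ^+ 2 * q * f) q s * (1 - b * q * f) * (1 - b * q * f * q))) * (- q * f) ^+ s * p).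
  field; nonzero.
rewrite Eb; field; nonzero.
Qed.

(** By induction on M the claim is an identity between three consecutive
quantities; dividing by their common factor D leaves a polynomial identity.  The
cases M = 0 and M = 1 are separate because the general case reduces all
factorials to length M - 2. *)
Lemma watson_term_telescope M :
  \sum_(s < M) (watson_term P q a b f^-1 s - watson_ratio q a b f^-1 * watson_term P q a (b * q ^+ 2) f^-1 s)
  = watson_cert P q a b f^-1 M.
Proof.
have nq n : qpoch q q n != 0 by exact: (proj1 (qpoch_neq0 _ _) q1 n).
have nb n : qpoch (b * q * f) q n != 0 by exact: (proj1 (qpoch_neq0 _ _) b1 n).
have na n : qpoch (a * q * f) q n != 0 by exact: (proj1 (qpoch_neq0 _ _) a1 n).
have nc n : qpoch (a * b * q * f ^+ 2 * q) (q ^+ 2) n != 0 by exact: (proj1 (qpoch_neq0 _ _) c1 n).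
have l_0 := l1 0%N; rewrite expr0 mulr1 in l_0.
elim: M => [|M IHM]; first by rewrite big_ord0.
rewrite big_ord_recr /= IHM watson_term_shift /=.
case: M {IHM} => [|[|m]].
- rewrite /watson_term /watson_cert !invrK !exprVn !invrK !qpochS !qpoch0 ?expr0 ?expr1 ?expr1n ?mulr1.
  rewrite [P (a * b * q)]PE.
  have := b1 0%N; have := b1 1%N; have := c1 0%N; have := q1 0%N.
  rewrite !expr0 !expr1 !mulr1 => *; set p := P _.
  field; nonzero.
- rewrite /watson_term /watson_cert !invrK !exprVn !invrK !qpochS !qpoch0 ?expr0 ?expr1 ?expr1n ?mulr1.
  rewrite [P (a * b * q * q ^+ 2)]PE.
  have := b1 0%N; have := b1 1%N; have := b1 2%N; have := c1 0%N; have := c1 1%N; have := q1 0%N; have := q1 1%N;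
    have := a1 0%N.
  rewrite !expr0 !expr1 !mulr1 [P (a * b * q * q ^+ 2 ^+ 2)](_ : _ = P (a * b * q * q ^+ 2 * q ^+ 2)); last by congr P; ring.
  move=> *; set p := P _.
  field; nonzero.
- rewrite /watson_term /watson_cert !invrK !exprVn !invrK.
  rewrite [P (a * b * q * (q ^+ m.+2) ^+ 2)]PE.
  rewrite [P (a * b * q * (q ^+ m.+3) ^+ 2)](_ : _ = P (a * b * q * (q ^+ m.+2) ^+ 2 * q ^+ 2)); last first.
    by congr P; rewrite !exprS; ring.
  set p := P _.
  have := nq m.+2; have := nb m.+4; have := na m.+2; have := nc m.+3.
  have := l1 m.+2; have := b1 m.+3.
  rewrite [qpoch (_ * q ^+ 2 * q ^+ m.+2) q m.+2](_ : _ = qpoch (a * b * q * f ^+ 2 * (q ^+ m.+4)) q m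
     * (1 - a * b * q * f ^+ 2 * q ^+ 4 * (q ^+ m) ^+ 2) * (1 - a * b * q * f ^+ 2 * q ^+ 5 * (q ^+ m) ^+ 2)); last first.
    by rewrite !qpochS !exprS; congr (_ * _ * _); [congr qpoch| |]; ring.
  rewrite [qpoch (_ * q * q ^+ m.+3) q m.+2](_ : _ = qpoch (a * b * q * f ^+ 2 * (q ^+ m.+4)) q m
     * (1 - a * b * q * f ^+ 2 * q ^+ 4 * (q ^+ m) ^+ 2) * (1 - a * b * q * f ^+ 2 * q ^+ 5 * (q ^+ m) ^+ 2)); last first.
    by rewrite !qpochS !exprS; congr (_ * _ * _); [congr qpoch| |]; ring.
  rewrite [qpoch (_ * q ^+ m.+2) q m.+2](_ : _ = (1 - a * b * q * f ^+ 2 * q ^+ 2 * q ^+ m)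
     * (1 - a * b * q * f ^+ 2 * q ^+ 3 * q ^+ m) * qpoch (a * b * q * f ^+ 2 * (q ^+ m.+4)) q m); last first.
    by rewrite !qpochSl mulrA !exprS; congr (_ * _ * _); [| |congr qpoch]; ring.
  rewrite [qpoch (_ * q * q ^+ m.+2) q m.+1](_ : _ = (1 - a * b * q * f ^+ 2 * q ^+ 3 * q ^+ m)
     * qpoch (a * b * q * f ^+ 2 * (q ^+ m.+4)) q m); last first.
    by rewrite !qpochSl !exprS; congr (_ * _); [|congr qpoch]; ring.
  rewrite (qpochSl b).
  rewrite !(qpochS _ _ m.+3) !(qpochS _ _ m.+2) !(qpochS _ _ m.+1) !(qpochS _ _ m) !expr_sqr.
  have E1 x : x ^+ m.+1 = x * x ^+ m by rewrite exprS.
  have E2 x : x ^+ m.+2 = x ^+ 2 * x ^+ m by rewrite -exprD.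
  have E3 x : x ^+ m.+3 = x ^+ 3 * x ^+ m by rewrite -exprD.
  rewrite !E1 !E2 !E3.
  move: (qpoch _ _ m) (qpoch _ _ m) (qpoch _ _ m) (qpoch _ _ m) (qpoch _ _ m) (qpoch _ _ m)
    (qpoch _ _ m) (qpoch _ _ m) (qpoch _ _ m) => Q1 Q2 Q3 Q4 Q5 Q6 Q7 Q8 Q9.
  clear E1 E2 E3 q1 l1 b1 a1 c1 nq nb na nc.
  move: (_ ^+ m) p (_ ^+ m) => G p X.
  move: l_0; set l := a * b * f; set c := a * b * q * f ^+ 2 => l_0.
  have cqE : c * q * (q ^+ 2 * X) ^+ 2 = c * q ^+ 5 * X ^+ 2 by ring.
  rewrite cqE.
  do 6 (let H := fresh in intro H; rewrite ?mulf_eq0 ?negb_or -?andbA in H).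
  do ?match goal with H : is_true (_ && _) |- _ => case/andP: H => *  end.
  (* D is the common factor of all four terms; the cofactors are N1, N2, N3, N4. *)
  pose D := Q5 * (1 - l * X) * (1 - l * (q * X)) * (Q4 * (1 - a * X) * (1 - a * (q * X)))
    * (Q3 * (1 - b * q * X)) * (Q2 * (1 - f^-1 * X) * (1 - f^-1 * (q * X))) * Q1
    * ((- q * f) ^+ 2 * G) * p / ((1 - l) * (Q6 * (1 - q * X) * (1 - q * (q * X)))
    * (Q7 * (1 - b * q * f * X) * (1 - b * q * f * (q * X)) * (1 - b * q * f * (q ^+ 2 * X))
       * (1 - b * q * f * (q ^+ 3 * X)))
    * (Q8 * (1 - a * q * f * X) * (1 - a * q * f * (q * X)))
    * (Q9 * (1 - c * q * X ^+ 2) * (1 - c * q * (q * X) ^+ 2) * (1 - c * q ^+ 5 * X ^+ 2))).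
  pose N1 := b * (1 - q * f) * (1 - l * b * q * (q ^+ 2 * X) ^+ 2 * f) * (1 - c * q ^+ 3 * X)
     * (1 - q * (q * X)) * (1 - b * q * f * (q ^+ 3 * X)) * (1 - a * q * f * (q * X))
     * (1 - a * b * q * (q ^+ 2 * X) ^+ 2).
  pose N2 := (1 - l * (q ^+ 2 * X) ^+ 2) * (1 - b) * (1 - c * q ^+ 2 * X) * (1 - c * q ^+ 3 * X)
     * (1 - b * q * f * (q ^+ 2 * X)) * (1 - b * q * f * (q ^+ 3 * X)) * (1 - a * b * q * (q ^+ 2 * X) ^+ 2).
  pose N3 := (1 - b * q ^+ 2 * f ^+ 2) * (1 - l * (q ^+ 2 * X)) * (1 - l * q * (q ^+ 2 * X))
     * (1 - l * q ^+ 2 * (q ^+ 2 * X) ^+ 2) * (1 - b * q * (q * X)) * (1 - b * q * (q ^+ 2 * X))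
     * (1 - c * q ^+ 4 * X ^+ 2).
  pose N4 := b * (1 - q * f) * (1 - l * b * q * (q ^+ 3 * X) ^+ 2 * f) * (1 - l * (q ^+ 2 * X))
     * (1 - a * (q ^+ 2 * X)) * (1 - b * q * (q * X)) * (- q * f * (1 - f^-1 * (q ^+ 2 * X))) * (1 - c * q ^+ 4 * X ^+ 2).
  have EN : N1 + (N2 - N3) =N4 by rewrite /N1 /N2 /N3 /N4 /l /c; field; nonzero.
  have bqE : b * q * f * q * (q ^+ 2 * X) = b * q * f * (q ^+ 3 * X) by ring.
  transitivity (D * (1 - c * q ^+ 5 * X ^+ 2) * N1 + (D * (1 - c * q ^+ 5 * X ^+ 2) * N2
     - D * (1 - c * q ^+ 5 * X ^+ 2) * N3)); last first.
    rewrite -mulrBr -mulrDr EN /N4 /D. opaque_factors K; field; nonzero.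
  rewrite /N1 /N2 /N3 /D.
  rewrite bqE; opaque_factors K.
  by congr (_ + (_ - _)); field; nonzero.
Qed.
End Telescope.
End Algebra.

(** * A finite sum over pairs: telescoping in the length *)

Section Algebra.
Variable K : numFieldType.
Implicit Types x y z q a b e k : K.

(** The inner summand of the double sum.  Formally it is the Watson-type summand
with (a, b) replaced by (k q^n, q^(-n)), for e = k/a; factorials of length n - j
take the place of (q^(-n))_j and of its companion. *)
Definition pair_term q a f (n j : nat) : K :=
  let e := f^-1 in
  qpoch e q (n - j) * qpoch (a * e) q (n + j) * qpoch e q j * qpoch (a * q * f) (q ^+ 2) j
  * (-1) ^+ j * (1 - a * (q ^+ j) ^+ 2) * qpoch a q j * qpoch (a * q ^+ (n + j).+1) q (n - j)
  / (qpoch q q (n - j) * qpoch q q j * qpoch (a * q * f) q j * qpoch (a * e * q) (q ^+ 2) j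
     * (1 - a) * qpoch (a * q ^+ 2) (q ^+ 2) n).

(** The certificate of the Watson-type summand, in these parameters. *)
Definition pair_cert q a f (n j : nat) : K :=
  let e := f^-1 in
  if j is m.+1 then
    (e - q) * (q ^+ (n - j).-1 - a * f * q ^+ j)
    * qpoch e q (n - j).-1 * qpoch (a * e) q (n + j) * qpoch e q j
    * qpoch (a * q * f) (q ^+ 2) j * (-1) ^+ j * qpoch a q j
    * qpoch (a * q ^+ (n + j)) q (n - j).+1
    / ((1 - q ^+ n) * qpoch q q (n - j) * qpoch q q m * qpoch (a * q * f) q j.+1
       * qpoch (a * e * q) (q ^+ 2) j * (1 - a) * qpoch (a * q ^+ 2) (q ^+ 2) n)
  else 0.

Definition pair_ratio q a f (n : nat) : K :=
  let e := f^-1 in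
  (1 - a * q) * (1 - a * q ^+ (2 * n).-1) * (1 - a * e) * (1 - e ^+ 2 * q ^+ (n - 2))
  / ((1 - q ^+ n) * (1 - a * q ^+ 2 * f)).

Section PTelescope.
Variables (q a f : K).
Hypotheses (q0 : q != 0) (f0 : f != 0).
Hypothesis q1 : forall j, 1 - q * q ^+ j != 0.
Hypothesis a1 : forall j, 1 - a * (q ^+ 2) ^+ j != 0.
Hypothesis af1 : forall j, 1 - a * q * f * q ^+ j != 0.
Hypothesis ae1 : forall j, 1 - a * f^-1 * q * (q ^+ 2) ^+ j != 0.
Let e := f^-1.

Let nq n : qpoch q q n != 0. Proof. exact: (proj1 (qpoch_neq0 _ _) q1 n). Qed.
Let naf n : qpoch (a * q * f) q n != 0. Proof. exact: (proj1 (qpoch_neq0 _ _) af1 n). Qed.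
Let nae n : qpoch (a * e * q) (q ^+ 2) n != 0. Proof. exact: (proj1 (qpoch_neq0 _ _) ae1 n). Qed.
Let na n : qpoch (a * q ^+ 2) (q ^+ 2) n != 0.
Proof. by have := proj1 (qpoch_neq0 _ _) a1 n.+1; rewrite qpochSl mulf_eq0 negb_or => /andP[]. Qed.
Let a0 : 1 - a != 0. Proof. by have := a1 0%N; rewrite expr0 mulr1. Qed.

(** The greatest common factor of the terms and certificates for n = J + d + 2 and
j = J or J + 1; with X = q^J and Y = q^d the cofactors are polynomials. *)
Definition pair_common d J : K :=
  qpoch e q d * qpoch (a * e) q (J + d + 2 + J) * qpoch e q J * qpoch (a * q * f) (q ^+ 2) J
  * (-1) ^+ J * qpoch a q J * qpoch (a * q ^+ (J + d + 2 + J).+1) q d.+2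
  / (qpoch q q d.+2 * qpoch q q J * qpoch (a * q * f) q J * qpoch (a * e * q) (q ^+ 2) J
     * (1 - a) * qpoch (a * q ^+ 2) (q ^+ 2) (J + d + 2) * (1 - q ^+ (J + d + 2))
     * (1 - a * q * f * q ^+ J) * (1 - a * q * f * (q * q ^+ J))
     * (1 - a * e * q * (q ^+ J) ^+ 2)).

Let qn1 d J : 1 - q * (q * (q ^+ J * q ^+ d)) != 0.
Proof. by rewrite -exprD -exprS. Qed.

Lemma pair_term_common d J : let X := q ^+ J in let Y := q ^+ d in
  pair_term q a f (J + d + 2) J = pair_common d J *
  ((1 - e * Y) * (1 - e * (q * Y)) * (1 - a * X ^+ 2) * (1 - q ^+ (J + d + 2))
   * (1 - a * q * f * X) * (1 - a * q * f * (q * X)) * (1 - a * e * q * X ^+ 2)).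
Proof.
rewrite /pair_term /pair_common -/e /= (_ : J + d + 2 - J = d.+2)%N; last by lia.
have H0 := a0; have nE1 : (J + d + 2 + J = (J + d + J).+2)%N by rewrite addn2 !addSn.
have H1 := af1 J; have H2 := af1 J.+1; have H3 : 1 - a * e * q * (q ^+ J) ^+ 2 != 0 by rewrite -expr_sqr; exact: ae1.
have H4 := @qn1 d J.
have H5 := nq d.+2; have H6 := nq J; have H7 := naf J; have H8 := nae J.
have H9 := na (J + d + 2).
have En : q ^+ (J + d + 2) = q * (q * (q ^+ J * q ^+ d)) by rewrite !exprD; ring.
rewrite exprS in H2; rewrite En (qpochS e q d.+1) (qpochS e q d) exprS.
opaque_factors K; field; nonzero.
Qed.

Lemma pair_term_shift d J : let X := q ^+ J in let Y := q ^+ d in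
  pair_ratio q a f (J + d + 2) * pair_term q (a * q ^+ 2) f (J + d) J = pair_common d J *
  ((1 - e ^+ 2 * (X * Y)) * (1 - a * q * f * X ^+ 2) * (1 - a * q ^+ 2 * X ^+ 2)
   * (1 - a * X) * (1 - a * (q * X)) * (1 - q * Y) * (1 - q * (q * Y))).
Proof.
move=> X Y.
rewrite /pair_term /pair_ratio /pair_common -/e /= (_ : J + d - J = d)%N; last by lia.
rewrite (_ : J + d + 2 - 2 = J + d)%N; last by lia.
rewrite (_ : (2 * (J + d + 2)).-1 = (J + J + d + d).+3)%N; last by lia.
have H0 := a0; have nE1 : (J + d + 2 + J = (J + d + J).+2)%N by rewrite addn2 !addSn.
have H1 := af1 J; have H2 := af1 J.+1; have H3 : 1 - a * e * q * (q ^+ J) ^+ 2 != 0 by rewrite -expr_sqr; exact: ae1.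
have H4 := @qn1 d J.
have H5 := nq d; have H6 := nq J; have H7 := naf J; have H8 := nae J.
have H9 := na (J + d + 2); have H10 := q1 d; have H11 := q1 d.+1.
have H12 := af1 0; have H13 := af1 1; have H14 := ae1 0%N.
have H15 := a1 1.
have En : q ^+ (J + d + 2) = q * (q * (q ^+ J * q ^+ d)) by rewrite !exprD; ring.
rewrite ?(exprS, expr0, mulr1) in H2 H11 H12 H13 H14 H15.
rewrite mulrA in H15.
have H16 : 1 - a * q ^+ 2 * (q ^+ 2) ^+ (J + d) != 0 by rewrite -mulrA -exprS.
have H17 : 1 - a * q ^+ 2 * (q ^+ 2) ^+ (J + d).+1 != 0 by rewrite -mulrA -exprS.
rewrite -/X -/Y in H1 H2 H3 H4 H10 H11.
rewrite ?exprS ?expr_sqr ?exprD -/X -/Y in H16 H17.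
rewrite En !(qpochS q) (exprS q d) -/X -/Y.
have E1 : qpoch (a * e) q (J + d + 2 + J) = (1 - a * e) * (1 - a * e * q)
    * qpoch (a * q ^+ 2 * e) q (J + d + J).
  rewrite nE1.
  rewrite (_ : a * q ^+ 2 * e = a * e * q * q); last by ring.
  by rewrite 2!qpochSl mulrA.
have E2 : (1 - a * q * f * X ^+ 2) * qpoch (a * q * f) (q ^+ 2) J = (1 - a * q * f)
    * qpoch (a * q ^+ 2 * q * f) (q ^+ 2) J.
  rewrite mulrC -expr_sqr -qpochSr (_ : a * q * f * q ^+ 2 = a * q ^+ 2 * q * f) //; ring.
have E3 : qpoch (a * q ^+ (J + d + 2 + J).+1) q d.+2
   = qpoch (a * q ^+ 2 * q ^+ (J + d + J).+1) q d
     * (1 - a * q * (q ^+ 2 * (X * X * (Y * Y)))) * (1 - a * q ^+ 2 * (q ^+ 2 * (X * X * (Y * Y)))).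
  rewrite nE1 !qpochS.
  rewrite (_ : a * q ^+ (J + d + J).+3 = a * q ^+ 2 * q ^+ (J + d + J).+1); last by rewrite -mulrA -exprD.
  rewrite -[(J + d + J).+1]addn1 -[d.+1]addn1 !exprD -/X -/Y.
  by congr (_ * (1 - _) * (1 - _)); ring.
have E4 : (1 - a) * (1 - a * q) * qpoch (a * q ^+ 2) q J = qpoch a q J * (1 - a * X) * (1 - a * q * X).
  exact: qpoch_shift2.
have E5 : qpoch (a * q * f) q J = (1 - a * q * f) * (1 - a * q * f * q)
   * qpoch (a * q ^+ 2 * q * f) q J / ((1 - a * q * f * X) * (1 - a * q * f * (q * X))).
  rewrite (_ : a * q ^+ 2 * q * f = a * q * f * q ^+ 2); last by ring.
  rewrite qpoch_shift2 -[a * q * f * q * q ^+ J]mulrA -/X; opaque_factors K; field; nonzero.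
have E6 : qpoch (a * e * q) (q ^+ 2) J = (1 - a * e * q) *
   qpoch (a * q ^+ 2 * e * q) (q ^+ 2) J / (1 - a * e * q * X ^+ 2).
  rewrite (_ : a * q ^+ 2 * e * q = a * e * q * q ^+ 2); last by ring.
  rewrite qpochSr expr_sqr -/X; opaque_factors K; field; nonzero.
have E7 : qpoch (a * q ^+ 2) (q ^+ 2) (J + d + 2) = (1 - a * q ^+ 2) *
   qpoch (a * q ^+ 2 * q ^+ 2) (q ^+ 2) (J + d) * (1 - a * q ^+ 2 * (q ^+ 2 * (X * Y) ^+ 2)).
  rewrite addn2 qpochS qpochSl; congr (_ * (1 - _ * _)).
  by rewrite exprS expr_sqr exprD.
have E8 : q ^+ (J + J + d + d).+3 = q * (q ^+ 2 * (X * X * (Y * Y))).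
  by rewrite -addn3 !exprD -/X -/Y; ring.
rewrite E8 E1 E3 exprD -/X -/Y.
rewrite -mulrA in E4.
have -> : 1 - a * (q * X) = 1 - a * q * X by rewrite mulrA.
have nA : qpoch (a * q ^+ 2 * q ^+ 2) (q ^+ 2) (J + d) != 0.
  by have := H9; rewrite E7 !mulf_eq0 !negb_or => /andP[/andP[]].
have nB : qpoch (a * q ^+ 2 * e * q) (q ^+ 2) J != 0.
  by have := H8; rewrite E6 !mulf_eq0 !negb_or => /andP[/andP[]].
have nC : qpoch (a * q ^+ 2 * q * f) q J != 0.
  by have := H7; rewrite E5 !mulf_eq0 !negb_or => /andP[/andP[]].
have H18 : 1 - a * e * q != 0 by have := ae1 0%N; rewrite expr0 mulr1.
have H19 : 1 - a * q ^+ 2 * (q ^+ 2 * (X * Y) ^+ 2) != 0.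
  by have := H9; rewrite E7 mulf_eq0 negb_or => /andP[].
rewrite E5 E6 E7.
have H20 : 1 - a * q ^+ 2 * f != 0 by nonzero.
have Z1 : a * (q * (q ^+ 2 * (X * X * (Y * Y)))) = a * q * (q ^+ 2 * (X * Y) ^+ 2) by ring.
have Z2 : a * q * (q ^+ 2 * (X * X * (Y * Y))) = a * q * (q ^+ 2 * (X * Y) ^+ 2) by ring.
have Z3 : a * q ^+ 2 * (q ^+ 2 * (X * X * (Y * Y))) = a * q ^+ 2 * (q ^+ 2 * (X * Y) ^+ 2) by ring.
have Z4 : a * q ^+ 2 * f = a * q * f * q by ring.
rewrite Z1 Z2 Z3 Z4.
have H15' : 1 - a * q ^+ 2 != 0 by nonzero.
clear H20 E1 E3 E5 E6 E7 E8 Z1 Z2 Z3 Z4 En nE1 H7 H8 H9 H14 H16 H17 H15.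
clear q1 a1 af1 ae1 nq naf nae na a0 qn1.
have nE : 1 - a * q ^+ 2 * (q ^+ 2 * (X * Y) ^+ 2) != 0 by [].
pose C := (1 - a * q * (q ^+ 2 * (X * Y) ^+ 2)) * (1 - a * e) * (1 - e ^+ 2 * (X * Y))
  * qpoch e q d * qpoch (a * q ^+ 2 * e) q (J + d + J) * qpoch e q J * (-1) ^+ J
  * (1 - a * q ^+ 2 * X ^+ 2) * qpoch (a * q ^+ 2 * q ^+ (J + d + J).+1) q d
  / ((1 - q * (q * (X * Y))) * (1 - a * q * f * q) * qpoch q q d * qpoch q q J
     * qpoch (a * q ^+ 2 * q * f) q J * qpoch (a * q ^+ 2 * e * q) (q ^+ 2) J
     * (1 - a * q ^+ 2) * qpoch (a * q ^+ 2 * q ^+ 2) (q ^+ 2) (J + d)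
     * (1 - a) * (1 - a * q * f)).
transitivity (((1 - a) * ((1 - a * q) * qpoch (a * q ^+ 2) q J))
   * ((1 - a * q * f) * qpoch (a * q ^+ 2 * q * f) (q ^+ 2) J) * C);
   [|rewrite -E2 E4]; rewrite /C; clear C E2 E4; opaque_factors K; field; nonzero.
Qed.

Lemma pair_cert_common d J : let X := q ^+ J in let Y := q ^+ d in
  pair_cert q a f (J + d + 2) J = pair_common d J *
  ((e - q) * (q * Y - a * f * X) * (1 - a * (q * (q * (X * Y))) * X) * (1 - e * Y) * (1 - X)
   * (1 - a * q * f * (q * X)) * (1 - a * e * q * X ^+ 2)).
Proof.
move=> X Y; case: J @X => [|m] X; first by rewrite /pair_cert /X expr0 subrr mulr0 !mul0r mulr0.
rewrite /pair_cert /pair_common -/e (_ : m.+1 + d + 2 - m.+1 = d.+2)%N; last by lia.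
have H0 := a0; have H1 := af1 m.+1; have H2 := af1 m.+2.
have H3 : 1 - a * e * q * X ^+ 2 != 0 by rewrite -expr_sqr; exact: ae1.
have H4 := @qn1 d m.+1; have H5 := nq d.+2; have H6 := nq m; have H7 := naf m.+1.
have H8 := nae m.+1; have H9 := na (m.+1 + d + 2); have H10 := q1 m.
have En : q ^+ (m.+1 + d + 2) = q * (q * (X * Y)) by rewrite !exprD -/X -/Y; ring.
have EX : q ^+ m.+2 = q * X by rewrite exprS.
rewrite EX -/X in H1 H2 H4; rewrite /= -exprS -/X in H10.
have EG : qpoch (a * q ^+ (m.+1 + d + 2 + m.+1)) q d.+3 =
   (1 - a * (q * (q * (X * Y))) * X) * qpoch (a * q ^+ (m.+1 + d + 2 + m.+1).+1) q d.+2.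
  rewrite qpochSl -[a * _ * q]mulrA -exprSr; congr ((1 - _) * _).
  by rewrite exprD En -/X !mulrA.
rewrite EG (qpochS e q d) (qpochS q q m) (qpochS (a * q * f) q m.+1) -exprS -/X -/Y En.
rewrite /= (exprS q d) -/Y.
rewrite -/Y in H4.
opaque_factors K; field; nonzero.
Qed.

Lemma pair_cert_next d J : let X := q ^+ J in let Y := q ^+ d in
  pair_cert q a f (J + d + 2) J.+1 = - pair_common d J *
  ((e - q) * (Y - a * f * (q * X)) * (1 - a * e * (q * (q * (X * Y))) * X) * (1 - e * X)
   * (1 - a * q * f * X ^+ 2) * (1 - a * X) * (1 - q * (q * Y))).
Proof.
move=> X Y.
rewrite /pair_cert /pair_common -/e (_ : J + d + 2 - J.+1 = d.+1)%N; last by lia.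
have H0 := a0; have H1 := af1 J; have H2 := af1 J.+1.
have H3 : 1 - a * e * q * X ^+ 2 != 0 by rewrite -expr_sqr; exact: ae1.
have H4 := @qn1 d J; have H5 := nq d.+1; have H6 := nq J; have H7 := naf J.
have H8 := nae J; have H9 := na (J + d + 2); have H11 := q1 d.+1.
have En : q ^+ (J + d + 2) = q * (q * (X * Y)) by rewrite !exprD -/X -/Y; ring.
rewrite (exprS q J) -/X in H2; rewrite -/X in H1; rewrite -/X -/Y in H4.
rewrite (exprS q d) -/Y in H11.
have -> : (J + d + 2 + J.+1 = (J + d + 2 + J).+1)%N by rewrite addnS.
rewrite (qpochS (a * e)) (qpochS e q J) (qpochS (a * q * f) (q ^+ 2) J) (qpochS a q J).
rewrite (qpochS q q d.+1) !(qpochS (a * q * f) q _) (qpochS (a * e * q)) !expr_sqr.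
rewrite exprD En /= (exprS q J) (exprS q d) (exprS (-1) J) -/X -/Y.
rewrite (mulrA (a * e)); opaque_factors K; field; nonzero.
Qed.

(** After division by [pair_common] this is a polynomial identity in q^j and
q^(n-j).  The passage from n + 2 to n corresponds to b |-> b q^2 for b = q^(-n). *)
Lemma pair_term_telescope n J : (J <= n.+1)%N ->
  \sum_(j < J) (pair_term q a f n.+2 j - pair_ratio q a f n.+2 * pair_term q (a * q ^+ 2) f n j)
  = pair_cert q a f n.+2 J.
Proof.
elim: J => [|J IHJ] leJn; first by rewrite big_ord0.
set R := RHS; rewrite big_ord_recr /= IHJ ?(ltnW leJn) // {}/R; rewrite ltnS in leJn.
have [d ->] : exists d, n = (J + d)%N by exists (n - J)%N; rewrite subnKC.
rewrite -addn2 (pair_term_common d J) (pair_term_shift d J) (pair_cert_common d J) (pair_cert_next d J).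
rewrite -mulrBr -mulrDr mulNr -mulrN; congr (_ * _); rewrite /e.
set En := q ^+ (J + d + 2).
have -> : En = q * (q * (q ^+ J * q ^+ d)) by rewrite /En !exprD; ring.
by clear En; move: (q ^+ J) (q ^+ d) => X Y; field; nonzero.
Qed.

(** The terms with j = n + 1 and j = n + 2 have no counterpart in the shorter sum
and cancel the certificate exactly. *)
Lemma pair_term_end n :
  pair_cert q a f n.+2 n.+1 + pair_term q a f n.+2 n.+1 + pair_term q a f n.+2 n.+2 = 0.
Proof.
rewrite /pair_cert /pair_term -/e subnn (_ : n.+2 - n.+1 = 1)%N; last by lia.
rewrite (_ : n.+2 + n.+2 = (n.+2 + n.+1).+1)%N; last by lia.
set N := (n.+2 + n.+1)%N.
have NE : q ^+ N = q * (q ^+ n.+1) ^+ 2 by rewrite /N -[n.+2]addn1 !exprD; ring.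
have H0 := a0; have H1 := af1 n.+1; have H2 := q1 n.
have H3 : 1 - a * e * q * (q ^+ n.+1) ^+ 2 != 0 by rewrite -expr_sqr; exact: ae1.
have H4 := q1 n.+1; have H5 := q1 0%N; have H6 := nq n; have H7 := naf n.+1.
have H8 := nae n.+1; have H9 := na n.+2.
rewrite expr0 mulr1 in H5.
rewrite [qpoch (a * q ^+ N) q 2]qpochS !qpoch1 !qpoch0 expr1.
rewrite (qpochS (a * e)) (qpochS e q n.+1) (qpochS (a * q * f) (q ^+ 2) n.+1) (qpochS a q n.+1).
rewrite !(qpochS q q _) (qpochS (a * q * f) q n.+1) (qpochS (a * e * q) (q ^+ 2) n.+1) expr_sqr.
rewrite (exprSr q N) NE /= (exprSr (-1) n.+1) (exprSr q n.+1).
rewrite -(exprS q n) expr0 in H2 *.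
move: (q ^+ n.+1) H1 H2 H3 H4 ((-1) ^+ n.+1) => X H1 H2 H3 H4 s.
(* The three quantities divided by their common factor D sum to 0 as polynomials. *)
pose D := qpoch (a * e) q N * qpoch e q n.+1 * qpoch (a * q * f) (q ^+ 2) n.+1 * s * qpoch a q n.+1
  / ((1 - q) * (qpoch q q n * (1 - X) * (1 - q * X)) * (qpoch (a * q * f) q n.+1 * (1 - a * q * f * X)) *
   (qpoch (a * e * q) (q ^+ 2) n.+1 * (1 - a * e * q * X ^+ 2)) * (1 - a) * qpoch (a * q ^+ 2) (q ^+ 2) n.+2).
transitivity (D * ((e - q) * (1 - a * f * X) * (1 - a * (q * X ^+ 2)) * (1 - a * (q * X ^+ 2 * q))
     * (1 - X) * (1 - a * e * q * X ^+ 2)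
   + (1 - e) * (1 - a * X ^+ 2) * (1 - a * (q * X ^+ 2 * q)) * (1 - q * X) * (1 - a * q * f * X) * (1 - a * e * q * X ^+ 2)
   - (1 - a * e * (q * X ^+ 2)) * (1 - e * X) * (1 - a * q * f * X ^+ 2) * (1 - a * (X * q) ^+ 2) * (1 - a * X) * (1 - q))).
  rewrite /D (mulrC X q) (mulrA (a * e)) -[a * _ * q]mulrA; opaque_factors K; field; nonzero.
rewrite (_ : _ - _ = 0) ?mulr0 // /e; field; nonzero.
Qed.

End PTelescope.

End Algebra.

(** * Evaluation of the finite sum *)

Section Algebra.
Variable K : numFieldType.
Implicit Types x y z q a b e k : K.

(** The telescoping relation links n to n - 2 and shifts a by q^2.  The values at
n = 0 and n = 1 are 1 and 0, which is the origin of the distinction by parity. *)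
Lemma pair_sum q (f : K) n : q != 0 -> f != 0 ->
  (forall j, 1 - q * q ^+ j != 0) ->
  forall a, (forall j, 1 - a * (q ^+ 2) ^+ j != 0) ->
  (forall j, 1 - a * q * f * q ^+ j != 0) ->
  (forall j, 1 - a * f^-1 * q * (q ^+ 2) ^+ j != 0) ->
  \sum_(j < n.+1) pair_term q a f n j =
  if odd n then 0 else
  qpoch (a * q) (q ^+ 2) n * qpoch (a * f^-1) (q ^+ 2) n./2 * qpoch (f^-1 ^+ 2) (q ^+ 2) n./2
  / (qpoch (q ^+ 2) (q ^+ 2) n./2 * qpoch (a * q ^+ 2 * f) (q ^+ 2) n./2).
Proof.
move=> q0 f0 q1; elim/ltn_ind: n => -[|[|n]] IHn a a1 af1 ae1.
- have := a1 0%N; rewrite expr0 mulr1 => a0.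
  rewrite big_ord_recr big_ord0 /=. rewrite /pair_term subn0 !qpoch0 !expr0 expr1n; field; nonzero.
- rewrite !big_ord_recr big_ord0 /= add0r /pair_term subn0 subnn.
  rewrite !qpochS !qpoch0 !expr0 !expr1 !expr1n.
  have fa : f - a * q != 0.
    by rewrite (_ : f - a * q = f * (1 - a / f * q * (q ^+ 2) ^+ 0)) ?mulf_neq0 //; field.
  have := a1 0%N; have := a1 1%N; have := af1 0%N; have := af1 1%N.
  have := ae1 0%N; have := ae1 1%N; have := q1 0%N; have := q1 1%N.
  rewrite !expr0 !expr1 => *; field; nonzero.
have E : \sum_(j < n.+3) pair_term q a f n.+2 j
    = pair_ratio q a f n.+2 * \sum_(j < n.+1) pair_term q (a * q ^+ 2) f n j.
  have := pair_term_end q0 f0 q1 a1 af1 ae1 n.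
  have := pair_term_telescope q0 f0 q1 a1 af1 ae1 (leqnn n.+1).
  rewrite big_split sumrN -mulr_sumr => <- Z.
  have -> (F : nat -> K) : \sum_(j < n.+3) F j = \sum_(j < n.+1) F j + F n.+1 + F n.+2.
    by rewrite 2!big_ord_recr.
  apply/eqP; rewrite -subr_eq0; apply/eqP; apply: etrans Z.
  move: (\sum_(_ < n.+1) _) (\sum_(_ < n.+1) _) => S1 S2 /=; ring.
rewrite E IHn //=; last first.
- by move=> j; have := ae1 j.+1; rewrite exprS; congr (_ != _); ring.
- move=> j; have := af1 j.+2; rewrite -addn2 exprD; congr (_ != _); ring.
- by move=> j; have := a1 j.+1; rewrite exprS mulrA.
rewrite negbK; case en: (odd n) => /=; first by rewrite mulr0.
set m := n./2.
have {en} En : n = (m + m)%N by rewrite addnn -[LHS]odd_double_half en.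
have E1 : qpoch (a * q) (q ^+ 2) n.+2 = (1 - a * q) * qpoch (a * q ^+ 2 * q) (q ^+ 2) n
    * (1 - a * q * q ^+ 2 * (q ^+ 2) ^+ n).
  rewrite (_ : a * q ^+ 2 * q = a * q * q ^+ 2); last by ring.
  by rewrite qpochS qpochSl (exprS (q ^+ 2)) mulrA.
have E2 : qpoch (a * f^-1) (q ^+ 2) m.+1 = (1 - a * f^-1) * qpoch (a * q ^+ 2 * f^-1) (q ^+ 2) m.
  rewrite (_ : a * q ^+ 2 * f^-1 = a * f^-1 * q ^+ 2) ?qpochSl //; ring.
have E3 : qpoch (a * q ^+ 2 * f) (q ^+ 2) m.+1 = (1 - a * q ^+ 2 * f) * qpoch (a * q ^+ 2 * q ^+ 2 * f) (q ^+ 2) m.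
  rewrite (_ : a * q ^+ 2 * q ^+ 2 * f = a * q ^+ 2 * f * q ^+ 2) ?qpochSl //; ring.
rewrite E1 E2 E3 !(qpochS _ _ m) /pair_ratio (_ : (2 * n.+2).-1 = (n + n).+3)%N; last by lia.
have n1 : forall j, qpoch (q ^+ 2) (q ^+ 2) j != 0.
  apply/qpoch_neq0 => j.
  by have := q1 j.*2.+1; rewrite -mul2n exprS exprM mulrA -expr2.
have n2 : forall j, qpoch (a * q ^+ 2 * f) (q ^+ 2) j != 0.
  apply/qpoch_neq0 => j.
  by have := af1 j.*2.+1; rewrite -mul2n exprS exprM; congr (_ != _); ring.
have H1 := n1 m; have H2 := n1 m.+1; have H3 := n2 m; have H4 := n2 m.+1.
rewrite qpochS mulf_eq0 negb_or in H2; case/andP: H2 => _ H2.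
rewrite E3 mulf_eq0 negb_or in H4; case/andP: H4 => H5 H4.
rewrite (_ : n.+2 - 2 = n)%N; last by rewrite -addn2 addnK.
rewrite -[n.+2]addn2 -[(n + n).+3]addn3 !expr_sqr in H2 *.
have -> : q ^+ n = (q ^+ m) ^+ 2 by rewrite En exprD.
have En2 : q ^+ (n + n + 3) = q * q ^+ 2 * ((q ^+ m) ^+ 2) ^+ 2.
  by rewrite !exprD En !exprD; ring.
have En3 : q ^+ (n + 2) = q ^+ 2 * (q ^+ m) ^+ 2 by rewrite exprD En !exprD; ring.
rewrite En2 En3 in H2 *; move: (qpoch (a * q ^+ 2 * q ^+ 2 * f) _ _) H4 => Q H4; field; nonzero.
Qed.
End Algebra.

(** * The absolute value of the complex numbers *)
(** A real-valued absolute value compatible with the norm topology of K.  The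
estimates below need a totally ordered target, which the norm of K, with values in
K, does not provide.  The last three fields are the only facts about the topology
of K that enter besides the continuity of the field operations. *)
Record complete_abs (R : realType) (K : numFieldType) (nm : K -> R) : Prop := {
  nm_ge0 : forall z, 0 <= nm z;
  nm_eq0 : forall z, (nm z == 0) = (z == 0);
  nmM : forall z w, nm (z * w) = nm z * nm w;
  nmD : forall z w, nm (z + w) <= nm z + nm w;
  nm_lt1 : forall z, (`|z| < 1) = (nm z < 1);
  cvg_nm : forall (u : nat -> K) (l : K),
    u n @[n --> \oo] --> l <-> nm (u n - l) @[n --> \oo] --> (0 : R);
  nm_series : forall (u : nat -> K) (v : nat -> R),
    (forall n, nm (u n) <= v n) -> cvgn (series v) -> cvgn (series u);
  nm_normed_series : forall u : nat -> K,
    cvgn [normed series u] -> cvgn (series u) }.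

Section ComplexAbs.
Variable R : realType.
Local Notation C := (R[i] : numFieldType).
Local Notation nm := (@Normc.normc R).

Let nE (z : C) : `|z| = (nm z)%:C. Proof. by case: z. Qed.

Let n_ge0 (z : C) : 0 <= nm z. Proof. by case: z => a b; exact: sqrtr_ge0. Qed.

Let n_distC (z w : C) : nm (z - w) = nm (w - z).
Proof. by rewrite -[in RHS]normcN opprB. Qed.

Let n_Re (z : C) : `|complex.Re z| <= nm z.
Proof. by case: z => a b /=; rewrite -sqrtr_sqr ler_wsqrtr // lerDl sqr_ge0. Qed.

Let n_Im (z : C) : `|complex.Im z| <= nm z.
Proof. by case: z => a b /=; rewrite -sqrtr_sqr ler_wsqrtr // lerDr sqr_ge0. Qed.

Let n_ReIm (z : C) : nm z <= `|complex.Re z| + `|complex.Im z|.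
Proof.
case: z => a b /=.
rewrite -[leRHS]ger0_norm ?addr_ge0 // -sqrtr_sqr ler_wsqrtr //.
rewrite sqrrD !real_normK ?num_real // -addrA lerD2l lerDr.
by rewrite mulrn_wge0 // mulr_ge0.
Qed.

Let n_cvg (u : nat -> C) (l : C) :
  u n @[n --> \oo] --> l <-> nm (u n - l) @[n --> \oo] --> (0 : R).
Proof.
split=> [/cvgrPdist_lt H | /cvgrPdist_lt H]; apply/cvgrPdist_lt => e e0.
  have e0' : (0 : C) < e%:C by rewrite ltcR.
  near=> n; rewrite sub0r normrN ger0_norm ?n_ge0 // n_distC -ltcR -nE.
  by near: n; exact: H.
have eE : e = (complex.Re e)%:C by rewrite RRe_real // gtr0_real.
have e0' : 0 < complex.Re e by rewrite -ltcR -eE.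
near=> n; rewrite eE nE ltcR.
have : `|0 - nm (u n - l)| < complex.Re e by near: n; exact: H.
by rewrite sub0r normrN ger0_norm ?n_ge0 // n_distC.
Unshelve. all: by end_near. Qed.

Let n_series (u : nat -> C) (v : nat -> R) :
  (forall n, nm (u n) <= v n) -> cvgn (series v) -> cvgn (series u : nat -> C).
Proof.
move=> uv cv.
have v0 n : 0 <= v n by apply: le_trans (uv n); exact: n_ge0.
have cRe : cvgn (series (fun n => complex.Re (u n))).
  apply: normed_cvg; apply: (series_le_cvg _ v0 _ cv) => n //=.
  exact: le_trans (n_Re _) (uv n).
have cIm : cvgn (series (fun n => complex.Im (u n))).
  apply: normed_cvg; apply: (series_le_cvg _ v0 _ cv) => n //=.
  exact: le_trans (n_Im _) (uv n).
set a := limn (series (fun n => complex.Re (u n))) in cRe.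
set b := limn (series (fun n => complex.Im (u n))) in cIm.
apply/cvg_ex; exists ((a +i* b) : C).
have seriesE n : series u n =
    (series (fun n => complex.Re (u n)) n +i* series (fun n => complex.Im (u n)) n).
  rewrite /series /=; elim: n => [|n IH]; first by rewrite !big_geq.
  by rewrite !big_nat_recr //= IH; case: (u n).
apply/n_cvg.
apply: (@squeeze_cvgr _ _ _ _ (cst 0) (fun n => `|series (fun n => complex.Re (u n)) n - a|
   + `|series (fun n => complex.Im (u n)) n - b|)); last 2 first.
- exact: cvg_cst.
- rewrite -[0 : R](addr0 0); apply: cvgD.
    by rewrite -(normr0 R) -(subrr a); apply: cvg_norm; apply: cvgB => //; apply: cvg_cst.
  by rewrite -(normr0 R) -(subrr b); apply: cvg_norm; apply: cvgB => //; apply: cvg_cst.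
near=> n; rewrite n_ge0 /=. have {}seriesE := seriesE n; rewrite {1}/series /= in seriesE.
by rewrite seriesE; exact: n_ReIm.
Unshelve. all: by end_near. Qed.

Let n_normed (u : nat -> C) :
  cvgn [normed series u] -> cvgn (series u : nat -> C).
Proof.
move=> /cvg_ex [l /n_cvg ul]; apply: (@n_series _ (fun n => nm (u n))) => //.
apply/cvg_ex; exists (complex.Re l); apply/cvgrPdist_lt => e e0.
move/cvgrPdist_lt: ul => /(_ e e0) [N _ H]; exists N => // n /H /=.
rewrite sub0r normrN ger0_norm ?n_ge0 //; apply: le_lt_trans.
rewrite distrC; apply: le_trans (n_Re _); rewrite raddfB /=.
rewrite (_ : series _ n = complex.Re ([normed series u] n)) //.
rewrite /series /= [RHS](raddf_sum (@complex.Re R)); apply: eq_bigr => i _.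
by case: (u i).
Qed.

Lemma complex_complete_abs : @complete_abs R C nm.
Proof.
split; [exact: n_ge0 | | exact: Normc.normcM | exact: le_normcD | | exact: n_cvg
  | exact: n_series | exact: n_normed] => z.
- by apply/eqP/eqP => [/Normc.eq0_normc | ->] //; rewrite Normc.normc0.
- by rewrite nE -[1]/((1 : R)%:C) ltcR.
Qed.

End ComplexAbs.

(** * Limits and infinite products *)
Section AbsTheory.
Variables (R : realType) (K : numFieldType) (nm : K -> R).
Hypothesis A : complete_abs nm.
Implicit Types (x y z q : K) (r B : R).

Let nmge0 := nm_ge0 A.

Lemma nm0 : nm 0 = 0. Proof. by apply/eqP; rewrite (nm_eq0 A). Qed.

Lemma nm_gt0 z : (0 < nm z) = (z != 0).
Proof. by rewrite lt_neqAle nmge0 andbT eq_sym (nm_eq0 A). Qed.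

Lemma nm1 : nm 1 = 1.
Proof.
have n1 : nm 1 != 0 by rewrite (nm_eq0 A) oner_eq0.
by apply: (mulfI n1); rewrite -(nmM A) !mulr1.
Qed.

Lemma nmN z : nm (- z) = nm z.
Proof.
rewrite -mulN1r (nmM A) (_ : nm (-1) = 1) ?mul1r //.
have : nm (-1) ^+ 2 == 1 by rewrite expr2 -(nmM A) mulrNN mulr1 nm1.
rewrite sqrf_eq1 => /orP[/eqP //|/eqP E].
by have := nmge0 (-1); rewrite E oppr_ge0 ler10.
Qed.

Lemma nm_distC z y : nm (z - y) = nm (y - z).
Proof. by rewrite -nmN opprB. Qed.

Lemma nmB z y : nm (z - y) <= nm z + nm y.
Proof. by rewrite -(nmN y); exact: (nmD A). Qed.

Lemma nmX z n : nm (z ^+ n) = nm z ^+ n.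
Proof. by elim: n => [|n IH]; rewrite ?expr0 ?nm1 // !exprS (nmM A) IH. Qed.

Lemma nmV z : nm z^-1 = (nm z)^-1.
Proof.
have [->|z0] := eqVneq z 0; first by rewrite invr0 nm0 invr0.
have n0 : nm z != 0 by rewrite (nm_eq0 A).
by apply: (mulfI n0); rewrite -(nmM A) !divff ?nm1.
Qed.

Lemma nm_sum n (F : nat -> K) : nm (\sum_(i < n) F i) <= \sum_(i < n) nm (F i).
Proof.
elim: n => [|n IH]; first by rewrite !big_ord0 nm0.
by rewrite !big_ord_recr /=; apply: le_trans (nmD A _ _) _; rewrite lerD2r.
Qed.

Lemma nm_cvg_le (u : nat -> K) (l : K) (v : nat -> R) :
  (forall n, nm (u n - l) <= v n) -> v n @[n --> \oo] --> (0 : R) ->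
  u n @[n --> \oo] --> l.
Proof.
move=> uv v0; apply/(cvg_nm A); apply: squeeze_cvgr v0; last exact: cvg_cst.
by near=> n; rewrite nmge0 uv.
Unshelve. all: by end_near. Qed.

Lemma limnK (u : nat -> K) (l : K) : u n @[n --> \oo] --> l -> limn u = l.
Proof. by move=> ul; apply: cvg_lim. Qed.

Lemma cvgK_unique (u : nat -> K) (l m : K) :
  u n @[n --> \oo] --> l -> u n @[n --> \oo] --> m -> l = m.
Proof. by move=> /limnK <- /limnK. Qed.

Lemma cvg_eventually (u v : nat -> K) (l : K) N :
  (forall n, (N <= n)%N -> u n = v n) ->
  v n @[n --> \oo] --> l -> u n @[n --> \oo] --> l.
Proof.
move=> uv; apply: cvg_trans; apply: near_eq_cvg; near=> n.
by rewrite uv //; near: n; exists N.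
Unshelve. all: by end_near. Qed.

Lemma cvg_subseq (u : nat -> K) (l : K) (phi : nat -> nat) :
  (forall n, (n <= phi n)%N) -> u n @[n --> \oo] --> l ->
  u (phi n) @[n --> \oo] --> l.
Proof.
move=> le_phi ul; apply: (cvg_comp phi u _ ul) => P [N _ PN].
by exists N => // n /= Nn; apply: PN => /=; apply: leq_trans (le_phi n).
Qed.

Lemma nm_cvg_bounded (u : nat -> K) (l : K) B : u n @[n --> \oo] --> l ->
  (forall n, nm (u n) <= B) -> nm l <= B.
Proof.
move=> /(cvg_nm A) ul uB; apply/ler_addgt0Pr => e e0.
have /cvgrPdist_lt /(_ e e0) [N _ H] := ul.
have := H N (leqnn N); rewrite /= sub0r normrN ger0_norm ?nmge0 // => Hl.
have -> : l = u N - (u N - l) by rewrite opprB addrC subrK.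
by apply: le_trans (nmB _ _) _; apply: lerD (uB N) (ltW Hl).
Qed.

Lemma exp_small r e : 0 <= r -> r < 1 -> 0 < e -> exists N, r ^+ N <= e.
Proof.
move=> r0 r1 e0.
have : (fun n => 1 * r ^+ n) @ \oo --> (0 : R) by apply: cvg_geometric; rewrite ger0_norm.
move/cvgrPdist_lt => /(_ e e0) [N _ /(_ N (leqnn N))] /=.
by rewrite sub0r mul1r normrN ger0_norm ?exprn_ge0 // => /ltW ?; exists N.
Qed.

Lemma cvg_geo B r : 0 <= r -> r < 1 -> (fun n => B * r ^+ n) @ \oo --> (0 : R).
Proof. by move=> r0 r1; apply: cvg_geometric; rewrite ger0_norm. Qed.

Lemma geo_sum_le r n : 0 <= r -> r < 1 -> \sum_(j < n) r ^+ j <= (1 - r)^-1.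
Proof.
move=> r0 r1; have p : 0 < 1 - r by rewrite subr_gt0.
have E : \sum_(j < n) r ^+ j * (1 - r) = 1 - r ^+ n.
  elim: n => [|n IH]; first by rewrite big_ord0 expr0 subrr.
  by rewrite big_ord_recr /= IH exprS; ring.
rewrite -(ler_pM2r p) mulVf ?gt_eqF // mulr_suml E.
by rewrite gerBl exprn_ge0.
Qed.

Section QInf.
Variable q : K.
Hypothesis q1 : nm q < 1.
Let r := nm q.
Let r0 : 0 <= r. Proof. exact: nmge0. Qed.
Let r1 : 0 < 1 - r. Proof. by rewrite subr_gt0. Qed.

(** Each factor changes the product by at most |y| |q|^n times its size, which stays
below 2; the total is a geometric sum. *)
Lemma qpoch_near1 y n : nm y / (1 - r) <= 1 / 4%:R ->
  nm (qpoch y q n - 1) <= 2%:R * (nm y / (1 - r)).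
Proof.
move=> y_small.
have S m : nm y * \sum_(j < m) r ^+ j <= nm y / (1 - r).
  by rewrite ler_wpM2l ?nmge0 // geo_sum_le.
suff: nm (qpoch y q n - 1) <= 2%:R * (nm y * \sum_(j < n) r ^+ j).
  by move=> /le_trans; apply; rewrite ler_wpM2l.
elim: n => [|n IH]; first by rewrite qpoch0 subrr nm0 big_ord0 !mulr0.
rewrite qpochS big_ord_recr /=.
have nP : nm (qpoch y q n) <= 2%:R.
  rewrite -(subrK 1 (qpoch y q n)); apply: le_trans (nmD A _ _) _; rewrite nm1.
  have := S n; lra.
have -> : qpoch y q n * (1 - y * q ^+ n) - 1 =
   (qpoch y q n - 1) - qpoch y q n * (y * q ^+ n) by ring.
apply: le_trans (nmB _ _) _; rewrite mulrDr mulrDr; apply: lerD => //.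
by rewrite !(nmM A) nmX ler_wpM2r // mulr_ge0 ?nmge0 ?exprn_ge0.
Qed.

(** Beyond an index N that depends only on B, the tail of the product is close to 1;
the first N factors are at most 1 + B. *)
Lemma qpoch_bounded B : exists M, 1 <= M /\
  forall y, nm y <= B -> forall n, nm (qpoch y q n) <= M.
Proof.
have [B0|B0] := ltP B 0.
  by exists 1; split => // y yB; have := nmge0 y; rewrite leNgt (le_lt_trans yB B0).
pose e := (1 - r) / 4%:R / (B + 1).
have e0 : 0 < e by rewrite !divr_gt0 // ltr_wpDl.
have [N rN] := exp_small r0 q1 e0.
have B1 : 1 <= (1 + B) ^+ N by rewrite exprn_ege1 // lerDl.
exists ((1 + B) ^+ N * 2%:R); split; first by lra.
move=> y yB.
have r_le1 j : r ^+ j <= 1 by rewrite exprn_ile1 // ltW.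
have fac j : nm (1 - y * q ^+ j) <= 1 + B.
  apply: le_trans (nmB _ _) _; rewrite nm1 lerD2l (nmM A) nmX.
  by apply: le_trans yB; rewrite ler_piMr ?nmge0.
have small n : (n <= N)%N -> nm (qpoch y q n) <= (1 + B) ^+ n.
  elim: n => [|n IH] nN; first by rewrite qpoch0 nm1 expr0.
  by rewrite qpochS (nmM A) exprSr ler_pM ?nmge0 // IH // ltnW.
move=> n; have [nN|/ltnW Nn] := leqP n N.
  apply: le_trans (small n nN) _.
  apply: (@le_trans _ _ ((1 + B) ^+ N)); last by rewrite ler_peMr ?ler1n // (le_trans ler01).
  by rewrite ler_weXn2l // lerDl.
rewrite -(subnKC Nn) qpochD (nmM A) ler_pM ?nmge0 ?small //.
have near : nm (y * q ^+ N) / (1 - r) <= 1 / 4%:R.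
  rewrite ler_pdivrMr // (nmM A) nmX.
  have : nm y * r ^+ N <= B * e by rewrite ler_pM ?nmge0 ?exprn_ge0.
  move=> /le_trans; apply.
  rewrite /e mulrCA mulrA [_ * B]mulrC.
  have t1 : B / (B + 1) <= 1 by rewrite ler_pdivrMr ?mul1r ?lerDl // ltr_wpDl.
  by rewrite mulrAC mul1r [leRHS]mulrC ler_piMl // divr_ge0 // ltW.
rewrite -(subrK 1 (qpoch _ _ _)); apply: le_trans (nmD A _ _) _; rewrite nm1.
have := qpoch_near1 (n - N) near; lra.
Qed.

(** Again the tail is close to 1, so a partial product is bounded below by half of the
N-th one; earlier partial products are recovered by dividing by a bounded one. *)
Lemma qpoch_lower y : (forall j, 1 - y * q ^+ j != 0) ->
  exists c, 0 < c /\ forall n, c <= nm (qpoch y q n).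
Proof.
move=> y1.
have P0 n : qpoch y q n != 0 by exact: (proj1 (qpoch_neq0 _ _) y1 n).
have [M [M1 PM]] := qpoch_bounded (nm y).
have [|N rN] := exp_small (e := (1 - r) / 4%:R / (nm y + 1)) r0 q1.
  by rewrite !divr_gt0 // ltr_wpDl ?nmge0.
have near n : (N <= n)%N -> nm (qpoch y q N) / (2%:R * M) <= nm (qpoch y q n).
  move=> Nn.
  have near : nm (y * q ^+ N) / (1 - r) <= 1 / 4%:R.
    rewrite ler_pdivrMr // (nmM A) nmX.
    have : nm y * r ^+ N <= nm y * ((1 - r) / 4%:R / (nm y + 1)) by rewrite ler_wpM2l ?nmge0.
    move=> /le_trans; apply.
    have t1 : nm y / (nm y + 1) <= 1 by rewrite ler_pdivrMr ?mul1r ?lerDl // ltr_wpDl ?nmge0.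
    by rewrite mulrA mulrAC mul1r [leRHS]mulrC ler_piMl // divr_ge0 // ltW.
  rewrite -(subnKC Nn) qpochD (nmM A) ler_wpM2l ?nmge0 //.
  apply: (@le_trans _ _ (1 / 2%:R)); first by rewrite mul1r lef_pV2 ?posrE ?ler_peMr //; lra.
  have := qpoch_near1 (n - N) near.
  have : 1 <= nm (qpoch (y * q ^+ N) q (n - N)) + nm (qpoch (y * q ^+ N) q (n - N) - 1).
    rewrite -[X in X <= _]nm1 nm_distC; apply: le_trans (nmD A _ _).
    by rewrite addrC subrK.
  lra.
have c0 : 0 < nm (qpoch y q N) / (2%:R * M) by rewrite divr_gt0 ?nm_gt0 //; lra.
exists (nm (qpoch y q N) / (2%:R * M)); split => // n.
have [/near //|/ltnW nN] := leqP N n.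
have yn : nm (y * q ^+ n) <= nm y.
  by rewrite (nmM A) nmX ler_piMr ?nmge0 // exprn_ile1 // ltW.
rewrite ler_pdivrMr; last by lra.
rewrite -(subnKC nN) qpochD (nmM A) ler_wpM2l ?nmge0 //.
by apply: le_trans (PM _ yn _) _; lra.
Qed.

Lemma qpoch_cvg y : qpoch y q n @[n --> \oo] --> qpoch_inf y q.
Proof.
have [M [M1 PM]] := qpoch_bounded (nm y).
pose u n := qpoch y q n.+1 - qpoch y q n.
have cu : cvgn (series u).
  apply: (nm_series A (v := fun n => (M * nm y) * r ^+ n)).
    move=> n; rewrite /u qpochS.
    have -> : qpoch y q n * (1 - y * q ^+ n) - qpoch y q n = - (qpoch y q n * (y * q ^+ n)) by ring.
    rewrite nmN.
    by rewrite !(nmM A) nmX -mulrA ler_wpM2r ?mulr_ge0 ?nmge0 ?exprn_ge0 // PM.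
  by apply: is_cvg_geometric_series; rewrite ger0_norm.
have uE n : qpoch y q n = 1 + series u n.
  rewrite /series /=; elim: n => [|n IH]; first by rewrite big_geq // qpoch0 addr0.
  by rewrite big_nat_recr //= addrA -IH /u addrC subrK.
suff : cvgn (fun n => qpoch y q n) by [].
rewrite (_ : (fun n => qpoch y q n) = (fun n => 1 + series u n)).
  by apply: is_cvgD => //; apply: is_cvg_cst.
by apply/funext => n; exact: uE.
Qed.

Lemma qpoch_infD y n : qpoch_inf y q = qpoch y q n * qpoch_inf (y * q ^+ n) q.
Proof.
apply: (@cvgK_unique (fun m => qpoch y q (n + m))).
  by apply: (@cvg_subseq (qpoch y q) _ (addn n)); [exact: leq_addl | exact: qpoch_cvg].
rewrite (_ : (fun m => _) = (fun m => qpoch y q n * qpoch (y * q ^+ n) q m)).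
  by apply: cvgM; [exact: cvg_cst | exact: qpoch_cvg].
by apply/funext => m; rewrite qpochD.
Qed.

Lemma qpoch_infS y : qpoch_inf y q = (1 - y) * qpoch_inf (y * q) q.
Proof. by rewrite (qpoch_infD y 1) qpoch1 expr1. Qed.

Lemma qpoch_inf_neq0 y : (forall j, 1 - y * q ^+ j != 0) -> qpoch_inf y q != 0.
Proof.
move=> /qpoch_lower [c [c0 Pc]]; rewrite -(nm_eq0 A) gt_eqF //.
apply: (@lt_le_trans _ _ (c / 2%:R)); first by rewrite divr_gt0.
have /(cvg_nm A) /cvgrPdist_lt /(_ (c / 2%:R)) [|N _ /(_ N (leqnn N))] := qpoch_cvg (y := y).
  by rewrite divr_gt0.
rewrite /= sub0r normrN ger0_norm ?nmge0 // => H.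
have := Pc N; have := nmD A (qpoch y q N - qpoch_inf y q) (qpoch_inf y q).
by rewrite subrK; lra.
Qed.

Lemma qpoch_inf_bounded B : exists M, 1 <= M /\
  forall y, nm y <= B -> nm (qpoch_inf y q) <= M.
Proof.
have [M [M1 PM]] := qpoch_bounded B; exists M; split => // y yB.
by apply: (nm_cvg_bounded (qpoch_cvg (y := y))) => n; exact: PM.
Qed.

Lemma qpoch_inf_near1 y : nm y / (1 - r) <= 1 / 4%:R ->
  nm (qpoch_inf y q - 1) <= 2%:R * (nm y / (1 - r)).
Proof.
move=> y_small; apply: (@nm_cvg_bounded (fun n => qpoch y q n - 1)).
  by apply: cvgB; [exact: qpoch_cvg | exact: cvg_cst].
by move=> n; exact: qpoch_near1.
Qed.

Lemma qpoch_inf_small (s : nat -> R) : s n @[n --> \oo] --> (0 : R) ->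
  forall (u : nat -> K), (forall n, nm (u n) <= s n) ->
  qpoch_inf (u n) q @[n --> \oo] --> (1 : K).
Proof.
move=> s0 u us; apply/(cvg_nm A)/cvgrPdist_lt => e e0.
have e1 : 0 < Num.min (1 / 4%:R) (e / 4%:R) * (1 - r) by rewrite mulr_gt0 // lt_min !divr_gt0.
have /cvgrPdist_lt /(_ _ e1) [N _ H] := s0; exists N => // n /H /=.
rewrite !sub0r !normrN => sn; rewrite ger0_norm ?nmge0 //.
have {sn} un : nm (u n) / (1 - r) < Num.min (1 / 4%:R) (e / 4%:R).
  rewrite ltr_pdivrMr //; apply: le_lt_trans sn.
  by apply: le_trans (us n) (ler_norm _).
rewrite lt_min in un; case/andP: un => /ltW /qpoch_inf_near1 un1 un2.
by apply: le_lt_trans un1 _; lra.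
Qed.

End QInf.
End AbsTheory.

(** * Uniform bounds and Tannery's theorem *)
Section Bounded.
Variables (R : realType) (K : numFieldType) (nm : K -> R).
Hypothesis A : complete_abs nm.
Implicit Types (x y z q : K) (r B : R).

Let nmge0 := nm_ge0 A.

(** Boundedness is indexed by an arbitrary type, so that it also expresses bounds
uniform in two indices. *)
Definition bdd (I : Type) (u : I -> K) := exists M, forall i, nm (u i) <= M.

Lemma bddM I (u v : I -> K) : bdd u -> bdd v -> bdd (fun i => u i * v i).
Proof.
by move=> [M uM] [N vN]; exists (M * N) => i; rewrite (nmM A) ler_pM ?nmge0.
Qed.

Lemma bddD I (u v : I -> K) : bdd u -> bdd v -> bdd (fun i => u i + v i).
Proof.
by move=> [M uM] [N vN]; exists (M + N) => i; apply: le_trans (nmD A _ _) _; apply: lerD.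
Qed.

Lemma bddN I (u : I -> K) : bdd u -> bdd (fun i => - u i).
Proof. by move=> [M uM]; exists M => i; rewrite (nmN A). Qed.

Lemma bdd_cst I (x : K) : bdd (fun _ : I => x).
Proof. by exists (nm x). Qed.

Lemma bddX I q (n : I -> nat) : nm q < 1 -> bdd (fun i => q ^+ n i).
Proof. by move=> q1; exists 1 => i; rewrite (nmX A) exprn_ile1 ?nmge0 // ltW. Qed.

Lemma bdd_qpoch I q (x : I -> K) (n : I -> nat) : nm q < 1 -> bdd x ->
  bdd (fun i => qpoch (x i) q (n i)).
Proof.
move=> q1 [B xB]; have [M [_ PM]] := qpoch_bounded A q1 B.
by exists M => i; apply: PM.
Qed.

Lemma bdd_qpoch_inf I q (x : I -> K) : nm q < 1 -> bdd x ->
  bdd (fun i => qpoch_inf (x i) q).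
Proof.
move=> q1 [B xB]; have [M [_ PM]] := qpoch_inf_bounded A q1 B.
by exists M => i; apply: PM.
Qed.

(** The inverse is (y)_m / (y)_(m+n), a quotient of partial products of one infinite
product: the longer one is bounded below, the shorter one is bounded above. *)
Lemma bddV_qpoch I q y (m n : I -> nat) : nm q < 1 -> (forall j, 1 - y * q ^+ j != 0) ->
  bdd (fun i => (qpoch (y * q ^+ m i) q (n i))^-1).
Proof.
move=> q1 y1; have [M [M1 PM]] := qpoch_bounded A q1 (nm y).
have [c [c0 Pc]] := qpoch_lower A q1 y1.
exists (M / c) => i; rewrite (nmV A).
have : qpoch y q (m i + n i) != 0 by exact: (proj1 (qpoch_neq0 _ _) y1).
rewrite qpochD mulf_eq0 negb_or => /andP[Pm Pn].
have := Pc (m i + n i)%N; rewrite qpochD (nmM A) => H.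
rewrite -[leLHS]mul1r ler_pdivrMr ?(nm_gt0 A) // mulrAC ler_pdivlMr // mul1r.
by apply: le_trans H _; rewrite ler_wpM2r ?nmge0 // PM.
Qed.

Lemma bddV_qpoch0 I q y (n : I -> nat) : nm q < 1 -> (forall j, 1 - y * q ^+ j != 0) ->
  bdd (fun i => (qpoch y q (n i))^-1).
Proof.
move=> q1 y1; have := bddV_qpoch (fun=> 0%N) n q1 y1.
by under eq_fun do rewrite expr0 mulr1.
Qed.

Lemma bddV_factor I q y (m : I -> nat) : nm q < 1 -> (forall j, 1 - y * q ^+ j != 0) ->
  bdd (fun i => (1 - y * q ^+ m i)^-1).
Proof.
move=> q1 y1; have := bddV_qpoch m (fun=> 1%N) q1 y1.
by under eq_fun do rewrite qpoch1.
Qed.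

Lemma series_cvg_geo (u : nat -> K) B r : 0 <= r -> r < 1 ->
  (forall n, nm (u n) <= B * r ^+ n) -> cvgn (series u).
Proof.
move=> r0 r1 uB; apply: (nm_series A (v := fun n => B * r ^+ n)) => //.
by apply: is_cvg_geometric_series; rewrite ger0_norm.
Qed.

Lemma seriesS (u : nat -> K) n : series u n.+1 = series u n + u n.
Proof. by rewrite /series /= big_nat_recr. Qed.

Lemma series0 (u : nat -> K) : series u 0%N = 0.
Proof. by rewrite /series /= big_geq. Qed.

Lemma seriesE (u : nat -> K) n : series u n = \sum_(i < n) u i.
Proof. by rewrite /series /= big_mkord. Qed.

Lemma series_tail (u : nat -> K) U B r : 0 <= r -> r < 1 ->
  (forall n, nm (u n) <= B * r ^+ n) -> series u n @[n --> \oo] --> U ->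
  forall M, nm (U - series u M) <= B * r ^+ M / (1 - r).
Proof.
move=> r0 r1 uB uU M.
have B0 : 0 <= B by have := le_trans (nmge0 _) (uB 0%N); rewrite expr0 mulr1.
apply: (nm_cvg_bounded A (u := fun n => series u (M + n)%N - series u M)).
  apply: cvgB; last exact: cvg_cst.
  apply: (@cvg_subseq _ (series u) _ (addn M)) => //; exact: leq_addl.
move=> n.
have -> : series u (M + n)%N - series u M = \sum_(i < n) u (M + i)%N.
  elim: n => [|n IH]; first by rewrite addn0 subrr big_ord0.
  by rewrite addnS seriesS big_ord_recr /= -IH addrAC.
apply: le_trans (nm_sum A n (fun i => u (M + i)%N)) _.
apply: (@le_trans _ _ (\sum_(i < n) (B * r ^+ M) * r ^+ i)).
  by apply: ler_sum => i _; rewrite -mulrA -exprD.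
by rewrite -mulr_sumr ler_wpM2l ?geo_sum_le // mulr_ge0 ?exprn_ge0.
Qed.

(** Dominated convergence for series.  The limit L of the series of limits is a
hypothesis, because in each application it is known beforehand. *)
Lemma tannery (t : nat -> nat -> K) (l S : nat -> K) (L : K) B r : 0 <= r -> r < 1 ->
  (forall N s, nm (t N s) <= B * r ^+ s) ->
  (forall s, t N s @[N --> \oo] --> l s) ->
  (forall N, series (t N) n @[n --> \oo] --> S N) ->
  series l n @[n --> \oo] --> L -> S N @[N --> \oo] --> L.
Proof.
move=> r0 r1 tB tl tS lL; apply/(cvg_nm A)/cvgrPdist_lt => e e0.
have lB s : nm (l s) <= B * r ^+ s by apply: (nm_cvg_bounded A (tl s)) => N; exact: tB.
have e4 : 0 < e / 4%:R by rewrite divr_gt0.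
have /cvgrPdist_lt /(_ _ e4) [M _ /(_ M (leqnn M))] := cvg_geo (B / (1 - r)) r0 r1.
rewrite /= sub0r normrN => /(le_lt_trans (ler_norm _)) HM.
have fin : series (t N) M @[N --> \oo] --> series l M.
  elim: (M) => [|m IH].
    by rewrite series0; under eq_fun do rewrite series0; exact: cvg_cst.
  rewrite seriesS; under eq_fun do rewrite seriesS.
  by apply: cvgD; [exact: IH | exact: tl].
move/(cvg_nm A)/cvgrPdist_lt: fin => /(_ _ e4) [N0 _ H]; exists N0 => // N /H /=.
rewrite !sub0r !normrN !ger0_norm ?nmge0 // => HN.
have -> : S N - L = (S N - series (t N) M) + (series (t N) M - series l M) - (L - series l M) by ring.
have T1 := series_tail r0 r1 (tB N) (tS N) M.
have T2 := series_tail r0 r1 lB lL M.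
rewrite mulrAC in T1; rewrite mulrAC in T2.
apply: le_lt_trans (nmB A _ _) _.
have := nmD A (S N - series (t N) M) (series (t N) M - series l M).
by move: T1 T2 HN HM; move: (nm _) (nm _) (nm _) (nm _) => a b c d; lra.
Qed.
End Bounded.

(** * Product identities and the q-binomial theorem *)
Lemma qpoch_mulN (K : numFieldType) (y q : K) n :
  qpoch y q n * qpoch (- y) q n = qpoch (y ^+ 2) (q ^+ 2) n.
Proof.
elim: n => [|n IH]; first by rewrite !qpoch0 mulr1.
by rewrite !qpochS -IH expr_sqr; ring.
Qed.

Lemma qpoch_parity (K : numFieldType) (y q : K) n :
  qpoch y q n.*2 = qpoch y (q ^+ 2) n * qpoch (y * q) (q ^+ 2) n.
Proof.
elim: n => [|n IH]; first by rewrite !qpoch0 mulr1.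
by rewrite doubleS !qpochS IH (exprS q n.*2) -muln2 exprM !expr_sqr; ring.
Qed.

Section Sums.
Variables (R : realType) (K : numFieldType) (nm : K -> R).
Hypothesis A : complete_abs nm.
Implicit Types (x y z : K) (r B : R).
Variable q : K.
Hypothesis q1 : nm q < 1.

Let nmge0 := nm_ge0 A.

Let q21 : nm (q ^+ 2) < 1.
Proof. by rewrite (nmX A) exprn_ilt1 ?nmge0. Qed.

Lemma qn1 : forall j, 1 - q * q ^+ j != 0.
Proof.
move=> j; rewrite subr_eq0; apply/eqP => E.
have : nm (q * q ^+ j) < 1 by rewrite -exprS (nmX A) exprn_ilt1 ?nmge0.
by rewrite -E (nm1 A) ltxx.
Qed.

Lemma qpoch_inf_mulN y : qpoch_inf y q * qpoch_inf (- y) q = qpoch_inf (y ^+ 2) (q ^+ 2).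
Proof.
apply: (@cvgK_unique _ (fun n => qpoch y q n * qpoch (- y) q n)).
  by apply: cvgM; apply: (qpoch_cvg A).
by under eq_fun do rewrite qpoch_mulN; apply: (qpoch_cvg A).
Qed.

Lemma qpoch_inf_parity y :
  qpoch_inf y q = qpoch_inf y (q ^+ 2) * qpoch_inf (y * q) (q ^+ 2).
Proof.
apply: (@cvgK_unique _ (fun n => qpoch y q n.*2)).
  apply: (@cvg_subseq _ (qpoch y q) _ double); last exact: (qpoch_cvg A).
  by move=> n; rewrite -addnn leq_addr.
by under eq_fun do rewrite qpoch_parity; apply: cvgM; apply: (qpoch_cvg A).
Qed.

Lemma q2n1 : forall j, 1 - q ^+ 2 * (q ^+ 2) ^+ j != 0.
Proof. by move=> j; have := qn1 j.*2.+1; rewrite -exprS -muln2 -addn2 addnC exprD mulnC exprM. Qed.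

(** Euler's partition identity between distinct parts and odd parts:
(-q; q)_oo (q; q^2)_oo = 1, by splitting (q^2; q^2)_oo in two ways. *)
Lemma euler_odd : qpoch_inf (- q) q * qpoch_inf q (q ^+ 2) = 1.
Proof.
have n0 : qpoch_inf (q ^+ 2) (q ^+ 2) != 0 by apply: (qpoch_inf_neq0 A) => //; exact: q2n1.
apply: (mulIf n0); rewrite mul1r -[RHS]qpoch_inf_mulN [qpoch_inf q q]qpoch_inf_parity -expr2.
ring.
Qed.

Lemma cvg_qpoch_arg (x : nat -> K) (l : K) s : x N @[N --> \oo] --> l ->
  qpoch (x N) q s @[N --> \oo] --> qpoch l q s.
Proof.
move=> xl; elim: s => [|s IH].
  by rewrite qpoch0; under eq_fun do rewrite qpoch0; exact: cvg_cst.
rewrite qpochS; under eq_fun do rewrite qpochS.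
apply: cvgM => //; apply: cvgB; first exact: cvg_cst.
by apply: cvgM => //; exact: cvg_cst.
Qed.

(** The sum F satisfies (1 - z) F(z) = (1 - e z) F(q z); iteration and
continuity at z = 0 give the product.  The statement avoids a division by the
product (z; q)_oo. *)
Lemma q_binomial e z : nm z < 1 -> exists F,
  series (fun s => qpoch e q s / qpoch q q s * z ^+ s) n @[n --> \oo] --> F
  /\ qpoch_inf z q * F = qpoch_inf (e * z) q.
Proof.
move=> z1.
pose c s := qpoch e q s / qpoch q q s.
have [B cB] : bdd nm c.
  apply: (bddM A); first by apply: (bdd_qpoch A) => //; exact: bdd_cst.
  by apply: (bddV_qpoch0 A) => //; exact: qn1.
pose t N s := c s * (z * q ^+ N) ^+ s.
have z0 := nmge0 z.
have tB N s : nm (t N s) <= B * nm z ^+ s.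
  rewrite (nmM A) (nmX A) (nmM A) ler_pM ?exprn_ge0 ?mulr_ge0 ?nmge0 //.
  rewrite lerXn2r ?nnegrE ?mulr_ge0 ?nmge0 // (nmX A).
  by rewrite ler_piMr // exprn_ile1 ?nmge0 // ltW.
have ct N : cvgn (series (t N)) by apply: (series_cvg_geo A z0 z1 (tB N)).
pose F N := limn (series (t N)).
have tF N : series (t N) n @[n --> \oo] --> F N by exact: ct.
have rec N : (1 - z * q ^+ N) * F N = (1 - e * (z * q ^+ N)) * F N.+1.
  have part n : series (t N) n.+1 - series (t N.+1) n.+1 =
     z * q ^+ N * (series (t N) n - e * series (t N.+1) n).
    elim: n => [|n IH].
      by rewrite !seriesS !series0 /t !expr0; ring.
    rewrite [series _ n.+2]seriesS [series (t N.+1) n.+2]seriesS.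
    rewrite opprD addrACA IH [in RHS]seriesS [in RHS]seriesS.
    have : t N n.+1 - t N.+1 n.+1 = z * q ^+ N * (t N n - e * t N.+1 n).
      have H1 := proj1 (qpoch_neq0 _ _) qn1 n; have H2 := qn1 n.
      rewrite /t /c !qpochS !exprS !exprMn.
      move: (qpoch e q n) (qpoch q q n) (q ^+ N ^+ n) (z ^+ n) (q ^+ n) H1 H2 => X1 X2 X3 X4 X5 H1 H2.
      by field; rewrite H1 H2.
    by move=> ->; ring.
  suff : F N - F N.+1 = z * q ^+ N * (F N - e * F N.+1).
    move=> E; apply/eqP; rewrite -subr_eq0; apply/eqP.
    transitivity (F N - F N.+1 - z * q ^+ N * (F N - e * F N.+1)); last by rewrite E subrr.
    by ring.
  apply: (@cvgK_unique _ (fun n => series (t N) n.+1 - series (t N.+1) n.+1)).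
    apply: cvgB; first exact: (@cvg_subseq _ (series (t N)) _ succn).
    exact: (@cvg_subseq _ (series (t N.+1)) _ succn).
  under eq_fun do rewrite part.
  apply: cvgM; first exact: cvg_cst.
  by apply: cvgB => //; apply: cvgM => //; exact: cvg_cst.
have iter N : qpoch z q N * F 0%N = qpoch (e * z) q N * F N.
  elim: N => [|N IH]; first by rewrite !qpoch0 mul1r.
  by rewrite !qpochS mulrAC IH mulrAC -[in RHS]mulrA -[e * z * _]mulrA -rec; ring.
(* As N grows, z q^N tends to 0 and only the constant term of the series remains. *)
pose l0 (s : nat) : K := if s is 0%N then 1 else 0.
have F1 : F N @[N --> \oo] --> (1 : K).
  apply: (tannery A (l := l0) z0 z1 tB _ tF).
    case=> [|s].
      by under eq_fun do rewrite /t /c !qpoch0 expr0 divr1 mulr1; exact: cvg_cst.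
    apply: (nm_cvg_le A (v := fun N => B * nm q ^+ N)); last exact: cvg_geo.
    move=> N; rewrite subr0 /t (nmM A) ler_pM ?nmge0 // (nmX A).
    have w1 : nm (z * q ^+ N) <= nm q ^+ N.
      by rewrite (nmM A) (nmX A) ler_piMl ?exprn_ge0 ?nmge0 // ltW.
    apply: le_trans w1; rewrite exprS ler_piMr ?nmge0 // exprn_ile1 ?nmge0 //.
    by rewrite (nmM A) (nmX A) mulr_ile1 ?exprn_ge0 ?exprn_ile1 ?nmge0 // ltW.
  have l0E n : series l0 n.+1 = 1.
    by rewrite seriesE big_ord_recl big1 ?addr0.
  apply: (@cvg_eventually _ _ (fun _ => 1) _ 1%N); last exact: cvg_cst.
  by case=> [//|n _]; exact: l0E.
exists (F 0%N); split.
  have := tF 0%N; rewrite /t /c.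
  by under eq_fun do rewrite expr0 mulr1.
apply: (@cvgK_unique _ (fun N => qpoch z q N * F 0%N)).
  by apply: cvgM; [exact: (qpoch_cvg A) | exact: cvg_cst].
under eq_fun do rewrite iter.
by rewrite -[qpoch_inf (e * z) q]mulr1; apply: cvgM => //; exact: (qpoch_cvg A).
Qed.
End Sums.

(** * The q-analogue of Watson's sum: terminating case and estimates *)

(** The denominators of [watson_term]; the factors of (abq; q^2) are absent because
they sit in P. *)
Definition watson_defined (K : numFieldType) (q a b f : K) : Prop :=
  [/\ forall j, 1 - a * b * f * q ^+ j != 0,
      forall j, 1 - b * q * f * q ^+ j != 0,
      forall j, 1 - a * q * f * q ^+ j != 0 &
      forall j, 1 - a * b * q * f ^+ 2 * q * (q ^+ 2) ^+ j != 0].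

Lemma watson_defined_shift (K : numFieldType) (q a b f : K) :
  watson_defined q a b f -> watson_defined q a (b * q ^+ 2) f.
Proof.
move=> [l1 b1 a1 c1]; split=> j //.
- by have := l1 j.+2; rewrite -addn2 exprD (_ : a * (b * q ^+ 2) * f * q ^+ j = a * b * f * (q ^+ j * q ^+ 2)) //; ring.
- by have := b1 j.+2; rewrite -addn2 exprD (_ : b * q ^+ 2 * q * f * q ^+ j = b * q * f * (q ^+ j * q ^+ 2)) //; ring.
- by have := c1 j.+1; rewrite (exprS (q ^+ 2)) (_ : a * (b * q ^+ 2) * q * f ^+ 2 * q * (q ^+ 2) ^+ j
    = a * b * q * f ^+ 2 * q * (q ^+ 2 * (q ^+ 2) ^+ j)) //; ring.
Qed.

Lemma watson_defined_sym (K : numFieldType) (q a b f : K) : watson_defined q a b f -> watson_defined q b a f.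
Proof. by rewrite /watson_defined (mulrC b a) => -[]. Qed.

(** The symmetry in a and b lets the recurrence in b be applied to a as well. *)
Lemma watson_term_sym (K : numFieldType) (P : K -> K) (q a b e : K) : watson_term P q a b e = watson_term P q b a e.
Proof.
apply/funext => s; rewrite /watson_term (mulrC b a) (mulrC (qpoch b q s)).
by congr (_ / _ * _ * _); rewrite -!mulrA; congr (_ * _); rewrite mulrCA.
Qed.

Section Watson.
Variables (R : realType) (K : numFieldType) (nm : K -> R).
Hypothesis A : complete_abs nm.
Variable q : K.
Hypothesis q1 : nm q < 1.
Implicit Types a b f F L x y : K.

Let nmge0 := nm_ge0 A.
Let q21 : nm (q ^+ 2) < 1.
Proof. by rewrite (nmX A) exprn_ilt1 ?nmge0. Qed.
Let qn1 := qn1 A q1.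

Local Notation P := (fun x => qpoch_inf x (q ^+ 2)).
Local Notation Q := (fun x => qpoch_inf x q).

Let PE x : P x = (1 - x) * P (x * q ^+ 2).
Proof. exact: (qpoch_infS A q21). Qed.

(** The closed form of the sum is [watson_num / watson_den]; it is used without
division, because [watson_den] may vanish through its first factor. *)
Definition watson_den a b f : K :=
  Q (- q * f) * Q (b * q * f) * Q (a * q * f) * P (a * b * q * f ^+ 2 * q).
Definition watson_num a b f : K :=
  Q (- q) * Q (a * b * f * q) * (P (a * q) * P (b * q) * P (b * q ^+ 2 * f ^+ 2) * P (a * q ^+ 2 * f ^+ 2)).

Lemma watson_den_shift a b f : watson_den a b f =
  (1 - b * q * f) * (1 - b * q ^+ 2 * f) * (1 - a * b * q * f ^+ 2 * q) * watson_den a (b * q ^+ 2) f.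
Proof.
rewrite /watson_den [Q (b * q * f)](qpoch_infS A q1) [Q (b * q * f * q)](qpoch_infS A q1).
rewrite [P (a * b * q * f ^+ 2 * q)](qpoch_infS A q21).
have -> : b * q * f * q * q = b * q ^+ 2 * q * f by ring.
have -> : a * b * q * f ^+ 2 * q * q ^+ 2 = a * (b * q ^+ 2) * q * f ^+ 2 * q by ring.
ring.
Qed.

Lemma watson_num_shift a b f : watson_num a b f =
  (1 - a * b * f * q) * (1 - a * b * f * q ^+ 2) * (1 - b * q) * (1 - b * q ^+ 2 * f ^+ 2)
  * watson_num a (b * q ^+ 2) f.
Proof.
rewrite /watson_num [Q (a * b * f * q)](qpoch_infS A q1) [Q (a * b * f * q * q)](qpoch_infS A q1).
rewrite [P (b * q)](qpoch_infS A q21) [P (b * q ^+ 2 * f ^+ 2)](qpoch_infS A q21).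
have -> : a * b * f * q * q * q = a * (b * q ^+ 2) * f * q by ring.
have -> : b * q * q ^+ 2 = b * q ^+ 2 * q by ring.
have -> : b * q ^+ 2 * f ^+ 2 * q ^+ 2 = b * q ^+ 2 * q ^+ 2 * f ^+ 2 by ring.
ring.
Qed.

Lemma watson_den_sym a b f : watson_den a b f = watson_den b a f.
Proof. by rewrite /watson_den (mulrC b a); congr (_ * _); rewrite mulrAC. Qed.

Lemma watson_num_sym a b f : watson_num a b f = watson_num b a f.
Proof. by rewrite /watson_num (mulrC b a); ring. Qed.

Lemma watson_scale a b f (F F' : K) : watson_defined q a b f -> F = watson_ratio q a b f^-1 * F' ->
  watson_den a (b * q ^+ 2) f * F' = watson_num a (b * q ^+ 2) f ->
  watson_den a b f * F = watson_num a b f.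
Proof.
move=> [l1 b1 a1 c1] -> E; rewrite watson_den_shift watson_num_shift -E /watson_ratio !exprVn !invrK.
have := b1 0%N; have := b1 1%N; have := c1 0%N; rewrite !expr0 expr1 => H1 H2 H3.
move: (watson_den _ _ _) => D; field; nonzero.
Qed.

Lemma series_telescope a b f (F' L : K) : f != 0 -> watson_defined q a b f ->
  series (watson_term P q a (b * q ^+ 2) f^-1) n @[n --> \oo] --> F' ->
  watson_cert P q a b f^-1 n @[n --> \oo] --> L ->
  series (watson_term P q a b f^-1) n @[n --> \oo] --> watson_ratio q a b f^-1 * F' + L.
Proof.
move=> f0 [l1 b1 a1 c1] cF cL.
rewrite (_ : (fun n => _) = (fun n => watson_ratio q a b f^-1 * series (watson_term P q a (b * q ^+ 2) f^-1) n
   + watson_cert P q a b f^-1 n)).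
  by apply: cvgD => //; apply: cvgM => //; exact: cvg_cst.
apply/funext => n; rewrite -(watson_term_telescope PE f0 qn1 l1 b1 a1 c1).
by rewrite !seriesE mulr_sumr -big_split /=; apply: eq_bigr => i _; rewrite addrC subrK.
Qed.

Lemma qpoch_terminates b M n : b * q ^+ M = 1 -> (M < n)%N -> qpoch b q n = 0.
Proof.
by move=> bM Mn; rewrite -(subnKC Mn) qpochD qpochS bM subrr mulr0 mul0r.
Qed.

(** Induction on M in steps of 2, by the recurrence in b.  For b = 1 only the term
s = 0 survives; for b = 1/q both sides are 0, since [watson_ratio] contains
1 - b q. *)
Lemma watson_terminating M a b f : f != 0 -> b * q ^+ M = 1 -> watson_defined q a b f ->
  exists F, series (watson_term P q a b f^-1) n @[n --> \oo] --> F
    /\ watson_den a b f * F = watson_num a b f.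
Proof.
move=> f0; elim/ltn_ind: M b => -[|[|M]] IH b bM ndg.
- rewrite expr0 mulr1 in bM; exists (P (a * q)); split.
    apply: (@cvg_eventually _ _ (fun _ => P (a * q)) _ 1%N); last exact: cvg_cst.
    case=> [//|n _]; rewrite seriesE big_ord_recl big1 => [|i _].
      case: ndg => /(_ 0%N) + _ _ _; rewrite bM expr0 !mulr1 => l0.
      by rewrite /watson_term !invrK !qpoch0 !expr0 expr1n !mulr1; field; nonzero.
    rewrite /watson_term (@qpoch_terminates b 0 (lift ord0 i)) ?expr0 ?mulr1 //.
    by rewrite !(mulr0, mul0r).
  rewrite /watson_den /watson_num bM !mul1r !mulr1.
  have := qpoch_inf_mulN A q1 (q * f); rewrite exprMn -mulNr => <-.
  have -> : a * q * f ^+ 2 * q = a * q ^+ 2 * f ^+ 2 by ring.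
  have -> : a * f * q = a * q * f by ring.
  rewrite -[LHS]mul1r -[X in X * _](euler_odd A q1); ring.
- have ndg' := watson_defined_shift ndg; rewrite expr1 in bM.
  exists 0; split; last first.
    by rewrite mulr0 /watson_num bM [P 1]PE subrr !(mulr0, mul0r).
  case: ndg => l1 b1 a1 c1.
  apply: (@cvg_eventually _ _ (fun _ => 0) _ 2%N); last exact: cvg_cst.
  move=> n n2; rewrite seriesE.
  have := watson_term_telescope PE f0 qn1 l1 b1 a1 c1 n.
  rewrite (_ : watson_ratio q a b f^-1 = 0); last first.
    by rewrite /watson_ratio bM subrr !(mulr0, mul0r).
  under eq_bigr do rewrite mul0r subr0.
  move=> ->; case: n n2 => [|[|n]] // _.
  by rewrite /watson_cert bM (qpochSl 1) subrr !(mulr0, mul0r).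
have bM' : b * q ^+ 2 * q ^+ M = 1 by rewrite -mulrA -exprD.
have [F' [cF' EF']] := IH M (leqnSn _) _ bM' (watson_defined_shift ndg).
exists (watson_ratio q a b f^-1 * F'); split; last exact: (watson_scale ndg erefl EF').
rewrite -[X in _ --> X]addr0; apply: series_telescope => //.
apply: (@cvg_eventually _ _ (fun _ => 0) _ M.+4); last exact: cvg_cst.
case=> // n Mn; rewrite /watson_cert (@qpoch_terminates (b * q) M.+1 n).
- by rewrite !(mulr0, mul0r).
- by rewrite -mulrA -exprS.
- exact: ltnW.
Qed.

Section NonTerminating.
Variables (f : K).
Hypotheses (f0 : f != 0) (f1 : nm (q * f) < 1).
Let rho := nm (q * f).

(** A bound uniform in the shift N of both parameters, as needed for Tannery's
theorem: all factors except (- q f)^s are bounded functions of (N, s). *)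
Lemma watson_term_bounded a b : watson_defined q a b f -> exists B, forall N s,
  nm (watson_term P q (a * q ^+ N) (b * q ^+ N) f^-1 s) <= B * rho ^+ s.
Proof.
move=> [l1 b1 a1 c1].
pose G (i : nat * nat) : K :=
  let N := i.1 in let s := i.2 in
  let l := a * b * f * q ^+ (N + N) in
  let c := a * b * q * f ^+ 2 * (q ^+ 2) ^+ N in
  qpoch l q s * (1 - l * q ^+ (s + s)) * (1 - l)^-1
  * (qpoch (a * q ^+ N) q s * qpoch (b * q ^+ N) q s * qpoch f^-1 q s * qpoch (c * q ^+ s) q s)
  * ((qpoch q q s)^-1 * (qpoch (b * q * f * q ^+ N) q s)^-1 * (qpoch (a * q * f * q ^+ N) q s)^-1
     * (qpoch (a * b * q * f ^+ 2 * q * (q ^+ 2) ^+ N) (q ^+ 2) s)^-1)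
  * P (a * b * q * (q ^+ (N + N) * q ^+ (s + s))).
have [B GB] : bdd nm G.
  have bq (n : nat * nat -> nat) : bdd nm (fun i => q ^+ n i) by exact: (bddX A).
  have bl : bdd nm (fun i : nat * nat => a * b * f * q ^+ (i.1 + i.1)).
    by apply: (bddM A); [exact: bdd_cst | exact: (bq (fun i => i.1 + i.1)%N)].
  have bc : bdd nm (fun i : nat * nat => a * b * q * f ^+ 2 * (q ^+ 2) ^+ i.1).
    by apply: (bddM A); [exact: bdd_cst | exact: (bddX A (fun i => i.1) q21)].
  have bx (x : K) : bdd nm (fun i : nat * nat => x * q ^+ i.1).
    by apply: (bddM A); [exact: bdd_cst | exact: (bq (fun i => i.1))].
  rewrite /G; apply: (bddM A); last first.
    apply: (bdd_qpoch_inf A) => //; apply: (bddM A); first exact: bdd_cst.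
    by apply: (bddM A); [exact: (bq (fun i => i.1 + i.1)%N) | exact: (bq (fun i => i.2 + i.2)%N)].
  apply: (bddM A); last first.
    apply: (bddM A); last exact: (bddV_qpoch A (fun i => i.1) (fun i => i.2) q21 c1).
    apply: (bddM A); last exact: (bddV_qpoch A (fun i => i.1) (fun i => i.2) q1 a1).
    apply: (bddM A); last exact: (bddV_qpoch A (fun i => i.1) (fun i => i.2) q1 b1).
    exact: (bddV_qpoch0 A (fun i => i.2) q1 qn1).
  apply: (bddM A); last first.
    apply: (bddM A); last first.
      apply: (bdd_qpoch A) => //; apply: (bddM A) => //; exact: (bq (fun i => i.2)).
    apply: (bddM A); last by apply: (bdd_qpoch A) => //; exact: bdd_cst.
    by apply: (bddM A); apply: (bdd_qpoch A).
  apply: (bddM A); last exact: (bddV_factor A (fun i => i.1 + i.1)%N q1 l1).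
  apply: (bddM A); first by apply: (bdd_qpoch A).
  apply: (bddD A); first exact: bdd_cst.
  apply: (bddN A); apply: (bddM A) => //; exact: (bq (fun i => i.2 + i.2)%N).
exists B => N s.
have -> : watson_term P q (a * q ^+ N) (b * q ^+ N) f^-1 s = G (N, s) * (- (q * f)) ^+ s.
  rewrite /watson_term /G /= !exprVn !invrK !invfM !exprD !expr_sqr.
  have -> : a * q ^+ N * (b * q ^+ N) * f = a * b * f * (q ^+ N * q ^+ N) by ring.
  have -> : a * q ^+ N * (b * q ^+ N) * q * f ^+ 2 = a * b * q * f ^+ 2 * (q ^+ N) ^+ 2 by ring.
  have -> : a * b * q * f ^+ 2 * (q ^+ N) ^+ 2 * q = a * b * q * f ^+ 2 * q * (q ^+ N) ^+ 2 by ring.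
  have -> : b * q ^+ N * q * f = b * q * f * q ^+ N by ring.
  have -> : a * q ^+ N * q * f = a * q * f * q ^+ N by ring.
  have -> : a * q ^+ N * (b * q ^+ N) * q * (q ^+ s) ^+ 2 = a * b * q * (q ^+ N * q ^+ N * (q ^+ s * q ^+ s)) by ring.
  by rewrite mulNr; ring.
by rewrite (nmM A) (nmX A) (nmN A) ler_wpM2r ?exprn_ge0 ?nmge0.
Qed.

(** The certificate contains the factor (- q f)^s, all else being bounded. *)
Lemma watson_cert_cvg a b : watson_defined q a b f -> watson_cert P q a b f^-1 n @[n --> \oo] --> (0 : K).
Proof.
move=> [l1 b1 a1 c1].
apply: (@cvg_eventually _ _ (fun n => watson_cert P q a b f^-1 n.-1.+1) _ 1%N); first by case.
pose l := a * b * f; pose c := a * b * q * f ^+ 2.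
pose G m : K :=
  b * (1 - q * f) * (1 - l * b * q * f * q ^+ (m.+1 + m.+1)) / (1 - l)
  * (qpoch l q m.+1 * qpoch a q m.+1 * qpoch (b * q) q m * qpoch f^-1 q m.+1
     * qpoch (c * q * q ^+ m.+1) q m)
  * ((qpoch q q m)^-1 * (qpoch (b * q * f) q m.+2)^-1 * (qpoch (a * q * f) q m)^-1
     * (qpoch (c * q) (q ^+ 2) m.+1)^-1)
  * P (a * b * q * q ^+ (m.+1 + m.+1)).
have [B GB] : bdd nm G.
  have bx (x : K) (n : nat -> nat) : bdd nm (fun i => x * q ^+ n i).
    by apply: (bddM A); [exact: bdd_cst | exact: (bddX A)].
  have bqp (x : K) (n : nat -> nat) : bdd nm (fun i => qpoch x q (n i)).
    by apply: (bdd_qpoch A) => //; exact: bdd_cst.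
  rewrite /G; apply: (bddM A); last by apply: (bdd_qpoch_inf A).
  apply: (bddM A); last first.
    apply: (bddM A); last exact: (bddV_qpoch0 A (fun i => i.+1) q21 c1).
    apply: (bddM A); last exact: (bddV_qpoch0 A (fun i => i) q1 a1).
    apply: (bddM A); last exact: (bddV_qpoch0 A (fun i => i.+2) q1 b1).
    exact: (bddV_qpoch0 A (fun i => i) q1 qn1).
  apply: (bddM A); last first.
    apply: (bddM A); last by apply: (bdd_qpoch A).
    apply: (bddM A); last exact: (bqp _ succn).
    apply: (bddM A); last exact: (bqp _ id).
    by apply: (bddM A); exact: (bqp _ succn).
  apply: (bddM A); last exact: bdd_cst.
  apply: (bddM A); first exact: bdd_cst.
  by apply: (bddD A); [exact: bdd_cst | apply: (bddN A)].
apply: (nm_cvg_le A (v := fun n => B * rho ^+ n)); last exact: (cvg_geo _ (nmge0 _) f1).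
move=> n; rewrite subr0.
have -> : watson_cert P q a b f^-1 n.-1.+1 = G n.-1 * (- (q * f)) ^+ n.-1.+1.
  rewrite /watson_cert /G /l /c !exprVn !invrK !invfM !exprD.
  rewrite mulNr -!expr2; ring.
rewrite (nmM A) (nmX A) (nmN A) ler_pM ?exprn_ge0 ?nmge0 //.
by case: n => [|n] //=; rewrite expr1 expr0 ltW.
Qed.
End NonTerminating.
End Watson.

(** * The q-analogue of Watson's sum: nonterminating case *)

Section Watson.
Variables (R : realType) (K : numFieldType) (nm : K -> R).
Hypothesis A : complete_abs nm.
Variable q : K.
Hypothesis q1 : nm q < 1.
Implicit Types a b f F L x y : K.

Let nmge0 := nm_ge0 A.
Let q21 : nm (q ^+ 2) < 1.
Proof. by rewrite (nmX A) exprn_ilt1 ?nmge0. Qed.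
Let qn1 := qn1 A q1.

Local Notation P := (fun x => qpoch_inf x (q ^+ 2)).
Local Notation Q := (fun x => qpoch_inf x q).

Let PE x : P x = (1 - x) * P (x * q ^+ 2).
Proof. exact: (qpoch_infS A q21). Qed.

Section NonTerminating.
Variables (f : K).
Hypotheses (f0 : f != 0) (f1 : nm (q * f) < 1).

Definition watson_sum a b : K := limn (series (watson_term P q a b f^-1)).

Lemma watson_sum_cvg a b : watson_defined q a b f ->
  series (watson_term P q a b f^-1) n @[n --> \oo] --> watson_sum a b.
Proof.
move=> ndg; have [B HB] := watson_term_bounded A q1 ndg.
apply: (series_cvg_geo A (B := B) (nmge0 (q * f)) f1) => n.
by have := HB 0%N n; rewrite !expr0 !mulr1.
Qed.

(** The recurrence in b, cleared of denominators. *)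
Lemma watson_sum_step a b : watson_defined q a b f ->
  (1 - b * q * f) * (1 - b * q ^+ 2 * f) * (1 - a * b * q * f ^+ 2 * q) * watson_sum a b =
  (1 - a * b * f * q) * (1 - a * b * f * q ^+ 2) * (1 - b * q) * (1 - b * q ^+ 2 * f ^+ 2)
  * watson_sum a (b * q ^+ 2).
Proof.
move=> ndg; have cF := watson_sum_cvg (watson_defined_shift ndg).
have := series_telescope A q1 f0 ndg cF (watson_cert_cvg A q1 f1 ndg).
rewrite addr0 => /(cvgK_unique (watson_sum_cvg ndg)) ->.
case: ndg => l1 b1 a1 c1; rewrite /watson_ratio !exprVn !invrK.
have := b1 0%N; have := b1 1%N; have := c1 0%N; rewrite !expr0 expr1 => H1 H2 H3.
move: (watson_sum _ _) => D; field; nonzero.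
Qed.

Lemma watson_sum_sym a b : watson_sum a b = watson_sum b a.
Proof. by rewrite /watson_sum watson_term_sym. Qed.

Let qNS N : q ^+ N.+1.*2 = q ^+ N.*2 * q ^+ 2.
Proof. by rewrite doubleS -addn2 exprD. Qed.

Lemma watson_defined_iter a b N : watson_defined q a b f -> watson_defined q (a * q ^+ N.*2) (b * q ^+ N.*2) f.
Proof.
move=> ndg; elim: N => [|N IH]; first by rewrite !mulr1.
rewrite qNS 2!mulrA; exact: (watson_defined_shift (watson_defined_sym (watson_defined_shift (watson_defined_sym IH)))).
Qed.

(** Each step uses the recurrence once in b and, by symmetry, once in a. *)
Lemma watson_sum_iter a b N : watson_defined q a b f ->
  qpoch (b * q * f) q N.*2 * qpoch (a * q * f) q N.*2 * qpoch (a * b * q * f ^+ 2 * q) (q ^+ 2) N.*2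
    * watson_sum a b =
  qpoch (a * b * f * q) q N.*2.*2 * qpoch (a * q) (q ^+ 2) N * qpoch (b * q) (q ^+ 2) N
    * qpoch (b * q ^+ 2 * f ^+ 2) (q ^+ 2) N * qpoch (a * q ^+ 2 * f ^+ 2) (q ^+ 2) N
    * watson_sum (a * q ^+ N.*2) (b * q ^+ N.*2).
Proof.
move=> ndg; elim: N => [|N IH]; first by rewrite !qpoch0 !mulr1 !mul1r.
have ndgN := watson_defined_iter N ndg.
have S1 := watson_sum_step ndgN.
have S2 := watson_sum_step (watson_defined_sym (watson_defined_shift ndgN)).
rewrite (watson_sum_sym _ (a * _)) (watson_sum_sym _ (a * _ * _)) in S2.
rewrite qNS (mulrA a) (mulrA b) !doubleS !qpochS.
have E1 : (q ^+ 2) ^+ N = q ^+ N.*2 by rewrite -mul2n exprM.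
have E2 x : (q ^+ 2) ^+ N.*2 = (q ^+ N.*2) ^+ 2 by rewrite expr_sqr.
have E3 : q ^+ N.*2.*2 = (q ^+ N.*2) ^+ 2 by rewrite -muln2 exprM.
have ES x n : x ^+ n.+1 = x * x ^+ n :> K by exact: exprS.
rewrite (ES q N.*2) (ES (q ^+ 2) N.*2) (ES q N.*2.*2.+2) (ES q N.*2.*2.+1) (ES q N.*2.*2).
rewrite E1 E2 // E3.
have chain (D W d1 d2 NN W0 W1 W2 n1 n2 : K) : D * W = NN * W0 -> d1 * W0 = n1 * W1 ->
    d2 * W1 = n2 * W2 -> D * d1 * d2 * W = NN * n1 * n2 * W2.
  move=> H1 H2 H3.
  transitivity (D * W * d1 * d2); first by ring.
  rewrite H1; transitivity (NN * d2 * (d1 * W0)); first by ring.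
  rewrite H2; transitivity (NN * n1 * (d2 * W1)); first by ring.
  by rewrite H3; ring.
apply: etrans (etrans (chain _ _ _ _ _ _ _ _ _ _ IH S1 S2) _); ring.
Qed.

(** When both parameters tend to 0 only the factors that involve e alone survive,
namely the summand of the q-binomial series at - q/e. *)
Lemma watson_term_cvg a b s :
  watson_term P q (a * q ^+ N.*2) (b * q ^+ N.*2) f^-1 s @[N --> \oo]
  --> qpoch f^-1 q s / qpoch q q s * (- q * f) ^+ s.
Proof.
rewrite /watson_term !exprVn !invrK.
have y0 (y : K) : y * q ^+ N.*2 @[N --> \oo] --> (0 : K).
  apply: (@cvg_subseq _ (fun n => y * q ^+ n) _ double); first by move=> n; rewrite -addnn leq_addr.
  apply: (nm_cvg_le A (v := fun n => nm y * nm q ^+ n)); last exact: (cvg_geo _ (nmge0 _) q1).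
  by move=> n; rewrite subr0 (nmM A) (nmX A).
have qp0 p n : qpoch (0 : K) p n = 1.
  by elim: n => [|n IH]; rewrite ?qpoch0 // qpochS IH mul0r subr0 mulr1.
have z1 (u : nat -> K) (c : K) : u N @[N --> \oo] --> (0 : K) -> u N * c @[N --> \oo] --> (0 : K).
  by move=> u0; rewrite -(mul0r c); apply: cvgM => //; exact: cvg_cst.
have one (u : nat -> K) : u N @[N --> \oo] --> (0 : K) -> 1 - u N @[N --> \oo] --> (1 : K).
  by move=> u0; rewrite -[X in _ --> X](subr0 1); apply: cvgB => //; exact: cvg_cst.
have qp1 p (u : nat -> K) n : u N @[N --> \oo] --> (0 : K) -> qpoch (u N) p n @[N --> \oo] --> (1 : K).
  by move=> u0; rewrite -(qp0 p n); apply: cvg_qpoch_arg.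
have pi1 (u : nat -> K) : u N @[N --> \oo] --> (0 : K) -> P (u N) @[N --> \oo] --> (1 : K).
  move=> /(cvg_nm A) u0; apply: (qpoch_inf_small A q21 u0) => n.
  by rewrite subr0.
have ab0 : a * q ^+ N.*2 * (b * q ^+ N.*2) @[N --> \oo] --> (0 : K).
  by rewrite -(mul0r 0); apply: cvgM.
have nq : qpoch q q s != 0 by exact: (proj1 (qpoch_neq0 _ _) qn1).
have -> : qpoch f^-1 q s / qpoch q q s * (- q * f) ^+ s =
   1 * 1 / 1 * (1 * 1 * qpoch f^-1 q s * 1) / (qpoch q q s * 1 * 1 * 1) * (- q * f) ^+ s * 1.
  by rewrite invr1 !(mulr1, mul1r).
apply: cvgM; last by apply: (pi1); do 2 apply: (z1).
apply: cvgM; last exact: cvg_cst.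
apply: cvgM; last first.
  apply: cvgV; first by rewrite !mulr1.
  apply: cvgM; last by apply: (qp1); do 3 apply: (z1).
  apply: cvgM; last by apply: (qp1); do 2 apply: (z1).
  apply: cvgM; last by apply: (qp1); do 2 apply: (z1).
  exact: cvg_cst.
apply: cvgM; last first.
  apply: cvgM; last by apply: (qp1); do 3 apply: (z1).
  apply: cvgM; last exact: cvg_cst.
  by apply: cvgM; apply: (qp1).
apply: cvgM; last by apply: cvgV; rewrite ?oner_eq0 //; apply: (one); apply: (z1).
apply: cvgM; first by apply: (qp1); apply: (z1).
by apply: (one); do 2 apply: (z1).
Qed.

Lemma qpoch_double_cvg (y : K) : qpoch y q N.*2 @[N --> \oo] --> qpoch_inf y q.
Proof.
apply: (@cvg_subseq _ (qpoch y q) _ double); last exact: (qpoch_cvg A q1).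
by move=> n; rewrite -addnn leq_addr.
Qed.

(** Let N tend to infinity in [watson_sum_iter]: by Tannery's theorem the sum on the
right tends to the q-binomial series, of sum (-q; q)_oo / (-qf; q)_oo. *)
Lemma watson_nonterminating a b : watson_defined q a b f ->
  exists F, series (watson_term P q a b f^-1) n @[n --> \oo] --> F
    /\ watson_den q a b f * F = watson_num q a b f.
Proof.
move=> ndg; exists (watson_sum a b); split; first exact: watson_sum_cvg.
have f1' : nm (- q * f) < 1 by rewrite mulNr (nmN A).
have [L [cL EL]] := q_binomial A q1 f^-1 f1'.
have [B HB] := watson_term_bounded A q1 ndg.
have cN : watson_sum (a * q ^+ N.*2) (b * q ^+ N.*2) @[N --> \oo] --> L.
  apply: (tannery A (nmge0 (q * f)) f1 (fun N s => HB N.*2 s) _ _ cL) => N.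
    exact: watson_term_cvg.
  exact: (watson_sum_cvg (watson_defined_iter N ndg)).
rewrite (_ : f^-1 * (- q * f) = - q) in EL; last by field; nonzero.
have D : qpoch (b * q * f) q N.*2 * qpoch (a * q * f) q N.*2
   * qpoch (a * b * q * f ^+ 2 * q) (q ^+ 2) N.*2 * watson_sum a b @[N --> \oo] -->
   Q (b * q * f) * Q (a * q * f) * P (a * b * q * f ^+ 2 * q) * watson_sum a b.
  apply: cvgM; last exact: cvg_cst.
  apply: cvgM; first by apply: cvgM; exact: qpoch_double_cvg.
  apply: (@cvg_subseq _ (qpoch _ (q ^+ 2)) _ double); last exact: (qpoch_cvg A q21).
  by move=> n; rewrite -addnn leq_addr.
have E : Q (b * q * f) * Q (a * q * f) * P (a * b * q * f ^+ 2 * q) * watson_sum a b =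
  Q (a * b * f * q) * P (a * q) * P (b * q) * P (b * q ^+ 2 * f ^+ 2) * P (a * q ^+ 2 * f ^+ 2) * L.
  apply: (cvgK_unique D).
  under eq_fun do rewrite watson_sum_iter //.
  do 5 (apply: cvgM; last by [|exact: (qpoch_cvg A q21)]).
  apply: (@cvg_subseq _ (qpoch _ q) _ (fun n => n.*2.*2)); last exact: (qpoch_cvg A q1).
  by move=> n; rewrite -!muln2 -mulnA leq_pmulr.
rewrite /watson_den /watson_num -EL.
transitivity (Q (- q * f) * (Q (b * q * f) * Q (a * q * f) * P (a * b * q * f ^+ 2 * q) * watson_sum a b)); first by ring.
by rewrite E; ring.
Qed.
End NonTerminating.
End Watson.

(** * The double sum and the exchange of its two summations *)

Section Core.
Variables (R : realType) (K : numFieldType) (nm : K -> R).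
Hypothesis A : complete_abs nm.

Variable q : K.
Hypothesis q1 : nm q < 1.
Variables B b f : K.
Hypothesis f0 : f != 0.
Local Notation k := (B * b * f).
Local Notation a := (B * b * f ^+ 2).
Local Notation e := (f^-1).
Hypothesis N1 : forall j, 1 - k * q ^+ j != 0.
Hypothesis N2 : forall j, 1 - b * q * f * q ^+ j != 0.
Hypothesis N3 : forall j, 1 - B * q * f * q ^+ j != 0.
Hypothesis N4 : forall j, 1 - a * q * f * q ^+ j != 0.
Hypothesis N5 : forall j, 1 - a * (q ^+ 2) ^+ j != 0.

Let nmge0 := nm_ge0 A.
Let q21 : nm (q ^+ 2) < 1.
Proof. by rewrite (nmX A) exprn_ilt1 ?nmge0. Qed.
Let qn1 := qn1 A q1.

Local Notation P := (fun x => qpoch_inf x (q ^+ 2)).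
Local Notation Q := (fun x => qpoch_inf x q).

(** The weight of the r-th inner sum.  The product P is the part of
(B b q; q^2)_oo beyond its first r factors, that is, a denominator
(B b q; q^2)_r cleared by an infinite product. *)
Definition left_weight r : K :=
  (1 - k * (q ^+ r) ^+ 2) / (1 - k) * (qpoch B q r * qpoch b q r)
  / (qpoch (b * q * f) q r * qpoch (B * q * f) q r) * (- q * f) ^+ r
  * P (B * b * q * (q ^+ r) ^+ 2).

(** The factor, depending on n alone, by which the double sum differs from a
Watson-type sum with parameters B q^n and b q^n. *)
Definition exchange_coef n : K :=
  (1 - k * (q ^+ n) ^+ 2) / (1 - k) * qpoch k q (n + n) * qpoch B q n * qpoch b q n
  * qpoch e q n * qpoch (a * q * f) (q ^+ 2) n * (1 - a * (q ^+ n) ^+ 2) * qpoch a q n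
  / (qpoch (b * q * f) q n * qpoch (B * q * f) q n * qpoch q q n * qpoch (a * q * f) q n
     * qpoch (k * q) (q ^+ 2) n * (1 - a) * qpoch (a * q ^+ 2) (q ^+ 2) n) * (q * f) ^+ n.

Let ndg n : watson_defined q (B * q ^+ n) (b * q ^+ n) f.
Proof.
split=> j.
- have := N1 (n + n + j); rewrite !exprD.
  by rewrite (_ : B * q ^+ n * (b * q ^+ n) * f * q ^+ j = k * (q ^+ n * q ^+ n * q ^+ j)) //; ring.
- have := N2 (n + j); rewrite !exprD.
  by rewrite (_ : b * q ^+ n * q * f * q ^+ j = b * q * f * (q ^+ n * q ^+ j)) //; ring.
- have := N3 (n + j); rewrite !exprD.
  by rewrite (_ : B * q ^+ n * q * f * q ^+ j = B * q * f * (q ^+ n * q ^+ j)) //; ring.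
- have := N5 (n + j).+1; rewrite (exprS (q ^+ 2)) !exprD expr_sqr.
  rewrite (_ : B * q ^+ n * (b * q ^+ n) * q * f ^+ 2 * q * (q ^+ 2) ^+ j
    = a * (q ^+ 2 * ((q ^+ n) ^+ 2 * (q ^+ 2) ^+ j))) //; ring.
Qed.

Let a0 : 1 - a != 0. Proof. by have := N5 0%N; rewrite expr0 mulr1. Qed.
Let k0 : 1 - k != 0. Proof. by have := N1 0%N; rewrite expr0 mulr1. Qed.
Let nk n : qpoch k q n != 0. Proof. exact: (proj1 (qpoch_neq0 _ _) N1 n). Qed.
Let nq n : qpoch q q n != 0. Proof. exact: (proj1 (qpoch_neq0 _ _) qn1 n). Qed.
Let nb n : qpoch (b * q * f) q n != 0. Proof. exact: (proj1 (qpoch_neq0 _ _) N2 n). Qed.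
Let nB n : qpoch (B * q * f) q n != 0. Proof. exact: (proj1 (qpoch_neq0 _ _) N3 n). Qed.
Let na n : qpoch (a * q * f) q n != 0. Proof. exact: (proj1 (qpoch_neq0 _ _) N4 n). Qed.
Let N6 j : 1 - k * q * (q ^+ 2) ^+ j != 0.
Proof. by have := N1 (j.*2.+1); rewrite exprS -mul2n exprM mulrA. Qed.
Let nkq n : qpoch (k * q) (q ^+ 2) n != 0. Proof. exact: (proj1 (qpoch_neq0 _ _) N6 n). Qed.
Let N7 j : 1 - a * q ^+ 2 * (q ^+ 2) ^+ j != 0.
Proof. by have := N5 j.+1; rewrite (exprS (q ^+ 2)) mulrA. Qed.
Let na2 n : qpoch (a * q ^+ 2) (q ^+ 2) n != 0. Proof. exact: (proj1 (qpoch_neq0 _ _) N7 n). Qed.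

(** The factorization of the double sum under r = n + s.  Factorials of length
n + s and 2n + s split at n and 2n. *)
Lemma left_weight_pair_term n s :
  left_weight (n + s) * pair_term q a f (n + s) n
  = exchange_coef n * watson_term P q (B * q ^+ n) (b * q ^+ n) e s.
Proof.
have [W1 W2 W3 W4] := ndg n.
have H1 := proj1 (qpoch_neq0 _ _) W2 s; have H2 := proj1 (qpoch_neq0 _ _) W3 s.
have H3 := proj1 (qpoch_neq0 _ _) W4 s.
have H4 := nb n; have H5 := nB n; have H6 := na n; have H7 := nkq n; have H8 := na2 n.
have H9 := nq n; have H10 := nq s; have H11 := a0; have H12 := k0.
have H13 := W1 0%N; rewrite expr0 mulr1 in H13.
(* The sign (-1)^n of pair_term is the one contained in (- q f)^n. *)
transitivity ((-1) ^+ n * (-1) ^+ n * (exchange_coef n * watson_term P q (B * q ^+ n) (b * q ^+ n) e s)); last first.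
  by rewrite -exprMn mulrNN mulr1 expr1n mul1r.
rewrite /left_weight /pair_term /exchange_coef /watson_term !exprVn !invrK addKn.
have -> : a / f = k by field; nonzero.
rewrite (_ : (n + s + n = n + n + s)%N); last by rewrite addnAC.
rewrite !qpochD !expr_sqr.
have -> : (a * q ^+ (n + n + s).+1) = B * q ^+ n * (b * q ^+ n) * q * f ^+ 2 * q ^+ s.
  by rewrite (exprS q) !exprD; ring.
have EB : B * q ^+ n * q * f = B * q * f * q ^+ n by ring.
have Eb : b * q ^+ n * q * f = b * q * f * q ^+ n by ring.
have Ek : B * q ^+ n * (b * q ^+ n) * f = k * (q ^+ n * q ^+ n) by ring.
have Ea : B * q ^+ n * (b * q ^+ n) * q * f ^+ 2 * q = a * q ^+ 2 * (q ^+ n) ^+ 2 by ring.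
have EP : B * q ^+ n * (b * q ^+ n) * q * (q ^+ s) ^+ 2 = B * b * q * (q ^+ n * q ^+ s) ^+ 2 by ring.
rewrite EB Eb Ek Ea in H1 H2 H3 H13 *; rewrite EP !exprD.
have Es : (- q * f) ^+ n = (-1) ^+ n * (q * f) ^+ n by rewrite -exprMn mulN1r mulNr.
rewrite Es.
have Ek2 : k * (q ^+ n * q ^+ s) ^+ 2 = k * (q ^+ n * q ^+ n) * (q ^+ s) ^+ 2 by ring.
rewrite Ek2 (_ : k * (q ^+ n) ^+ 2 = k * (q ^+ n * q ^+ n)) //.
opaque_factors K.
move: (B * q ^+ n * (b * q ^+ n) * q * f ^+ 2 * q ^+ s) (k * q ^+ n) (a * q ^+ 2) (a * q * f) H3 H6 H8
  => x1 x2 x3 x4 H3 H6 H8.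
field; nonzero.
Qed.

(** The factor that clears the denominators of all Watson-type sums at once: it is
[watson_den] for the parameters B and b. *)
Definition left_const : K := Q (- q * f) * Q (b * q * f) * Q (B * q * f) * P (a * q ^+ 2).

Definition left_term r : K := left_const * (left_weight r * \sum_(n < r.+1) pair_term q a f r n).

Definition right_term n : K :=
  Q (- q) * Q (k * q)
  * (qpoch e q n * qpoch (a * q * f) (q ^+ 2) n * (1 - a * (q ^+ n) ^+ 2) * qpoch a q n
     / (qpoch q q n * qpoch (a * q * f) q n * qpoch (k * q) (q ^+ 2) n * (1 - a)) * (q * f) ^+ n)
  * (qpoch B q n * qpoch b q n * (P (B * q * q ^+ n) * P (b * q * q ^+ n)
  * P (b * q ^+ 2 * f ^+ 2 * q ^+ n) * P (B * q ^+ 2 * f ^+ 2 * q ^+ n))).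

(** The value of the s-sum for given n.  F enters through [watson_den * F =
watson_num], so that no infinite product is divided by. *)
Lemma right_term_coef n F : watson_den q (B * q ^+ n) (b * q ^+ n) f * F = watson_num q (B * q ^+ n) (b * q ^+ n) f ->
  right_term n = left_const * exchange_coef n * F.
Proof.
have H4 := nb n; have H5 := nB n; have H6 := na n; have H7 := nkq n; have H8 := na2 n.
have H9 := nq n; have H11 := a0; have H12 := k0.
rewrite /watson_den /watson_num => E.
have E1 : left_const = qpoch (b * q * f) q n * qpoch (B * q * f) q n * qpoch (a * q ^+ 2) (q ^+ 2) n
   * (Q (- q * f) * Q (b * q ^+ n * q * f) * Q (B * q ^+ n * q * f)
      * P (B * q ^+ n * (b * q ^+ n) * q * f ^+ 2 * q)).
  rewrite /left_const (qpoch_infD A q1 (b * q * f) n) (qpoch_infD A q1 (B * q * f) n).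
  rewrite (qpoch_infD A q21 (a * q ^+ 2) n) expr_sqr.
  have -> : B * q ^+ n * q * f = B * q * f * q ^+ n by ring.
  have -> : b * q ^+ n * q * f = b * q * f * q ^+ n by ring.
  have -> : B * q ^+ n * (b * q ^+ n) * q * f ^+ 2 * q = a * q ^+ 2 * (q ^+ n) ^+ 2 by ring.
  ring.
have E2 : (1 - k) * Q (k * q) = qpoch k q (n + n) * (1 - k * (q ^+ n) ^+ 2) * Q (B * q ^+ n * (b * q ^+ n) * f * q).
  rewrite -(qpoch_infS A q1) (qpoch_infD A q1 k (n + n).+1) qpochS exprD -expr2.
  congr (_ * _ * qpoch_inf _ _); rewrite (exprS q) exprD; ring.
have -> : left_const * exchange_coef n * F = qpoch (b * q * f) q n * qpoch (B * q * f) q n * qpoch (a * q ^+ 2) (q ^+ 2) n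
   * exchange_coef n * ((Q (- q * f) * Q (b * q ^+ n * q * f) * Q (B * q ^+ n * q * f)
      * P (B * q ^+ n * (b * q ^+ n) * q * f ^+ 2 * q)) * F) by rewrite E1; ring.
rewrite E /right_term.
have EQ : Q (k * q) = qpoch k q (n + n) * (1 - k * (q ^+ n) ^+ 2) * Q (B * q ^+ n * (b * q ^+ n) * f * q) / (1 - k).
  by apply: (mulIf k0); rewrite divfK ?k0 // -E2 mulrC.
rewrite EQ /exchange_coef.
have -> : B * q ^+ n * q = B * q * q ^+ n by ring.
have -> : b * q ^+ n * q = b * q * q ^+ n by ring.
have -> : B * q ^+ n * q ^+ 2 * f ^+ 2 = B * q ^+ 2 * f ^+ 2 * q ^+ n by ring.
have -> : b * q ^+ n * q ^+ 2 * f ^+ 2 = b * q ^+ 2 * f ^+ 2 * q ^+ n by ring.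
clear E E1 E2 EQ.
opaque_factors K; move: (qpoch_inf _ _) (qpoch_inf _ _) (qpoch_inf _ _) (qpoch_inf _ _) (qpoch_inf _ _) (qpoch_inf _ _).
move: (a * q ^+ 2) (a * q * f) H6 H8 => x3 x4 H6 H8 P1 P2 P3 P4 P5 P6.
field; nonzero.
Qed.

Lemma sum_triangle (g : nat -> nat -> K) M :
  \sum_(r < M) \sum_(n < r.+1) g n (r - n)%N = \sum_(n < M) \sum_(s < M - n) g n s.
Proof.
elim: M => [|M IH]; first by rewrite !big_ord0.
rewrite big_ord_recr /= IH.
rewrite [in LHS](_ : \sum_(n < M) \sum_(s < M - n) g n s = \sum_(n < M.+1) \sum_(s < M - n) g n s).
  rewrite -big_split /=; apply: eq_bigr => n _.
  by rewrite subSn ?big_ord_recr // -ltnS.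
by rewrite big_ord_recr /= subnn big_ord0 addr0.
Qed.

Let wt n := watson_term P q (B * q ^+ n) (b * q ^+ n) e.
Let t M n := left_const * exchange_coef n * series (wt n) (M - n)%N.

(** Partial sums over r cut the double sum along the triangle n + s < M. *)
Lemma series_left_term M : series left_term M = \sum_(n < M) t M n.
Proof.
rewrite seriesE /left_term -mulr_sumr.
transitivity (left_const * \sum_(r < M) \sum_(n < r.+1) (exchange_coef n * wt n (r - n)%N)).
  congr (_ * _); apply: eq_bigr => r _; rewrite mulr_sumr; apply: eq_bigr => n _.
  by rewrite -left_weight_pair_term subnKC // -ltnS.
rewrite (sum_triangle (fun n s => exchange_coef n * wt n s)) mulr_sumr; apply: eq_bigr => n _.
by rewrite /t seriesE -mulr_sumr mulrA.
Qed.

Lemma t_cvg n F : series (wt n) m @[m --> \oo] --> F ->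
  watson_den q (B * q ^+ n) (b * q ^+ n) f * F = watson_num q (B * q ^+ n) (b * q ^+ n) f ->
  t M n @[M --> \oo] --> right_term n.
Proof.
move=> cF EF; rewrite (right_term_coef EF); apply: cvgM; first exact: cvg_cst.
move=> X /cF [N _ HN]; exists (N + n)%N => // m /= Hm; apply: HN => /=.
by rewrite leq_subRL ?(leq_trans _ Hm) ?leq_addl // addnC.
Qed.

Let r0 : 0 <= nm (q * f). Proof. exact: nmge0. Qed.

Lemma exchange_coef_bounded : exists C, forall n, nm (exchange_coef n) <= C * nm (q * f) ^+ n.
Proof.
pose G n : K := (1 - k * q ^+ (n + n)) / (1 - k) * qpoch k q (n + n) * qpoch B q n * qpoch b q n
  * qpoch e q n * qpoch (a * q * f) (q ^+ 2) n * (1 - a * q ^+ (n + n)) * qpoch a q n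
  * ((qpoch (b * q * f) q n)^-1 * (qpoch (B * q * f) q n)^-1 * (qpoch q q n)^-1 * (qpoch (a * q * f) q n)^-1
     * (qpoch (k * q) (q ^+ 2) n)^-1 * (1 - a)^-1 * (qpoch (a * q ^+ 2) (q ^+ 2) n)^-1).
have bq (y : K) (m : nat -> nat) : bdd nm (fun n => qpoch y q (m n)).
  by apply: (bdd_qpoch A) => //; exact: bdd_cst.
have bo (y : K) : bdd nm (fun n => 1 - y * q ^+ (n + n)).
  apply: (bddD A); first exact: bdd_cst.
  by apply: (bddN A); apply: (bddM A); [exact: bdd_cst | exact: (bddX A)].
have [C GC] : bdd nm G.
  rewrite /G; apply: (bddM A); last first.
    apply: (bddM A); last exact: (bddV_qpoch0 A id q21 N7).
    apply: (bddM A); last exact: bdd_cst.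
    apply: (bddM A); last exact: (bddV_qpoch0 A id q21 N6).
    apply: (bddM A); last exact: (bddV_qpoch0 A id q1 N4).
    apply: (bddM A); last exact: (bddV_qpoch0 A id q1 qn1).
    by apply: (bddM A); [exact: (bddV_qpoch0 A id q1 N2) | exact: (bddV_qpoch0 A id q1 N3)].
  apply: (bddM A); last exact: (bq _ id).
  apply: (bddM A); last exact: bo.
  apply: (bddM A); last by apply: (bdd_qpoch A) => //; exact: bdd_cst.
  do 3 (apply: (bddM A); last exact: (bq _ id)).
  apply: (bddM A); last exact: (bq _ (fun n => n + n)%N).
  by apply: (bddM A); [exact: bo | exact: bdd_cst].
exists C => n.
have -> : exchange_coef n = G n * (q * f) ^+ n.
  by rewrite /exchange_coef /G !invfM !exprD -!expr2; ring.
by rewrite (nmM A) (nmX A) ler_wpM2r ?exprn_ge0.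
Qed.

(** Tannery's theorem for the truncated triangle: for fixed n the partial s-sums
converge by the Watson-type summation; multiplied by [exchange_coef n] they are
bounded by a constant times |q f|^n. *)
Lemma exchange_nonterminating : nm (q * f) < 1 ->
  exists T : K, series left_term n @[n --> \oo] --> T /\ series right_term n @[n --> \oo] --> T.
Proof.
move=> f1.
have [C HC] := exchange_coef_bounded.
have [D HD] : exists D, forall N s, nm (wt N s) <= D * nm (q * f) ^+ s.
  have nd : watson_defined q B b f by have := ndg 0; rewrite !expr0 !mulr1.
  exact: (watson_term_bounded A q1 nd).
have D0 : 0 <= D by have := le_trans (nmge0 _) (HD 0%N 0%N); rewrite expr0 mulr1.
have C0 : 0 <= C by have := le_trans (nmge0 _) (HC 0%N); rewrite expr0 mulr1.
have HS n m : nm (series (wt n) m) <= D / (1 - nm (q * f)).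
  rewrite seriesE; apply: le_trans (nm_sum A m (wt n)) _.
  apply: (@le_trans _ _ (\sum_(s < m) D * nm (q * f) ^+ s)).
    by apply: ler_sum => s _; exact: HD.
  by rewrite -mulr_sumr ler_wpM2l // geo_sum_le.
pose E := nm left_const * C * (D / (1 - nm (q * f))).
have tB M n : nm (t M n) <= E * nm (q * f) ^+ n.
  rewrite /t /E (nmM A (left_const * exchange_coef n)) (nmM A left_const).
  apply: (@le_trans _ _ (nm left_const * (C * nm (q * f) ^+ n) * (D / (1 - nm (q * f))))).
    by apply: ler_pM; rewrite ?mulr_ge0 ?nmge0 //; exact: (ler_wpM2l (nmge0 _) (HC n)).
  by rewrite le_eqVlt; apply/orP; left; apply/eqP; ring.
have tr n : t M n @[M --> \oo] --> right_term n.
  have [F [cF EF]] := watson_nonterminating A q1 f0 f1 (ndg n).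
  exact: t_cvg cF EF.
have cr : cvgn (series right_term).
  apply: (series_cvg_geo A r0 f1 (B := E)) => n.
  by apply: (nm_cvg_bounded A (tr n)) => M; exact: tB.
exists (limn (series right_term)); split; last exact: cr.
apply: (tannery A r0 f1 tB tr _ cr) => M.
apply: (@cvg_eventually _ _ (fun _ => series left_term M) _ M); last exact: cvg_cst.
move=> n Mn; rewrite series_left_term seriesE -(subnKC Mn) big_split_ord /= [X in _ + X]big1 ?addr0 //.
move=> i _; rewrite /t (_ : M - (M + i) = 0)%N ?series0 ?mulr0 //.
by apply/eqP; rewrite subn_eq0 leq_addr.
Qed.

(** If only finitely many n contribute, the limit over the triangle is a finite sum of
limits, whatever the size of q f. *)
Lemma exchange_finite M0 :
  (forall n, (M0 < n)%N -> qpoch B q n * qpoch b q n = 0) ->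
  (forall n, (n <= M0)%N -> exists F : K, series (wt n) m @[m --> \oo] --> F
     /\ watson_den q (B * q ^+ n) (b * q ^+ n) f * F = watson_num q (B * q ^+ n) (b * q ^+ n) f) ->
  exists T : K, series left_term n @[n --> \oo] --> T /\ series right_term n @[n --> \oo] --> T.
Proof.
move=> Bb_0 watson.
have coef_0 n : (M0 < n)%N -> exchange_coef n = 0.
  move=> /Bb_0 /eqP; rewrite mulf_eq0 => /orP[] /eqP z;
  by rewrite /exchange_coef z !(mulr0, mul0r).
have right_term_0 n : (M0 < n)%N -> right_term n = 0.
  by move=> /Bb_0 z; rewrite /right_term z !(mulr0, mul0r).
have tr n : t M n @[M --> \oo] --> right_term n.
  have [nM|Mn] := leqP n M0; last first.
    by rewrite right_term_0 // /t coef_0 // mulr0; under eq_fun do rewrite mul0r; exact: cvg_cst.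
  by have [F [cF EF]] := watson n nM; exact: t_cvg cF EF.
exists (\sum_(n < M0.+1) right_term n); split.
  apply: (@cvg_eventually _ _ (fun M => \sum_(n < M0.+1) t M n) _ M0.+1).
    move=> M MM; rewrite series_left_term -(subnKC MM) big_split_ord /= [X in _ + X]big1 ?addr0 //.
    by move=> i _; rewrite /t coef_0 ?(mulr0, mul0r) // ltnS leq_addr.
  elim: (M0.+1) => [|m IH].
    by rewrite big_ord0; under eq_fun do rewrite big_ord0; exact: cvg_cst.
  rewrite big_ord_recr; under eq_fun do rewrite big_ord_recr.
  by apply: cvgD; [exact: IH | exact: tr].
apply: (@cvg_eventually _ _ (fun _ => \sum_(n < M0.+1) right_term n) _ M0.+1); last exact: cvg_cst.
move=> n Mn; rewrite seriesE -(subnKC Mn) big_split_ord /= [X in _ + X]big1 ?addr0 //.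
by move=> i _; rewrite right_term_0 // ltnS leq_addr.
Qed.

Lemma exchange_terminating M0 : B * q ^+ M0 = 1 \/ b * q ^+ M0 = 1 ->
  exists T : K, series left_term n @[n --> \oo] --> T /\ series right_term n @[n --> \oo] --> T.
Proof.
case=> z; apply: (@exchange_finite M0) => n nM.
- by rewrite (qpoch_terminates z nM) mul0r.
- have z' : B * q ^+ n * q ^+ (M0 - n) = 1 by rewrite -mulrA -exprD subnKC.
  have [F [cF EF]] := watson_terminating A q1 f0 z' (watson_defined_sym (ndg n)).
  exists F; rewrite /wt watson_term_sym; split => //.
  by rewrite watson_den_sym watson_num_sym.
- by rewrite (qpoch_terminates z nM) mulr0.
have z' : b * q ^+ n * q ^+ (M0 - n) = 1 by rewrite -mulrA -exprD subnKC.
exact: (watson_terminating A q1 f0 z' (ndg n)).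
Qed.
End Core.

(** * Rational functions of q^t and quasi-periodicity of theta functions *)

Section RatSeq.
Variables (K : numFieldType) (q : K).
Implicit Types (u v : nat -> K) (c : K).

(** Rationality is expressed by two fixed polynomials; the denominator has no zero
at the points q^t. *)
Definition ratseq u := exists p d : {poly K},
  forall t, d.[q ^+ t] != 0 /\ u t = p.[q ^+ t] / d.[q ^+ t].

Lemma ratseq_ext u v : (forall t, u t = v t) -> ratseq u -> ratseq v.
Proof. by move=> uv [p [d H]]; exists p, d => t; rewrite -uv; exact: H. Qed.

Lemma ratseq_cst c : ratseq (fun=> c).
Proof. by exists c%:P, 1 => t; rewrite !hornerE oner_eq0 divr1. Qed.

Lemma ratseq_base : ratseq (fun t => q ^+ t).
Proof. by exists 'X, 1 => t; rewrite !hornerE oner_eq0 divr1. Qed.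

Lemma ratseqM u v : ratseq u -> ratseq v -> ratseq (fun t => u t * v t).
Proof.
move=> [p [d H]] [p' [d' H']]; exists (p * p'), (d * d') => t.
have [d0 ->] := H t; have [d0' ->] := H' t.
by rewrite !hornerM mulf_neq0 //; split => //; field; rewrite d0 d0'.
Qed.

Lemma ratseqD u v : ratseq u -> ratseq v -> ratseq (fun t => u t + v t).
Proof.
move=> [p [d H]] [p' [d' H']]; exists (p * d' + p' * d), (d * d') => t.
have [d0 ->] := H t; have [d0' ->] := H' t.
by rewrite !(hornerM, hornerD) mulf_neq0 //; split => //; field; rewrite d0 d0'.
Qed.

Lemma ratseqN u : ratseq u -> ratseq (fun t => - u t).
Proof.
move=> H; have := ratseqM (ratseq_cst (-1)) H; apply: ratseq_ext => t.
by rewrite mulN1r.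
Qed.

Lemma ratseqB u v : ratseq u -> ratseq v -> ratseq (fun t => u t - v t).
Proof. by move=> Hu Hv; apply: ratseqD => //; exact: ratseqN. Qed.

Lemma ratseqV u : (forall t, u t != 0) -> ratseq u -> ratseq (fun t => (u t)^-1).
Proof.
move=> u0 [p [d H]]; exists d, p => t; have [d0 ut] := H t.
have := u0 t; rewrite ut mulf_eq0 negb_or => /andP[p0 _]; split => //.
by rewrite invfM invrK mulrC.
Qed.

Lemma ratseqX u n : ratseq u -> ratseq (fun t => u t ^+ n).
Proof.
move=> Hu; elim: n => [|n IH]; first by apply: (ratseq_ext _ (ratseq_cst 1)) => t; rewrite expr0.
by apply: (ratseq_ext _ (ratseqM Hu IH)) => t; rewrite exprS.
Qed.

Lemma ratseq_sum n (F : nat -> nat -> K) : (forall i, ratseq (F i)) ->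
  ratseq (fun t => \sum_(i < n) F i t).
Proof.
move=> HF; elim: n => [|n IH].
  by apply: (ratseq_ext _ (ratseq_cst 0)) => t; rewrite big_ord0.
by apply: (ratseq_ext _ (ratseqD IH (HF n))) => t; rewrite big_ord_recr.
Qed.

Lemma ratseq_qpoch u p n : ratseq u -> ratseq (fun t => qpoch (u t) p n).
Proof.
move=> Hu; elim: n => [|n IH].
  by apply: (ratseq_ext _ (ratseq_cst 1)) => t; rewrite qpoch0.
have H := ratseqM IH (ratseqB (ratseq_cst 1) (ratseqM Hu (ratseq_cst (p ^+ n)))).
by apply: (ratseq_ext _ H) => t; rewrite qpochS.
Qed.

(** The numerator polynomial would have more roots than its degree allows. *)
Lemma ratseq_zero u t0 : injective (GRing.exp q) -> ratseq u ->
  (forall t, (t0 <= t)%N -> u t = 0) -> forall t, u t = 0.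
Proof.
move=> q_inj [p [d H]] u0.
suff p0 : p = 0 by move=> t; have [_ ->] := H t; rewrite p0 horner0 mul0r.
apply/eqP/negPn/negP => p_neq0.
pose s := [seq q ^+ (t0 + j)%N | j <- iota 0 (size p)].
have : (size s < size p)%N.
  apply: max_poly_roots => //; last first.
    by rewrite map_inj_uniq ?iota_uniq // => x y /q_inj /addnI.
  apply/allP => _ /mapP [j _ ->]; rewrite /root.
  have [d0 E] := H (t0 + j)%N; have := u0 (t0 + j)%N (leq_addr _ _).
  by rewrite E => /eqP; rewrite mulf_eq0 invr_eq0 (negPf d0) orbF.
by rewrite size_map size_iota ltnn.
Qed.
End RatSeq.

Section Theta.
Variables (R : realType) (K : numFieldType) (nm : K -> R).
Hypothesis A : complete_abs nm.
Variable p : K.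
Hypothesis p1 : nm p < 1.
Hypothesis p0 : p != 0.
Implicit Types z : K.

Definition theta z : K := qpoch_inf z p * qpoch_inf (p / z) p.

Lemma theta_shift z : z != 0 -> theta (z / p) * p = - z * theta z.
Proof.
move=> z0; rewrite /theta (qpoch_infS A p1 (z / p)) divfK // invf_div.
rewrite (qpoch_infS A p1 (p / z)) (_ : p / z * p = p * (p / z)); last by rewrite mulrC.
by field; rewrite p0 z0.
Qed.

Lemma theta_iter z n : z != 0 ->
  theta (z / p ^+ n) * p ^+ 'C(n.+1, 2) = (- z) ^+ n * theta z.
Proof.
move=> z0; elim: n => [|n IH]; first by rewrite !expr0 divr1 mul1r mulr1.
have E := @theta_shift (z / p ^+ n) _.
have zn : z / p ^+ n != 0 by rewrite mulf_neq0 ?invr_eq0 ?expf_neq0.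
have {}E := E zn; rewrite binS bin1 exprD.
have -> : z / p ^+ n.+1 = z / p ^+ n / p by rewrite exprSr invfM; ring.
transitivity (theta (z / p ^+ n / p) * p * p ^+ n * p ^+ 'C(n.+1, 2)).
  by rewrite exprS; ring.
rewrite E [in RHS]exprS -[RHS]mulrA -IH.
by field; rewrite expf_neq0.
Qed.
End Theta.

(** * Dilated products as rational functions of q^t *)

Section Degenerate.
Variables (R : realType) (K : numFieldType) (nm : K -> R).
Hypothesis A : complete_abs nm.
Variable q : K.
Hypothesis q1 : nm q < 1.
Hypothesis q0 : q != 0.
Variables (B b f : K) (g : nat).
Hypotheses (B0 : B != 0) (b0 : b != 0) (f0 : f != 0).
Local Notation k := (B * b * f).
Local Notation a := (B * b * f ^+ 2).
Hypothesis ag : a * q ^+ g.*2.+1 = 1.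

Let nmge0 := nm_ge0 A.
Let q21 : nm (q ^+ 2) < 1.
Proof. by rewrite (nmX A) exprn_ilt1 ?nmge0. Qed.
Let q20 : q ^+ 2 != 0. Proof. by rewrite expf_neq0. Qed.

Local Notation P := (fun x => qpoch_inf x (q ^+ 2)).
Local Notation Q := (fun x => qpoch_inf x q).

Let k0 : k != 0. Proof. by rewrite !mulf_neq0. Qed.

(** The normalizing factor common to all terms: it compensates the Gaussian powers
produced by the theta functions when B and b are divided by q^(2t). *)
Definition dilation t : K := q ^+ (t * t.+1).*2 / k ^+ t.*2.

Let bin_odd t : 'C(t.*2.+1, 2) = (t * t.*2.+1)%N.
Proof. by rewrite bin2 /= -doubleMr doubleK mulnC. Qed.

Let bin_succ t : 'C(t.+1, 2).*2 = (t * t.+1)%N.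
Proof. by rewrite bin2 /= mulnC -[RHS]odd_double_half oddM /= andbN. Qed.

Let dil_nat t : (t * t.+1).*2 = (t * t.*2.+1 + t)%N.
Proof. by rewrite doubleMr doubleS !mulnS; lia. Qed.

Let sq t : (q ^+ t) ^+ 2 = q ^+ t.*2. Proof. by rewrite -exprM muln2. Qed.

(** An even number of steps, so that the signs cancel. *)
Lemma theta_base z t : z != 0 ->
  theta q (z / (q ^+ t) ^+ 2) * q ^+ (t * t.*2.+1) = z ^+ t.*2 * theta q z.
Proof.
move=> z0; rewrite sq -bin_odd (theta_iter A q1 q0) //.
by rewrite -mul2n !exprM sqrrN.
Qed.

(** The signs of the two factors cancel. *)
Lemma theta_base2 z w t : z != 0 -> w != 0 ->
  theta (q ^+ 2) (z / (q ^+ t) ^+ 2) * theta (q ^+ 2) (w / (q ^+ t) ^+ 2) * q ^+ (t * t.+1).*2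
  = (z * w) ^+ t * (theta (q ^+ 2) z * theta (q ^+ 2) w).
Proof.
move=> z0 w0.
have E y : y != 0 -> theta (q ^+ 2) (y / (q ^+ t) ^+ 2) * q ^+ (t * t.+1) = (- y) ^+ t * theta (q ^+ 2) y.
  move=> y0; rewrite -bin_succ -muln2 mulnC exprM.
  by rewrite -[(q ^+ t) ^+ 2]exprM mulnC exprM (theta_iter A q21 q20).
transitivity ((- z) ^+ t * theta (q ^+ 2) z * ((- w) ^+ t * theta (q ^+ 2) w)).
  by rewrite -!E // -addnn exprD; ring.
by rewrite -[z * w]mulrNN exprMn; ring.
Qed.

Let kE : B * b * q = k ^+ 2 * (q ^+ g.+1) ^+ 2.
Proof.
rewrite -[LHS]mulr1 -ag sq doubleS (exprS q g.*2.+1); ring.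
Qed.

Let aE : a = (q ^+ g.*2.+1)^-1.
Proof. by rewrite -[LHS]mulr1 -(mulfV (x := q ^+ g.*2.+1)) ?expf_neq0 // mulrA ag mul1r. Qed.

(** Because a q^(2g+1) = 1, the products (-qf; q)_oo and (Bbq; q^2)_oo combine, up to
finitely many factors, into (y; q)_oo theta(-y) with y proportional to k / s. *)
Lemma left_product r : (r <= g)%N -> (forall t j, 1 - k / (q ^+ t) ^+ 2 * q ^+ j != 0) ->
  exists v, ratseq q v /\ forall t, let s := (q ^+ t) ^+ 2 in
    dilation t * (Q (- q * (f * s)) * P (B / s * (b / s) * q * (q ^+ r) ^+ 2))
    = Q (k / s * q) * v t.
Proof.
move=> rg N1; pose m := (g.+1 + r)%N.
pose v t := qpoch (- q * (f * (q ^+ t) ^+ 2)) q (g - r) / qpoch (k / (q ^+ t) ^+ 2 * q) q (g + r)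
  * ((q ^+ t) ^+ m.*2.+1 * theta q (- (k * q ^+ m))).
have s0 t : (q ^+ t) ^+ 2 != 0 by rewrite !expf_neq0.
have nk t n : qpoch (k / (q ^+ t) ^+ 2 * q) q n != 0.
  by apply: (proj1 (qpoch_neq0 _ _)) => j; have := N1 t j.+1; rewrite (exprS q j) mulrA.
have rs : ratseq q (fun t => (q ^+ t) ^+ 2) by apply: ratseqX; exact: ratseq_base.
exists v; split.
  apply: ratseqM.
    apply: ratseqM.
      apply: ratseq_qpoch; apply: ratseqM; first exact: ratseq_cst.
      by apply: ratseqM => //; exact: ratseq_cst.
    apply: ratseqV; first by move=> t; exact: nk.
    apply: ratseq_qpoch; apply: ratseqM; last exact: ratseq_cst.
    by apply: ratseqM; [exact: ratseq_cst | exact: ratseqV].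
  by apply: ratseqM; [apply: ratseqX; exact: ratseq_base | exact: ratseq_cst].
move=> t s; have {}s0 : s != 0 := s0 t.
pose y := k / s * q ^+ m.
have y0 : y != 0 by rewrite !mulf_neq0 ?invr_eq0 ?expf_neq0.
have E1 : P (B / s * (b / s) * q * (q ^+ r) ^+ 2) = Q y * Q (- y).
  have -> : B / s * (b / s) * q * (q ^+ r) ^+ 2 = y ^+ 2.
    transitivity (B * b * q * (q ^+ r) ^+ 2 / s ^+ 2); first by field; nonzero.
    by rewrite kE /y /m exprD; field; nonzero.
  by rewrite -(qpoch_inf_mulN A q1).
have E2 : Q (k / s * q) = qpoch (k / s * q) q (g + r) * Q y.
  by rewrite (qpoch_infD A q1 _ (g + r)) /y /m addSn exprS mulrA.
have E3 : Q (- q * (f * s)) = qpoch (- q * (f * s)) q (g - r) * Q (q / (- y)).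
  have fE : f * (k * q ^+ g.*2.+1) = 1 by rewrite -ag; ring.
  have -> : q / - y = - q * (f * s) * q ^+ (g - r).
    rewrite -[LHS]mulr1 -fE.
    have -> : q ^+ g.*2.+1 = q ^+ m * q ^+ (g - r).
      by rewrite -exprD /m !addSn -addnA subnKC // addnn.
    have y1 := y0; rewrite /y in y1.
    by rewrite /y; field; rewrite s0 expf_neq0 //= ; nonzero.
  by rewrite -(qpoch_infD A q1).
have E4 : Q (q / (- y)) * Q (- y) = theta q (- y) by rewrite /theta mulrC.
have E5 := theta_base t (z := - (k * q ^+ m)) _.
have {E5}E5 : dilation t * theta q (- y) = (q ^+ t) ^+ m.*2.+1 * theta q (- (k * q ^+ m)).
  have kq0 : - (k * q ^+ m) != 0 by rewrite oppr_eq0 mulf_neq0 // expf_neq0.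
  have {}E5 := E5 kq0.
  have -> : - y = - (k * q ^+ m) / (q ^+ t) ^+ 2 by rewrite /y -/s; field.
  have kt0 : k ^+ t.*2 != 0 by rewrite expf_neq0.
  rewrite /dilation dil_nat.
  apply: (mulIf kt0); rewrite mulrAC divfK // exprD.
  transitivity (q ^+ t * (theta q (- (k * q ^+ m) / (q ^+ t) ^+ 2) * q ^+ (t * t.*2.+1))); first by ring.
  have ev (x : K) : (- x) ^+ t.*2 = x ^+ t.*2 by rewrite -mul2n !exprM sqrrN.
  rewrite E5 ev exprMn.
  have -> : (q ^+ m) ^+ t.*2 = (q ^+ t) ^+ m.*2 by rewrite -!exprM; congr (q ^+ _); rewrite -!doubleMr (mulnC m t).
  by rewrite exprS; ring.
rewrite E1 E3 E2.
transitivity (qpoch (- q * (f * s)) q (g - r) * Q y * (dilation t * (Q (q / - y) * Q (- y)))).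
  by ring.
rewrite E4 E5 /v -/s.
have := nk t (g + r)%N; rewrite -/s.
move: (qpoch _ _ _) (qpoch _ _ _) (theta _ _) ((q ^+ t) ^+ _) (Q y) => x1 x2 x3 x4 x5 x20.
by field.
Qed.

(** When z w q^(2g+1) = 1, the two half-infinite products over z and q^2 w combine
into a theta function with finitely many factors added.  The parity of n decides
whether its argument is z q or z. *)
Lemma right_factor_even z w j : z != 0 -> z * w * q ^+ g.*2.+1 = 1 -> (j <= g)%N ->
  qpoch z q j.*2 * (P (z * q * q ^+ j.*2) * P (w * q ^+ 2 * q ^+ j.*2))
  = qpoch z (q ^+ 2) j * qpoch (w * q ^+ 2 * q ^+ j.*2) (q ^+ 2) (g - j) * theta (q ^+ 2) (z * q).
Proof.
move=> z0 zw jg; rewrite qpoch_parity -!sq -!expr_sqr /theta.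
rewrite (qpoch_infD A q21 (z * q) j) (qpoch_infD A q21 (w * q ^+ 2 * _) (g - j)).
have -> : w * q ^+ 2 * (q ^+ 2) ^+ j * (q ^+ 2) ^+ (g - j) = q ^+ 2 / (z * q).
  rewrite -[_ * (q ^+ 2) ^+ (g - j)]mulrA -exprD subnKC // expr_sqr sq.
  apply: (mulIf (x := z * q)); first by rewrite mulf_neq0.
  by rewrite divfK ?mulf_neq0 // -[RHS]mulr1 -zw (exprS q g.*2); ring.
ring.
Qed.

Lemma right_factor_odd z w j : z != 0 -> z * w * q ^+ g.*2.+1 = 1 -> (j <= g)%N ->
  qpoch z q j.*2.+1 * (P (z * q * q ^+ j.*2.+1) * P (w * q ^+ 2 * q ^+ j.*2.+1))
  = qpoch (z * q) (q ^+ 2) j * qpoch (w * q ^+ 2 * q ^+ j.*2.+1) (q ^+ 2) (g - j) * theta (q ^+ 2) z.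
Proof.
move=> z0 zw jg; rewrite (qpochS z q) qpoch_parity /theta.
rewrite (qpoch_infD A q21 z j.+1) (qpoch_infD A q21 (w * q ^+ 2 * _) (g - j)) (qpochS z (q ^+ 2)).
have -> : w * q ^+ 2 * q ^+ j.*2.+1 * (q ^+ 2) ^+ (g - j) = q ^+ 2 / z.
  rewrite (exprS q j.*2) -[q ^+ j.*2]sq -expr_sqr.
  transitivity (w * q ^+ 2 * (q * ((q ^+ 2) ^+ j * (q ^+ 2) ^+ (g - j)))); first by ring.
  rewrite -exprD subnKC // expr_sqr sq.
  apply: (mulIf z0); rewrite divfK // -[RHS]mulr1 -zw (exprS q g.*2); ring.
rewrite (exprS (q ^+ 2) j) (exprS q j.*2) -sq -expr_sqr.
have -> : z * q * (q * (q ^+ 2) ^+ j) = z * (q ^+ 2 * (q ^+ 2) ^+ j) by ring.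
ring.
Qed.

Let kk : B * b = k ^+ 2 * q ^+ g.*2.+1.
Proof. by rewrite -[LHS]mulr1 -ag; ring. Qed.

(** The pairs (B, b f^2) and (b, B f^2) both satisfy z w q^(2g+1) = 1, so the four
products combine into two theta functions in base q^2. *)
Lemma right_product n : (n <= g.*2.+1)%N ->
  exists v, ratseq q v /\ forall t, let s := (q ^+ t) ^+ 2 in
    dilation t * (qpoch (B / s) q n * qpoch (b / s) q n *
      (P (B / s * q * q ^+ n) * P (b / s * q * q ^+ n)
       * P (b / s * q ^+ 2 * (f * s) ^+ 2 * q ^+ n) * P (B / s * q ^+ 2 * (f * s) ^+ 2 * q ^+ n)))
    = v t.
Proof.
move=> ng.
have rs : ratseq q (fun t => (q ^+ t) ^+ 2) by apply: ratseqX; exact: ratseq_base.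
have s0 t : (q ^+ t) ^+ 2 != 0 by rewrite !expf_neq0.
have rB (y : K) : ratseq q (fun t => y / (q ^+ t) ^+ 2).
  by apply: ratseqM; [exact: ratseq_cst | exact: ratseqV].
have rc u (y : K) : ratseq q u -> ratseq q (fun t => u t * y).
  by move=> ru; apply: ratseqM => //; exact: ratseq_cst.
have rw (y z : K) : ratseq q (fun t => y / (q ^+ t) ^+ 2 * (z * (q ^+ t) ^+ 2) ^+ 2 * q ^+ 2 * q ^+ n).
  do 2 apply: (rc); apply: ratseqM => //; apply: ratseqX.
  by apply: ratseqM => //; exact: ratseq_cst.
have dil t c : (B * b * q ^+ c) ^+ t / k ^+ t.*2 = (q ^+ t) ^+ (g.*2.+1 + c).
  have kt0 : k ^+ t.*2 != 0 by rewrite expf_neq0.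
  have -> : B * b * q ^+ c = k ^+ 2 * q ^+ (g.*2.+1 + c) by rewrite [in LHS]kk -mulrA -exprD.
  rewrite exprMn; have -> : (k ^+ 2) ^+ t = k ^+ t.*2 by rewrite -exprM mul2n.
  have X (x y : K) : x != 0 -> x * y / x = y by move=> x0; field.
  by rewrite X // -!exprM mulnC.
have ratv c (u1 u2 u3 u4 : nat -> K) x : ratseq q u1 -> ratseq q u2 -> ratseq q u3 -> ratseq q u4 ->
   ratseq q (fun t => u1 t * u2 t * (u3 t * u4 t) * ((q ^+ t) ^+ c * x)).
  move=> r1 r2 r3 r4; apply: ratseqM; last by apply: (rc); apply: ratseqX; exact: ratseq_base.
  by apply: ratseqM; apply: ratseqM.
have zw1 (s : K) : s != 0 -> B / s * (b / s * (f * s) ^+ 2) * q ^+ g.*2.+1 = 1.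
  by move=> ?; rewrite -ag; field.
have zw2 (s : K) : s != 0 -> b / s * (B / s * (f * s) ^+ 2) * q ^+ g.*2.+1 = 1.
  by move=> ?; rewrite -ag; field.
have z0 (s y : K) : s != 0 -> y != 0 -> y / s != 0 by move=> ? ?; rewrite mulf_neq0 ?invr_eq0.
have split_n : n = (odd n + n./2.*2)%N by rewrite odd_double_half.
move: rw; case: (odd n) split_n => /= [|]; rewrite ?add0n ?add1n => nE rw; set j := n./2 in nE.
- have jg : (j <= g)%N by rewrite -leq_double -ltnS -nE.
  exists (fun t => qpoch (B / (q ^+ t) ^+ 2 * q) (q ^+ 2) j
      * qpoch (b / (q ^+ t) ^+ 2 * (f * (q ^+ t) ^+ 2) ^+ 2 * q ^+ 2 * q ^+ n) (q ^+ 2) (g - j)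
    * (qpoch (b / (q ^+ t) ^+ 2 * q) (q ^+ 2) j
      * qpoch (B / (q ^+ t) ^+ 2 * (f * (q ^+ t) ^+ 2) ^+ 2 * q ^+ 2 * q ^+ n) (q ^+ 2) (g - j))
    * ((q ^+ t) ^+ (g.*2.+1 + 0) * (theta (q ^+ 2) B * theta (q ^+ 2) b))).
  split; first by apply: (ratv); apply: ratseq_qpoch => //; exact: (rc).
  move=> t /=; have := s0 t; set s := (q ^+ t) ^+ 2 => s1.
  have G1 := right_factor_odd (z0 s B s1 B0) (zw1 s s1) jg; have G2 := right_factor_odd (z0 s b s1 b0) (zw2 s s1) jg.
  have T := theta_base2 t B0 b0; rewrite -/s in T.
  rewrite -/s -dil expr0 mulr1 /dilation nE.
  have C (y : K) : y / s * q ^+ 2 * (f * s) ^+ 2 = y / s * (f * s) ^+ 2 * q ^+ 2 by rewrite mulrAC.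
  rewrite !C.
  transitivity ((q ^+ (t * t.+1).*2 / k ^+ t.*2) *
    ((qpoch (B / s) q j.*2.+1 * (P (B / s * q * q ^+ j.*2.+1) * P (b / s * (f * s) ^+ 2 * q ^+ 2 * q ^+ j.*2.+1)))
    * (qpoch (b / s) q j.*2.+1 * (P (b / s * q * q ^+ j.*2.+1) * P (B / s * (f * s) ^+ 2 * q ^+ 2 * q ^+ j.*2.+1))))).
    by ring.
  rewrite G1 G2.
  rewrite [(B * b) ^+ t / _ * _]mulrAC -T.
  by ring.
have jg : (j <= g)%N.
  by move: ng; rewrite nE leq_eqVlt ltnS leq_double => /orP[/eqP /(congr1 odd)|] //; rewrite /= !odd_double.
exists (fun t => qpoch (B / (q ^+ t) ^+ 2) (q ^+ 2) j
    * qpoch (b / (q ^+ t) ^+ 2 * (f * (q ^+ t) ^+ 2) ^+ 2 * q ^+ 2 * q ^+ n) (q ^+ 2) (g - j)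
  * (qpoch (b / (q ^+ t) ^+ 2) (q ^+ 2) j
    * qpoch (B / (q ^+ t) ^+ 2 * (f * (q ^+ t) ^+ 2) ^+ 2 * q ^+ 2 * q ^+ n) (q ^+ 2) (g - j))
  * ((q ^+ t) ^+ (g.*2.+1 + 2) * (theta (q ^+ 2) (B * q) * theta (q ^+ 2) (b * q)))).
split; first by apply: (ratv); apply: ratseq_qpoch.
move=> t /=; have := s0 t; set s := (q ^+ t) ^+ 2 => s1.
have G1 := right_factor_even (z0 s B s1 B0) (zw1 s s1) jg; have G2 := right_factor_even (z0 s b s1 b0) (zw2 s s1) jg.
have T := theta_base2 t (mulf_neq0 B0 q0) (mulf_neq0 b0 q0); rewrite -/s in T.
rewrite -/s -dil /dilation nE.
have C (y : K) : y / s * q ^+ 2 * (f * s) ^+ 2 = y / s * (f * s) ^+ 2 * q ^+ 2 by rewrite mulrAC.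
rewrite !C.
transitivity ((q ^+ (t * t.+1).*2 / k ^+ t.*2) *
  ((qpoch (B / s) q j.*2 * (P (B / s * q * q ^+ j.*2) * P (b / s * (f * s) ^+ 2 * q ^+ 2 * q ^+ j.*2)))
  * (qpoch (b / s) q j.*2 * (P (b / s * q * q ^+ j.*2) * P (B / s * (f * s) ^+ 2 * q ^+ 2 * q ^+ j.*2))))).
  by ring.
rewrite G1 G2.
have -> : B * b * q ^+ 2 = B * q * (b * q) by ring.
rewrite [(B * q * (b * q)) ^+ t / _ * _]mulrAC -T.
have C2 (y : K) : y / s * q = y * q / s by rewrite mulrAC.
rewrite !C2.
by ring.
Qed.
End Degenerate.

(** * The exchange when a is an odd negative power of q *)
Section Degenerate.
Variables (R : realType) (K : numFieldType) (nm : K -> R).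
Hypothesis A : complete_abs nm.
Variable q : K.
Hypothesis q1 : nm q < 1.
Hypothesis q0 : q != 0.
Variables (B b f : K) (g : nat).
Hypotheses (B0 : B != 0) (b0 : b != 0) (f0 : f != 0).
Local Notation k := (B * b * f).
Local Notation a := (B * b * f ^+ 2).
Hypothesis ag : a * q ^+ g.*2.+1 = 1.
Hypothesis N1 : forall t j, 1 - k / (q ^+ t) ^+ 2 * q ^+ j != 0.
Hypothesis N2 : forall j, 1 - b * q * f * q ^+ j != 0.
Hypothesis N3 : forall j, 1 - B * q * f * q ^+ j != 0.
Hypothesis N4 : forall j, 1 - a * q * f * q ^+ j != 0.
Hypothesis N5 : forall j, 1 - a * (q ^+ 2) ^+ j != 0.

Let nmge0 := nm_ge0 A.
Let q21 : nm (q ^+ 2) < 1.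
Proof. by rewrite (nmX A) exprn_ilt1 ?nmge0. Qed.
Let qn1 := qn1 A q1.

Local Notation P := (fun x => qpoch_inf x (q ^+ 2)).
Local Notation Q := (fun x => qpoch_inf x q).

Let Bt t := B / (q ^+ t) ^+ 2.
Let bt t := b / (q ^+ t) ^+ 2.
Let ft t := f * (q ^+ t) ^+ 2.

Let s0 t : (q ^+ t) ^+ 2 != 0. Proof. by rewrite !expf_neq0. Qed.
Let ft0 t : ft t != 0. Proof. by rewrite mulf_neq0. Qed.

Let ktE t : Bt t * bt t * ft t = k / (q ^+ t) ^+ 2.
Proof. by rewrite /Bt /bt /ft; have := s0 t; move: (_ ^+ 2) => s ?; field. Qed.
Let atE t : Bt t * bt t * ft t ^+ 2 = a.
Proof. by rewrite /Bt /bt /ft; have := s0 t; move: (_ ^+ 2) => s ?; field. Qed.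
Let bqfE t : bt t * q * ft t = b * q * f.
Proof. by rewrite /bt /ft; have := s0 t; move: (_ ^+ 2) => s ?; field. Qed.
Let BqfE t : Bt t * q * ft t = B * q * f.
Proof. by rewrite /Bt /ft; have := s0 t; move: (_ ^+ 2) => s ?; field. Qed.

Let M1 t j : 1 - Bt t * bt t * ft t * q ^+ j != 0. Proof. rewrite ktE; exact: N1. Qed.
Let M2 t j : 1 - bt t * q * ft t * q ^+ j != 0. Proof. rewrite bqfE; exact: N2. Qed.
Let M3 t j : 1 - Bt t * q * ft t * q ^+ j != 0. Proof. rewrite BqfE; exact: N3. Qed.
Let M4 t j : 1 - Bt t * bt t * ft t ^+ 2 * q * ft t * q ^+ j != 0.
Proof.
rewrite atE /ft -exprM; have := N4 (t * 2 + j); rewrite exprD.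
by rewrite (_ : a * q * (f * q ^+ (t * 2)) * q ^+ j = a * q * f * (q ^+ (t * 2) * q ^+ j)) //; ring.
Qed.
Let M5 t j : 1 - Bt t * bt t * ft t ^+ 2 * (q ^+ 2) ^+ j != 0. Proof. rewrite atE; exact: N5. Qed.

Let mul_sqr_div (x y : K) : y != 0 -> x * y ^+ 2 / y = x * y.
Proof. by move=> y0; field. Qed.

(** By [pair_sum] the term contains (aq; q^2)_r, which vanishes for r > g. *)
Lemma left_term_vanishes t r : (g < r)%N -> left_term q (Bt t) (bt t) (ft t) r = 0.
Proof.
move=> gr; rewrite /left_term.
have ae1 j : 1 - Bt t * bt t * ft t ^+ 2 * (ft t)^-1 * q * (q ^+ 2) ^+ j != 0.
  have := M1 t j.*2.+1; rewrite (exprS q j.*2) -mul2n exprM.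
  by rewrite mul_sqr_div ?mulrA.
rewrite (pair_sum r q0 (ft0 t) qn1 (M5 t) (M4 t) ae1).
case: odd; first by rewrite !mulr0.
rewrite atE -(subnKC gr) qpochD qpochS.
have -> : a * q * (q ^+ 2) ^+ g = 1 by rewrite -exprM mul2n -mulrA -exprS.
by rewrite subrr !(mulr0, mul0r).
Qed.

Lemma right_term_vanishes t n : (g.*2.+1 < n)%N -> right_term q (Bt t) (bt t) (ft t) n = 0.
Proof.
move=> gn; rewrite /right_term atE -(subnKC gn) (qpochD a) (qpochS a) ag subrr.
by rewrite !(mulr0, mul0r).
Qed.

Lemma series_vanishing (u : nat -> K) m : (forall n, (m <= n)%N -> u n = 0) ->
  series u n @[n --> \oo] --> \sum_(i < m) u i.
Proof.
move=> u0; apply: (@cvg_eventually _ _ (fun _ => \sum_(i < m) u i) _ m); last exact: cvg_cst.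
move=> n mn; rewrite seriesE -(subnKC mn) big_split_ord /= [X in _ + X]big1 ?addr0 //.
by move=> i _; rewrite u0 // leq_addr.
Qed.

Lemma q_inj : injective (GRing.exp q).
Proof.
have lt m n : (m < n)%N -> q ^+ m <> q ^+ n.
  move=> mn /(congr1 nm); rewrite !(nmX A) => E.
  have q_gt0 : 0 < nm q by rewrite (nm_gt0 A).
  have : nm q ^+ n < nm q ^+ m by rewrite ltr_iXn2l.
  by rewrite E ltxx.
move=> m n E; case: (ltngtP m n) => [mn|mn|//]; first by case: (lt _ _ mn).
by case: (lt _ _ mn).
Qed.

(** For such t the exchange is known, and both series are finite. *)
Lemma dilated t : nm (q * ft t) < 1 ->
  \sum_(r < g.+1) left_term q (Bt t) (bt t) (ft t) r = \sum_(n < g.+1.*2) right_term q (Bt t) (bt t) (ft t) n.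
Proof.
move=> f1.
have [T [cl cr]] := exchange_nonterminating A q1 (ft0 t) (M1 t) (M2 t) (M3 t) (M4 t) (M5 t) f1.
have /(cvgK_unique cl) <- := series_vanishing (fun n (h : (g < n)%N) => left_term_vanishes t h).
have /(cvgK_unique cr) <- // := series_vanishing (fun n (h : (g.*2.+1 < n)%N) => right_term_vanishes t h).
Qed.

Let rs : ratseq q (fun t => (q ^+ t) ^+ 2). Proof. by apply: ratseqX; exact: ratseq_base. Qed.
Let rB : ratseq q Bt. Proof. by apply: ratseqM; [exact: ratseq_cst | exact: ratseqV]. Qed.
Let rb : ratseq q bt. Proof. by apply: ratseqM; [exact: ratseq_cst | exact: ratseqV]. Qed.
Let rf : ratseq q ft. Proof. by apply: ratseqM => //; exact: ratseq_cst. Qed.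
Let re : ratseq q (fun t => (ft t)^-1). Proof. exact: ratseqV. Qed.
Let rk : ratseq q (fun t => Bt t * bt t * ft t). Proof. by do 2 apply: ratseqM => //. Qed.
Let ra : ratseq q (fun t => Bt t * bt t * ft t ^+ 2).
Proof. by apply: ratseqM; [exact: ratseqM | exact: ratseqX]. Qed.
Let rc u c : ratseq q u -> ratseq q (fun t => u t * c).
Proof. by move=> ru; apply: ratseqM => //; exact: ratseq_cst. Qed.
Let r1 u : ratseq q u -> ratseq q (fun t => 1 - u t).
Proof. by move=> ru; apply: ratseqB => //; exact: ratseq_cst. Qed.
Let raqf : ratseq q (fun t => Bt t * bt t * ft t ^+ 2 * q * ft t).
Proof. by apply: ratseqM => //; exact: rc. Qed.

Let k1 t : 1 - Bt t * bt t * ft t != 0. Proof. by have := M1 t 0; rewrite expr0 mulr1. Qed.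
Let a1 t : 1 - Bt t * bt t * ft t ^+ 2 != 0. Proof. by have := M5 t 0; rewrite expr0 mulr1. Qed.
Let M6 t j : 1 - Bt t * bt t * ft t * q * (q ^+ 2) ^+ j != 0.
Proof. by have := M1 t j.*2.+1; rewrite (exprS q) -mul2n exprM mulrA. Qed.
Let M7 t j : 1 - Bt t * bt t * ft t ^+ 2 * q ^+ 2 * (q ^+ 2) ^+ j != 0.
Proof. by have := M5 t j.+1; rewrite (exprS (q ^+ 2)) mulrA. Qed.

Lemma ratseq_qpochV u p n : ratseq q u -> (forall t j, 1 - u t * p ^+ j != 0) ->
  ratseq q (fun t => (qpoch (u t) p n)^-1).
Proof.
move=> ru u0; apply: ratseqV; last exact: ratseq_qpoch.
by move=> t; exact: (proj1 (qpoch_neq0 _ _) (u0 t) n).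
Qed.

Lemma ratseq_pair_term r n : ratseq q (fun t => pair_term q (Bt t * bt t * ft t ^+ 2) (ft t) r n).
Proof.
apply: (@ratseq_ext _ _ (fun t =>
  qpoch (ft t)^-1 q (r - n) * qpoch (Bt t * bt t * ft t) q (r + n) * qpoch (ft t)^-1 q n
  * qpoch (Bt t * bt t * ft t ^+ 2 * q * ft t) (q ^+ 2) n
  * (-1) ^+ n * (1 - Bt t * bt t * ft t ^+ 2 * (q ^+ n) ^+ 2) * qpoch (Bt t * bt t * ft t ^+ 2) q n
  * qpoch (Bt t * bt t * ft t ^+ 2 * q ^+ (r + n).+1) q (r - n)
  * ((qpoch q q (r - n))^-1 * (qpoch q q n)^-1 * (qpoch (Bt t * bt t * ft t ^+ 2 * q * ft t) q n)^-1
     * (qpoch (Bt t * bt t * ft t * q) (q ^+ 2) n)^-1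
     * (1 - Bt t * bt t * ft t ^+ 2)^-1 * (qpoch (Bt t * bt t * ft t ^+ 2 * q ^+ 2) (q ^+ 2) r)^-1))).
  by move=> t; rewrite /pair_term -!invfM mul_sqr_div.
apply: ratseqM.
  apply: ratseqM; last by apply: ratseq_qpoch; exact: rc.
  apply: ratseqM; last exact: ratseq_qpoch.
  apply: ratseqM; last by apply: r1; exact: rc.
  apply: rc; do 3 (apply: ratseqM; last exact: ratseq_qpoch); exact: ratseq_qpoch.
apply: ratseqM; last by apply: ratseq_qpochV; [exact: rc | exact: M7].
apply: ratseqM; last by apply: ratseqV => //; exact: r1.
apply: ratseqM; last by apply: ratseq_qpochV; [exact: rc | exact: M6].
apply: ratseqM; last exact: ratseq_qpochV.
exact: ratseq_cst.
Qed.

(** Among the factors that vary with t only the infinite products are not rational in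
q^t; they are treated by [left_product]. *)
Lemma left_term_dilation r : exists v, ratseq q v /\ forall t,
  dilation q B b f t * left_term q (Bt t) (bt t) (ft t) r = Q (Bt t * bt t * ft t * q) * v t.
Proof.
have [gr|rg] := ltnP g r.
  by exists (fun=> 0); split; [exact: ratseq_cst | move=> t; rewrite left_term_vanishes // !mulr0].
have [v [rv Hv]] := left_product A q1 q0 B0 b0 f0 ag rg N1.
pose c := Q (b * q * f) * Q (B * q * f) * P (a * q ^+ 2).
exists (fun t => v t * c * ((1 - Bt t * bt t * ft t * (q ^+ r) ^+ 2) / (1 - Bt t * bt t * ft t)
  * (qpoch (Bt t) q r * qpoch (bt t) q r)
  * ((qpoch (bt t * q * ft t) q r)^-1 * (qpoch (Bt t * q * ft t) q r)^-1) * (- q * ft t) ^+ r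
  * \sum_(n < r.+1) pair_term q (Bt t * bt t * ft t ^+ 2) (ft t) r n)); split.
  apply: ratseqM; first exact: rc.
  apply: ratseqM; last exact: (@ratseq_sum _ q r.+1
    (fun n t => pair_term q (Bt t * bt t * ft t ^+ 2) (ft t) r n) (ratseq_pair_term r)).
  apply: ratseqM; last by apply: ratseqX; apply: ratseqM => //; exact: ratseq_cst.
  apply: ratseqM; last first.
    apply: ratseqM; apply: ratseq_qpochV => //.
      by apply: ratseqM => //; exact: rc.
    by apply: ratseqM => //; exact: rc.
  apply: ratseqM; last by apply: ratseqM; exact: ratseq_qpoch.
  by apply: ratseqM; [apply: r1; exact: rc | apply: ratseqV => //; exact: r1].
move=> t; have := Hv t; rewrite /= -/(Bt t) -/(bt t) -/(ft t) -ktE => {}Hv.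
cbv beta.
set Z := (X in v t * c * X).
rewrite -(mulrA (v t)) (mulrA _ (v t)) -Hv /Z /left_term /left_const /left_weight /c ?atE ?bqfE ?BqfE -invfM.
ring.
Qed.

Lemma right_term_dilation n : exists v, ratseq q v /\ forall t,
  dilation q B b f t * right_term q (Bt t) (bt t) (ft t) n = Q (Bt t * bt t * ft t * q) * v t.
Proof.
have [gn|ng] := ltnP g.*2.+1 n.
  by exists (fun=> 0); split; [exact: ratseq_cst | move=> t; rewrite right_term_vanishes // !mulr0].
have [v [rv Hv]] := right_product A q1 q0 B0 b0 f0 ag ng.
exists (fun t => v t * Q (- q) *
  (qpoch (ft t)^-1 q n * qpoch (Bt t * bt t * ft t ^+ 2 * q * ft t) (q ^+ 2) n
   * (1 - Bt t * bt t * ft t ^+ 2 * (q ^+ n) ^+ 2) * qpoch (Bt t * bt t * ft t ^+ 2) q n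
   * ((qpoch q q n)^-1 * (qpoch (Bt t * bt t * ft t ^+ 2 * q * ft t) q n)^-1
      * (qpoch (Bt t * bt t * ft t * q) (q ^+ 2) n)^-1 * (1 - Bt t * bt t * ft t ^+ 2)^-1)
   * (q * ft t) ^+ n)); split.
  apply: ratseqM; first exact: rc.
  apply: ratseqM; last by apply: ratseqX; apply: ratseqM => //; exact: ratseq_cst.
  apply: ratseqM; last first.
    apply: ratseqM; last by apply: ratseqV => //; exact: r1.
    apply: ratseqM; last by apply: ratseq_qpochV; [exact: rc | exact: M6].
    by apply: ratseqM; [exact: ratseq_cst | exact: ratseq_qpochV].
  apply: ratseqM; last exact: ratseq_qpoch.
  apply: ratseqM; last by apply: r1; exact: rc.
  by apply: ratseqM; exact: ratseq_qpoch.
move=> t; have := Hv t; rewrite /= -/(Bt t) -/(bt t) -/(ft t) => {}Hv.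
cbv beta; rewrite -(mulrA (v t)) (mulrA _ (v t)) -Hv /right_term -!invfM.
ring.
Qed.

Lemma good_sum (F : nat -> nat -> K) m :
  (forall n, exists v, ratseq q v /\ forall t,
    dilation q B b f t * F t n = Q (Bt t * bt t * ft t * q) * v t) ->
  exists v, ratseq q v /\ forall t,
    dilation q B b f t * \sum_(n < m) F t n = Q (Bt t * bt t * ft t * q) * v t.
Proof.
move=> HF; elim: m => [|m [v [rv Hv]]].
  exists (fun=> 0); split; first exact: ratseq_cst.
  by move=> t; rewrite big_ord0 !mulr0.
have [w [rw Hw]] := HF m; exists (fun t => v t + w t); split; first exact: ratseqD.
by move=> t; rewrite big_ord_recr /= mulrDr Hv Hw mulrDr.
Qed.

(** The difference of the two finite sums, multiplied by [dilation] and divided by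
(k q / s; q)_oo, is a rational function of q^t that vanishes for large t; its value
at t = 0 is the claim. *)
Lemma exchange_degenerate : exists T : K,
  series (left_term q B b f) n @[n --> \oo] --> T /\ series (right_term q B b f) n @[n --> \oo] --> T.
Proof.
have [v [rv Hv]] := good_sum g.+1 left_term_dilation.
have [w [rw Hw]] := good_sum g.+1.*2 right_term_dilation.
have [t0 Ht0] : exists t0, forall t, (t0 <= t)%N -> nm (q * ft t) < 1.
  have p : 0 < nm (q * f) + 1 by rewrite ltr_wpDl ?nmge0.
  have p' : 0 < (nm (q * f) + 1)^-1 by rewrite invr_gt0.
  have [N HN] := exp_small (nmge0 q) q1 p'.
  exists N => t Nt; rewrite /ft mulrA (nmM A) -exprM (nmX A).
  have H1 : nm q ^+ (t * 2) <= nm q ^+ N.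
    by rewrite ler_wiXn2l ?nmge0 ?(ltW q1) // muln2 -addnn (leq_trans Nt) // leq_addr.
  apply: (@le_lt_trans _ _ (nm (q * f) * (nm (q * f) + 1)^-1)).
    by rewrite ler_wpM2l ?nmge0 // (le_trans H1).
  by rewrite ltr_pdivrMr // mul1r ltrDl.
have Z : forall t, v t - w t = 0.
  apply: (ratseq_zero (t0 := t0) q_inj (ratseqB rv rw)) => t /Ht0 /dilated E.
  have Q0 : Q (Bt t * bt t * ft t * q) != 0.
    apply: (qpoch_inf_neq0 A q1) => j; have := M1 t j.+1.
    by rewrite (exprS q) mulrA.
  by apply: (mulfI Q0); rewrite mulrBr mulr0 -Hv -Hw E subrr.
have E0 : Bt 0 = B /\ bt 0 = b /\ ft 0 = f.
  by rewrite /Bt /bt /ft expr0 expr1n invr1 !mulr1.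
have := Hv 0%N; have := Hw 0%N; have /eqP := Z 0%N; rewrite subr_eq0 => /eqP ->.
case: E0 => -> [-> ->] <-.
rewrite /dilation mul0n !expr0 invr1 !mul1r => E.
exists (\sum_(n < g.+1.*2) right_term q B b f n); split.
  rewrite -E; apply: series_vanishing => n gn.
  have := left_term_vanishes 0 gn; by rewrite /Bt /bt /ft expr0 expr1n invr1 !mulr1.
apply: series_vanishing => n gn.
have := @right_term_vanishes 0 n gn; by rewrite /Bt /bt /ft expr0 expr1n invr1 !mulr1.
Qed.
End Degenerate.

(** * Numerators and denominators of the three very-well-poised series *)
Section Pairs.
Variable K : numFieldType.
Implicit Types x y z p q : K.

Lemma qpoch_pair p y x n : y ^+ 2 = x ->
  qpoch y p n * qpoch (- y) p n = qpoch x (p ^+ 2) n.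
Proof. by move=> <-; exact: qpoch_mulN. Qed.

(** Two pairs of opposite square roots, in base q^2, make up one factorial of
doubled length. *)
Lemma qpoch_quad q y z x n : y ^+ 2 = x -> z ^+ 2 = x * q ^+ 2 ->
  qpoch y (q ^+ 2) n * qpoch (- y) (q ^+ 2) n
  * (qpoch z (q ^+ 2) n * qpoch (- z) (q ^+ 2) n) = qpoch x (q ^+ 2) n.*2.
Proof. by move=> yx zx; rewrite (qpoch_pair _ _ yx) (qpoch_pair _ _ zx) qpoch_parity. Qed.

Lemma qpoch_factor x q n j : (j < n)%N -> qpoch x q n != 0 -> 1 - x * q ^+ j != 0.
Proof. by move=> jn /prodf_neq0 /(_ (Ordinal jn) isT). Qed.
End Pairs.

Section Terms.
Variable K : numFieldType.
Variable sqrt : K -> K.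
Hypothesis sqrtK : forall z, sqrt z ^+ 2 = z.
Variables q B b f : K.
Hypotheses (q0 : q != 0) (B0 : B != 0) (b0 : b != 0) (f0 : f != 0).
Local Notation k := (B * b * f).
Local Notation a := (B * b * f ^+ 2).

Let k0 : k != 0. Proof. by rewrite !mulf_neq0. Qed.
Let a0 : a != 0. Proof. by rewrite !mulf_neq0 // expf_neq0. Qed.

Let sqrt_neq0 x : x != 0 -> sqrt x != 0.
Proof. by move=> x0; apply: contraNneq x0 => s0; rewrite -(sqrtK x) s0 expr0n. Qed.

(** The square roots occur in opposite pairs and disappear in base q^4.  The second
factor comes from the very-well-poised part +- q^2 sqrt k. *)
Lemma vwp_num1E m : vwp_num sqrt k (params1 sqrt q a b k) (q ^+ 2) m =
  qpoch k (q ^+ 2) m * qpoch (k * q ^+ 4) ((q ^+ 2) ^+ 2) m * qpoch B q m.*2 * qpoch b q m.*2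
  * qpoch (a * q) (q ^+ 2) m.*2 * qpoch (f^-1 ^+ 2) (q ^+ 2) m.
Proof.
rewrite /vwp_num /qpochs /params1 !big_cons big_nil.
have -> : k ^+ 2 / (a * b) = B by field; rewrite B0 b0 f0.
have -> : k ^+ 2 * q / (a * b) = B * q by field; rewrite B0 b0 f0.
have -> : k ^+ 2 / a ^+ 2 = f^-1 ^+ 2 by field; rewrite B0 b0 f0.
have E1 : sqrt (a * q ^+ 3) ^+ 2 = a * q * q ^+ 2 by rewrite sqrtK; ring.
have E2 : (q ^+ 2 * sqrt k) ^+ 2 = k * q ^+ 4 by rewrite exprMn sqrtK; ring.
rewrite (qpoch_parity B) (qpoch_parity b) -(qpoch_quad m (sqrtK (a * q)) E1).
rewrite -(qpoch_pair _ _ E2) mulNr; ring.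
Qed.

Lemma vwp_den1E m : vwp_den sqrt k (params1 sqrt q a b k) (q ^+ 2) m =
  qpoch (q ^+ 2) (q ^+ 2) m * qpoch k ((q ^+ 2) ^+ 2) m * qpoch (b * q * f) q m.*2
  * qpoch (B * q * f) q m.*2 * qpoch (B * b * q) (q ^+ 2) m.*2
  * qpoch (a * q ^+ 2 * f) (q ^+ 2) m.
Proof.
rewrite /vwp_den /qpochs /params1 /= !big_cons big_nil.
have s1 := sqrt_neq0 (mulf_neq0 a0 q0).
have s3 := sqrt_neq0 (mulf_neq0 a0 (expf_neq0 3 q0)).
have -> : k * q ^+ 2 / (k ^+ 2 / (a * b)) = b * q * f * q by field; rewrite B0 b0 f0.
have -> : k * q ^+ 2 / (k ^+ 2 * q / (a * b)) = b * q * f by field; rewrite B0 b0 f0 q0.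
have -> : k * q ^+ 2 / b = B * q * f * q by field; rewrite b0.
have -> : k * q ^+ 2 / (b * q) = B * q * f by field; rewrite q0 b0.
have -> : k * q ^+ 2 / (k ^+ 2 / a ^+ 2) = a * q ^+ 2 * f by field; rewrite B0 b0 f0.
have E1 : (k * q ^+ 2 / sqrt (a * q ^+ 3)) ^+ 2 = B * b * q.
  rewrite expr_div_n sqrtK; field; rewrite q0 B0 b0 f0 //.
have E2 : (k * q ^+ 2 / sqrt (a * q)) ^+ 2 = B * b * q * q ^+ 2.
  rewrite expr_div_n sqrtK; field; rewrite q0 B0 b0 f0 //.
rewrite (qpoch_parity (b * q * f)) (qpoch_parity (B * q * f)) -(qpoch_quad m E1 E2).
rewrite -(qpoch_pair _ _ (sqrtK k)) !invrN !mulrN; ring.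
Qed.

Lemma vwp_num2E m : vwp_num sqrt a (params2 sqrt q a b k) (q ^+ 2) m =
  qpoch a q m.*2 * qpoch (a * q ^+ 4) ((q ^+ 2) ^+ 2) m * qpoch B (q ^+ 2) m
  * qpoch b (q ^+ 2) m * qpoch (f^-1) q m.*2 * qpoch (a * q * f) (q ^+ 2) m.*2.
Proof.
rewrite /vwp_num /qpochs /params2 !big_cons big_nil.
have -> : k ^+ 2 / (a * b) = B by field; rewrite B0 b0 f0.
have -> : k / a = f^-1 by field; rewrite B0 b0 f0.
have -> : k * q / a = f^-1 * q by field; rewrite B0 b0 f0.
have E1 : (q ^+ 2 * sqrt a) ^+ 2 = a * q ^+ 4 by rewrite exprMn sqrtK; ring.
have E2 : (a * sqrt (q / k)) ^+ 2 = a * q * f.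
  rewrite exprMn sqrtK; field; rewrite B0 b0 f0 //.
have E3 : (a * sqrt (q ^+ 3 / k)) ^+ 2 = a * q * f * q ^+ 2.
  rewrite exprMn sqrtK; field; rewrite B0 b0 f0 //.
rewrite (qpoch_parity a) (qpoch_parity f^-1) -(qpoch_quad m E2 E3).
rewrite -(qpoch_pair _ _ E1) !mulNr; ring.
Qed.

Lemma vwp_den2E m : vwp_den sqrt a (params2 sqrt q a b k) (q ^+ 2) m =
  qpoch q q m.*2 * qpoch a ((q ^+ 2) ^+ 2) m * qpoch (b * q ^+ 2 * f ^+ 2) (q ^+ 2) m
  * qpoch (B * q ^+ 2 * f ^+ 2) (q ^+ 2) m * qpoch (a * q * f) q m.*2
  * qpoch (k * q) (q ^+ 2) m.*2.
Proof.
rewrite /vwp_den /qpochs /params2 /= !big_cons big_nil.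
have s1 := sqrt_neq0 (mulf_neq0 q0 (invr_neq0 k0)).
have s3 := sqrt_neq0 (mulf_neq0 (expf_neq0 3 q0) (invr_neq0 k0)).
have -> : a * q ^+ 2 / (k ^+ 2 / (a * b)) = b * q ^+ 2 * f ^+ 2 by field; rewrite B0 b0 f0.
have -> : a * q ^+ 2 / b = B * q ^+ 2 * f ^+ 2 by field; rewrite b0.
have -> : a * q ^+ 2 / (a * q) = q by field; rewrite q0 B0 b0 f0.
have -> : a * q ^+ 2 / (k / a) = a * q * f * q by field; rewrite B0 b0 f0.
have -> : a * q ^+ 2 / (k * q / a) = a * q * f by field; rewrite q0 B0 b0 f0.
have E1 : (a * q ^+ 2 / (a * sqrt (q ^+ 3 / k))) ^+ 2 = k * q.
  rewrite expr_div_n [(_ * sqrt _) ^+ 2]exprMn sqrtK; field; rewrite q0 B0 b0 f0 //.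
have E2 : (a * q ^+ 2 / (a * sqrt (q / k))) ^+ 2 = k * q * q ^+ 2.
  rewrite expr_div_n [(_ * sqrt _) ^+ 2]exprMn sqrtK; field; rewrite q0 B0 b0 f0 //.
rewrite (qpoch_parity q) (qpoch_parity (a * q * f)) -(qpoch_quad m E1 E2).
rewrite -(qpoch_pair _ _ (sqrtK a)) !mulNr !invrN !mulrN -[q * q]expr2; ring.
Qed.

Lemma vwp_num3E m : vwp_num sqrt (a * q ^+ 2) (params3 sqrt q a b k) (q ^+ 2) m =
  qpoch (a * q) q m.*2 * qpoch (a * q ^+ 6) ((q ^+ 2) ^+ 2) m * qpoch (B * q) (q ^+ 2) m
  * qpoch (b * q) (q ^+ 2) m * qpoch (f^-1 * q) q m.*2 * qpoch (a * q ^+ 3 * f) (q ^+ 2) m.*2.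
Proof.
rewrite /vwp_num /qpochs /params3 !big_cons big_nil.
have -> : k ^+ 2 * q / (a * b) = B * q by field; rewrite B0 b0 f0.
have -> : k * q / a = f^-1 * q by field; rewrite B0 b0 f0.
have -> : k * q ^+ 2 / a = f^-1 * q * q by field; rewrite B0 b0 f0.
have E1 : (q ^+ 2 * sqrt (a * q ^+ 2)) ^+ 2 = a * q ^+ 6 by rewrite exprMn sqrtK; ring.
have E2 : (a * sqrt (q ^+ 3 / k)) ^+ 2 = a * q ^+ 3 * f.
  rewrite exprMn sqrtK; field; rewrite B0 b0 f0 //.
have E3 : (a * sqrt (q ^+ 5 / k)) ^+ 2 = a * q ^+ 3 * f * q ^+ 2.
  rewrite exprMn sqrtK; field; rewrite B0 b0 f0 //.
rewrite (qpoch_parity (a * q)) (qpoch_parity (f^-1 * q)) -(qpoch_quad m E2 E3).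
rewrite -(mulrA a q q) -[q * q]expr2.
rewrite -(qpoch_pair _ _ E1) !mulNr; ring.
Qed.

Lemma vwp_den3E m : vwp_den sqrt (a * q ^+ 2) (params3 sqrt q a b k) (q ^+ 2) m =
  qpoch (q ^+ 2) q m.*2 * qpoch (a * q ^+ 2) ((q ^+ 2) ^+ 2) m
  * qpoch (b * f ^+ 2 * q ^+ 3) (q ^+ 2) m
  * qpoch (B * f ^+ 2 * q ^+ 3) (q ^+ 2) m * qpoch (a * q ^+ 2 * f) q m.*2
  * qpoch (k * q ^+ 3) (q ^+ 2) m.*2.
Proof.
rewrite /vwp_den /qpochs /params3 /= !big_cons big_nil.
have s1 := sqrt_neq0 (mulf_neq0 (expf_neq0 5 q0) (invr_neq0 k0)).
have s3 := sqrt_neq0 (mulf_neq0 (expf_neq0 3 q0) (invr_neq0 k0)).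
have -> : a * q ^+ 2 * q ^+ 2 / (k ^+ 2 * q / (a * b)) = b * f ^+ 2 * q ^+ 3.
  by field; rewrite q0 B0 b0 f0.
have -> : a * q ^+ 2 * q ^+ 2 / (b * q) = B * f ^+ 2 * q ^+ 3 by field; rewrite q0 b0.
have -> : a * q ^+ 2 * q ^+ 2 / (a * q) = q ^+ 2 * q by field; rewrite q0 B0 b0 f0.
have -> : a * q ^+ 2 * q ^+ 2 / (k * q / a) = a * q ^+ 2 * f * q.
  by field; rewrite q0 B0 b0 f0.
have -> : a * q ^+ 2 * q ^+ 2 / (k * q ^+ 2 / a) = a * q ^+ 2 * f.
  by field; rewrite q0 B0 b0 f0.
have E1 : (a * q ^+ 2 * q ^+ 2 / (a * sqrt (q ^+ 5 / k))) ^+ 2 = k * q ^+ 3.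
  rewrite expr_div_n [(_ * sqrt _) ^+ 2]exprMn sqrtK; field; rewrite q0 B0 b0 f0 //.
have E2 : (a * q ^+ 2 * q ^+ 2 / (a * sqrt (q ^+ 3 / k))) ^+ 2 = k * q ^+ 3 * q ^+ 2.
  rewrite expr_div_n [(_ * sqrt _) ^+ 2]exprMn sqrtK; field; rewrite q0 B0 b0 f0 //.
rewrite (qpoch_parity (q ^+ 2)) (qpoch_parity (a * q ^+ 2 * f)) -(qpoch_quad m E1 E2).
rewrite -(qpoch_pair _ _ (sqrtK (a * q ^+ 2))) !mulNr !invrN !mulrN; ring.
Qed.
End Terms.

(** * From the double sum to the three series *)

Section Match.
Variables (R : realType) (K : numFieldType) (nm : K -> R).
Hypothesis A : complete_abs nm.
Variable sqrt : K -> K.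
Hypothesis sqrtK : forall z, sqrt z ^+ 2 = z.
Variable q : K.
Hypotheses (q0 : q != 0) (q1 : nm q < 1).
Variables B b f : K.
Hypotheses (B0 : B != 0) (b0 : b != 0) (f0 : f != 0).
Local Notation k := (B * b * f).
Local Notation a := (B * b * f ^+ 2).
Local Notation P := (fun x => qpoch_inf x (q ^+ 2)).
Local Notation Q := (fun x => qpoch_inf x q).
Hypothesis kq_qf : forall n, qpochs [:: k * q; q * a / k] q n != 0.
Hypothesis D1 : vwp_defined sqrt k (params1 sqrt q a b k) (q ^+ 2).
Hypothesis D2 : vwp_defined sqrt a (params2 sqrt q a b k) (q ^+ 2).
Hypothesis D3 : vwp_defined sqrt (a * q ^+ 2) (params3 sqrt q a b k) (q ^+ 2).

Let qn1 := qn1 A q1.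
Let nmge0 := nm_ge0 A.
Let q21 : nm (q ^+ 2) < 1.
Proof. by rewrite (nmX A) exprn_ilt1 ?nmge0. Qed.

Let kq0 j : 1 - k * q * q ^+ j != 0.
Proof.
have := kq_qf j.+1; rewrite /qpochs !big_cons mulf_eq0 => /norP [H _].
exact: qpoch_factor H.
Qed.

Let qf1 j : 1 - q * f * q ^+ j != 0.
Proof.
have := kq_qf j.+1; rewrite /qpochs !big_cons mulf_eq0 => /norP [_].
rewrite mulf_eq0 => /norP [H _].
have -> : q * f = q * a / k by field; rewrite B0 b0 f0.
exact: qpoch_factor H.
Qed.

Let n1 m : [/\ qpoch (q ^+ 2) (q ^+ 2) m != 0, qpoch k ((q ^+ 2) ^+ 2) m != 0,
  qpoch (b * q * f) q m.*2 != 0, qpoch (B * q * f) q m.*2 != 0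
  & qpoch (B * b * q) (q ^+ 2) m.*2 != 0 /\ qpoch (a * q ^+ 2 * f) (q ^+ 2) m != 0].
Proof.
have := D1 m; rewrite (vwp_den1E sqrtK q0 B0 b0 f0) !mulf_eq0 !negb_or.
by move=> /andP [/andP [/andP [/andP [/andP [-> ->] ->] ->] ->] ->].
Qed.

Let n2 m : [/\ qpoch q q m.*2 != 0, qpoch a ((q ^+ 2) ^+ 2) m != 0,
  qpoch (b * q ^+ 2 * f ^+ 2) (q ^+ 2) m != 0, qpoch (B * q ^+ 2 * f ^+ 2) (q ^+ 2) m != 0
  & qpoch (a * q * f) q m.*2 != 0 /\ qpoch (k * q) (q ^+ 2) m.*2 != 0].
Proof.
have := D2 m; rewrite (vwp_den2E sqrtK q0 B0 b0 f0) !mulf_eq0 !negb_or.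
by move=> /andP [/andP [/andP [/andP [/andP [-> ->] ->] ->] ->] ->].
Qed.

Let n3 m : [/\ qpoch (q ^+ 2) q m.*2 != 0, qpoch (a * q ^+ 2) ((q ^+ 2) ^+ 2) m != 0,
  qpoch (b * f ^+ 2 * q ^+ 3) (q ^+ 2) m != 0, qpoch (B * f ^+ 2 * q ^+ 3) (q ^+ 2) m != 0
  & qpoch (a * q ^+ 2 * f) q m.*2 != 0 /\ qpoch (k * q ^+ 3) (q ^+ 2) m.*2 != 0].
Proof.
have := D3 m; rewrite (vwp_den3E sqrtK q0 B0 b0 f0) !mulf_eq0 !negb_or.
by move=> /andP [/andP [/andP [/andP [/andP [-> ->] ->] ->] ->] ->].
Qed.

Let even_factor (x p : K) : (forall m, qpoch x p m.*2 != 0) -> forall j, 1 - x * p ^+ j != 0.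
Proof. by move=> H j; apply: qpoch_factor (H j.+1); rewrite -addnn ltn_addl. Qed.

Lemma nonzero_k j : 1 - k * q ^+ j != 0.
Proof.
case: j => [|j]; last by rewrite (exprS q) mulrA.
by have [_ H _ _ _] := n1 1; have := qpoch_factor (ltn0Sn 0) H; rewrite !expr0.
Qed.

Lemma nonzero_bqf j : 1 - b * q * f * q ^+ j != 0.
Proof. by apply: even_factor => m; have [] := n1 m. Qed.

Lemma nonzero_Bqf j : 1 - B * q * f * q ^+ j != 0.
Proof. by apply: even_factor => m; have [] := n1 m. Qed.

Lemma nonzero_aqf j : 1 - a * q * f * q ^+ j != 0.
Proof. by apply: even_factor => m; have [_ _ _ _ []] := n2 m. Qed.

(** Even powers of q^2 come from the denominators +- sqrt a of the second series, odd
ones from +- sqrt (a q^2) of the third. *)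
Lemma nonzero_a j : 1 - a * (q ^+ 2) ^+ j != 0.
Proof.
rewrite -(odd_double_half j) exprD -mul2n (exprM (q ^+ 2)) mulrA.
case: (odd j); rewrite ?expr1 ?expr0 ?mulr1.
  by have [_ H _ _ _] := n3 j./2.+1; exact: qpoch_factor H.
by have [_ H _ _ _] := n2 j./2.+1; exact: qpoch_factor H.
Qed.

(** The quotient of the factors +- p sqrt x and +- sqrt x of a very-well-poised
series. *)
Lemma qpoch_shift_ratio (x p : K) m : 1 - x != 0 ->
  qpoch (x * p ^+ 2) (p ^+ 2) m = qpoch x (p ^+ 2) m * ((1 - x * (p ^+ 2) ^+ m) / (1 - x)).
Proof.
move=> x1; apply: (mulfI x1); rewrite -qpochSl qpochS.
by move: (qpoch x _ _) (p ^+ 2 ^+ m) => c d; field.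
Qed.

Lemma left_term_even m : left_term q B b f m.*2 = left_const q B b f * P (B * b * q)
  * vwp_term sqrt k (params1 sqrt q a b k) (q ^+ 2) (a ^+ 2 * q ^+ 2 / k ^+ 2) m.
Proof.
have ae1 j : 1 - a * f^-1 * q * (q ^+ 2) ^+ j != 0.
  have := nonzero_k j.*2.+1; rewrite (exprS q j.*2) -mul2n exprM.
  by rewrite (_ : a / f = k) ?mulrA //; field.
rewrite /left_term (pair_sum m.*2 q0 f0 qn1 nonzero_a nonzero_aqf ae1) odd_double doubleK.
rewrite /left_weight /vwp_term (vwp_num1E sqrtK q B0 b0 f0) (vwp_den1E sqrtK q0 B0 b0 f0).
have [H1 H2 H3 H4 [H5 H6]] := n1 m.
have k1 := nonzero_k 0; rewrite expr0 mulr1 in k1.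
rewrite (qpoch_infD A q21 (B * b * q) m.*2).
have -> : (q ^+ 2) ^+ m.*2 = (q ^+ m.*2) ^+ 2 by rewrite -!exprM mulnC.
rewrite (_ : k * q ^+ 4 = k * (q ^+ 2) ^+ 2); last by rewrite -exprM.
rewrite (qpoch_shift_ratio _ _ k1).
have -> : (q ^+ 2) ^+ 2 ^+ m = (q ^+ m.*2) ^+ 2.
  by rewrite -!exprM -mul2n mulnAC -mulnA mulnC.
have -> : a / f = k by field.
have -> : (- q * f) ^+ m.*2 = (a ^+ 2 * q ^+ 2 / k ^+ 2) ^+ m.
  rewrite -mul2n exprM; congr (_ ^+ m); field; rewrite B0 b0 f0 //.
move: (_ ^+ m) => x; move: (left_const _ _ _ _) => l; move: (qpoch_inf _ _) => p; move: (q ^+ m.*2) => qm.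
move: (qpoch (q ^+ 2) _ _) H1 => c1 H1; move: (qpoch k ((q ^+ 2) ^+ 2) m) H2 => c2 H2.
move: (qpoch (b * q * f) _ _) H3 => c3 H3; move: (qpoch (B * q * f) _ _) H4 => c4 H4.
move: (qpoch (B * b * q) _ _) H5 => c5 H5; move: (qpoch (a * q ^+ 2 * f) _ _) H6 => c6 H6.
move: (qpoch k _ _) (qpoch B _ _) (qpoch b _ _) (qpoch (a * q) _ _) (qpoch (f^-1 ^+ 2) _ _) => d1 d2 d3 d4 d5.
move: k k1 => kk k1; have := k1; move: (1 - kk) => kk1 kk10.
field; nonzero.
Qed.

Lemma left_term_odd m : left_term q B b f m.*2.+1 = 0.
Proof.
have ae1 j : 1 - a * f^-1 * q * (q ^+ 2) ^+ j != 0.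
  have := nonzero_k j.*2.+1; rewrite (exprS q j.*2) -mul2n exprM.
  by rewrite (_ : a / f = k) ?mulrA //; field.
by rewrite /left_term (pair_sum m.*2.+1 q0 f0 qn1 nonzero_a nonzero_aqf ae1) /= odd_double !mulr0.
Qed.

Let aq1 j : 1 - a * q ^+ 2 * (q ^+ 2) ^+ j != 0.
Proof. by have := nonzero_a j.+1; rewrite (exprS (q ^+ 2)) mulrA. Qed.

Lemma right_term_even m : right_term q B b f m.*2 = Q (- q) * Q (k * q)
  * (P (B * q) * P (b * q) * P (b * q ^+ 2 * f ^+ 2) * P (B * q ^+ 2 * f ^+ 2))
  * vwp_term sqrt a (params2 sqrt q a b k) (q ^+ 2) (q ^+ 2 * a ^+ 2 / k ^+ 2) m.
Proof.
rewrite /right_term /vwp_term (vwp_num2E sqrtK q B0 b0 f0) (vwp_den2E sqrtK q0 B0 b0 f0).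
have [H1 H2 H3 H4 [H5 H6]] := n2 m.
have a1 := nonzero_a 0; rewrite expr0 mulr1 in a1.
rewrite (_ : a * q ^+ 4 = a * (q ^+ 2) ^+ 2); last by rewrite -exprM.
rewrite (qpoch_shift_ratio _ _ a1).
rewrite (qpoch_parity B) (qpoch_parity b).
rewrite (qpoch_infD A q21 (B * q) m) (qpoch_infD A q21 (b * q) m).
rewrite (qpoch_infD A q21 (b * q ^+ 2 * f ^+ 2) m) (qpoch_infD A q21 (B * q ^+ 2 * f ^+ 2) m).
have E : q ^+ m.*2 = (q ^+ 2) ^+ m by rewrite -mul2n exprM.
rewrite E [(q ^+ 2) ^+ 2 ^+ m]exprAC.
have -> : (q * f) ^+ m.*2 = (q ^+ 2 * a ^+ 2 / k ^+ 2) ^+ m.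
  by rewrite -mul2n exprM; congr (_ ^+ m); field; rewrite B0 b0 f0.
move: (_ / _ ^+ 2) => X; move: (X ^+ m) => x.
move: (qpoch_inf (- q) _) (qpoch_inf (k * q) _) => p1 p2.
move: (qpoch_inf (B * q * _) _) (qpoch_inf (b * q * _) _) => p3 p4.
move: (qpoch_inf (B * q ^+ 2 * f ^+ 2 * _) _) (qpoch_inf (b * q ^+ 2 * f ^+ 2 * _) _) => p5 p6.
move: ((q ^+ 2) ^+ m) => qm.
move: (qpoch q _ _) H1 => c1 H1; move: (qpoch a ((q ^+ 2) ^+ 2) m) H2 => c2 H2.
move: (qpoch (b * q ^+ 2 * f ^+ 2) _ _) H3 => c3 H3.
move: (qpoch (B * q ^+ 2 * f ^+ 2) _ _) H4 => c4 H4.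
move: (qpoch (a * q * f) q _) H5 => c5 H5; move: (qpoch (k * q) _ _) H6 => c6 H6.
move: (qpoch f^-1 _ _) (qpoch (a * q * f) _ _) (qpoch a _ _) => d1 d2 d3.
move: (qpoch B _ _) (qpoch (B * q) _ _) (qpoch b _ _) (qpoch (b * q) _ _) => e1 e2 e3 e4.
move: a a1 => aa a1; have := a1; move: (1 - aa) => aa1 aa10.
field; nonzero.
Qed.

(** An odd n splits one factor off every factorial; these factors make up the
coefficient of the third series. *)
Lemma right_term_odd m : right_term q B b f m.*2.+1 = Q (- q) * Q (k * q)
  * (q * f * ((1 - a * q ^+ 2) * (1 - f^-1) / ((1 - q) * (1 - k * q)))
     * (P B * P b * P (b * f ^+ 2 * q ^+ 3) * P (B * f ^+ 2 * q ^+ 3)))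
  * vwp_term sqrt (a * q ^+ 2) (params3 sqrt q a b k) (q ^+ 2) (q ^+ 2 * a ^+ 2 / k ^+ 2) m.
Proof.
rewrite /right_term /vwp_term (vwp_num3E sqrtK q B0 b0 f0) (vwp_den3E sqrtK q0 B0 b0 f0).
have [H1 H2 H3 H4 [H5 H6]] := n3 m.
have a1 := nonzero_a 0; rewrite expr0 mulr1 in a1.
have a2 := aq1 0; rewrite expr0 mulr1 in a2.
have k1 := kq0 0; rewrite expr0 mulr1 in k1.
have q11 := qn1 0; rewrite expr0 mulr1 in q11.
have f1 := nonzero_aqf 0; rewrite expr0 mulr1 in f1.
rewrite (_ : a * q ^+ 6 = a * q ^+ 2 * (q ^+ 2) ^+ 2); last by ring.
rewrite (qpoch_shift_ratio _ _ a2).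
rewrite !(qpochSl _ _ m.*2).
rewrite (_ : k * q * q ^+ 2 = k * q ^+ 3); last by ring.
rewrite (_ : a * q * f * q = a * q ^+ 2 * f); last by ring.
rewrite (_ : a * q * f * q ^+ 2 = a * q ^+ 3 * f); last by ring.
rewrite (_ : q * q = q ^+ 2); last by ring.
rewrite (qpoch_parity (B * q)) (qpoch_parity (b * q)).
have E : q ^+ m.*2 = (q ^+ 2) ^+ m by rewrite -mul2n exprM.
rewrite (qpoch_infS A q21 B) (qpoch_infS A q21 b).
rewrite (qpoch_infD A q21 (B * q ^+ 2) m) (qpoch_infD A q21 (b * q ^+ 2) m).
rewrite (qpoch_infD A q21 (b * f ^+ 2 * q ^+ 3) m) (qpoch_infD A q21 (B * f ^+ 2 * q ^+ 3) m).
rewrite (exprS q m.*2) E [(q ^+ 2) ^+ 2 ^+ m]exprAC.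
have -> : (q * f) ^+ m.*2.+1 = q * f * (q ^+ 2 * a ^+ 2 / k ^+ 2) ^+ m.
  by rewrite exprS -mul2n exprM; congr (_ * _ ^+ m); field; rewrite B0 b0 f0.
rewrite (_ : B * q * (q * (q ^+ 2) ^+ m) = B * q ^+ 2 * (q ^+ 2) ^+ m); last by ring.
rewrite (_ : b * q * (q * (q ^+ 2) ^+ m) = b * q ^+ 2 * (q ^+ 2) ^+ m); last by ring.
rewrite (_ : B * q ^+ 2 * f ^+ 2 * (q * (q ^+ 2) ^+ m) = B * f ^+ 2 * q ^+ 3 * (q ^+ 2) ^+ m); last by ring.
rewrite (_ : b * q ^+ 2 * f ^+ 2 * (q * (q ^+ 2) ^+ m) = b * f ^+ 2 * q ^+ 3 * (q ^+ 2) ^+ m); last by ring.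
rewrite (_ : B * q * q = B * q ^+ 2); last by ring.
rewrite (_ : b * q * q = b * q ^+ 2); last by ring.
rewrite (_ : a * (q * (q ^+ 2) ^+ m) ^+ 2 = a * q ^+ 2 * ((q ^+ 2) ^+ m) ^+ 2); last by ring.
move: (_ / _ ^+ 2) => X; move: (X ^+ m) => x.
move: (qpoch_inf (- q) _) (qpoch_inf (k * q) _) => p1 p2.
move: (qpoch_inf (B * q ^+ 2 * _) _) (qpoch_inf (b * q ^+ 2 * _) _) => p3 p4.
move: (qpoch_inf (B * f ^+ 2 * q ^+ 3 * _) _) (qpoch_inf (b * f ^+ 2 * q ^+ 3 * _) _) => p5 p6.
move: ((q ^+ 2) ^+ m) => qm.
move: (qpoch (q ^+ 2) q _) H1 => c1 H1; move: (qpoch (a * q ^+ 2) ((q ^+ 2) ^+ 2) m) H2 => c2 H2.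
move: (qpoch (b * f ^+ 2 * q ^+ 3) _ _) H3 => c3 H3.
move: (qpoch (B * f ^+ 2 * q ^+ 3) _ _) H4 => c4 H4.
move: (qpoch (a * q ^+ 2 * f) _ _) H5 => c5 H5; move: (qpoch (k * q ^+ 3) _ _) H6 => c6 H6.
move: (qpoch (f^-1 * q) _ _) (qpoch (a * q ^+ 3 * f) _ _) (qpoch (a * q) _ _) => d1 d2 d3.
move: (qpoch (B * q) _ _) (qpoch (B * q ^+ 2) _ _) (qpoch (b * q) _ _) (qpoch (b * q ^+ 2) _ _) => e1 e2 e3 e4.
move: (1 - B) (1 - b) (1 - f^-1) (1 - a) a1 (1 - k * q) k1 (1 - q) q11 (1 - a * q * f) f1
  => g1 g2 g3 g4 a1 g5 k1 g6 q11 g7 f1.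
move: (a * q ^+ 2) a2 => y a2; have := a2; move: (1 - y) => y1 y10.
field; nonzero.
Qed.
Let p41 : nm ((q ^+ 2) ^+ 2) < 1.
Proof. by rewrite (nmX A) exprn_ilt1 ?nmge0. Qed.

Lemma factor_dichotomy (x p : K) :
  (exists j, x * p ^+ j = 1) \/ (forall j, 1 - x * p ^+ j != 0).
Proof.
have [H|H] := pselect (exists j, x * p ^+ j = 1); [by left | right => j].
by apply/eqP => /eqP; rewrite subr_eq0 => /eqP E; apply: H; exists j.
Qed.

Lemma cvg_term0 (u : nat -> K) : cvgn (series u) -> u n @[n --> \oo] --> (0 : K).
Proof.
move=> /cvg_ex [l ul].
have us : series u n.+1 @[n --> \oo] --> l by apply: (cvg_subseq (phi := S) _ ul) => n.
have D : series u n.+1 - series u n @[n --> \oo] --> (l - l : K) by exact: cvgB.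
rewrite subrr in D; apply: (@cvg_eventually _ _ _ _ 0%N _ D) => n _.
by rewrite -[series u n.+1]/(\sum_(0 <= i < n.+1) u i) big_nat_recr //=
  -[\sum_(0 <= i < n) u i]/(series u n) addrAC subrr add0r.
Qed.

Local Notation T1 := (vwp_term sqrt k (params1 sqrt q a b k) (q ^+ 2)
  (a ^+ 2 * q ^+ 2 / k ^+ 2)).

(** The inverses of the terms are bounded: the denominators are bounded above, the
numerators are bounded below, and the argument is at least 1 in absolute value. *)
Lemma left_diverges : 1 <= nm (q * f) ->
  (forall j, 1 - B * q ^+ j != 0) -> (forall j, 1 - b * q ^+ j != 0) ->
  (forall j, 1 - a * q * (q ^+ 2) ^+ j != 0) ->
  (forall j, 1 - f^-1 ^+ 2 * (q ^+ 2) ^+ j != 0) ->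
  ~ cvgn (series T1).
Proof.
move=> f1 HB Hb Ha Hf /cvg_term0 T0.
have Hk j : 1 - k * (q ^+ 2) ^+ j != 0 by rewrite -exprM; exact: nonzero_k.
have Hk4 j : 1 - k * q ^+ 4 * (q ^+ 2) ^+ 2 ^+ j != 0.
  by rewrite -!exprM -mulrA -exprD; exact: nonzero_k.
have bT : bdd nm (fun m => (T1 m)^-1).
  pose X := (q * f) ^+ 2.
  have bX : bdd nm (fun m => (X^-1) ^+ m).
    exists 1 => m; rewrite (nmX A) exprn_ile1 ?nmge0 // (nmV A) invf_le1.
      by rewrite (nmX A) exprn_ege1.
    by rewrite (nm_gt0 A) expf_neq0 // mulf_neq0.
  have [M HM] : bdd nm (fun m => (qpoch (q ^+ 2) (q ^+ 2) m * qpoch k ((q ^+ 2) ^+ 2) m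
     * qpoch (b * q * f) q m.*2 * qpoch (B * q * f) q m.*2
     * qpoch (B * b * q) (q ^+ 2) m.*2 * qpoch (a * q ^+ 2 * f) (q ^+ 2) m)
     * ((qpoch k (q ^+ 2) m)^-1 * (qpoch (k * q ^+ 4) ((q ^+ 2) ^+ 2) m)^-1
     * (qpoch B q m.*2)^-1 * (qpoch b q m.*2)^-1 * (qpoch (a * q) (q ^+ 2) m.*2)^-1
     * (qpoch (f^-1 ^+ 2) (q ^+ 2) m)^-1) * X^-1 ^+ m).
    apply: (bddM A) => //; apply: (bddM A); last first.
      by do 5 (apply: (bddM A); last exact: (bddV_qpoch0 A)); exact: (bddV_qpoch0 A).
    do 5 (apply: (bddM A); last by apply: (bdd_qpoch A) => //; exact: bdd_cst).
    by apply: (bdd_qpoch A) => //; exact: bdd_cst.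
  exists M => m; have := HM m; rewrite /vwp_term (vwp_num1E sqrtK q B0 b0 f0) (vwp_den1E sqrtK q0 B0 b0 f0) -!invfM.
  have -> : a ^+ 2 * q ^+ 2 / k ^+ 2 = X by rewrite /X; field; rewrite B0 b0 f0.
  by rewrite (exprVn X) [X in _ -> nm X <= _]invfM [X in _ -> nm (X / _) <= _]invf_div.
have [M HM] := bT.
have T_neq0 m : T1 m != 0.
  rewrite /vwp_term mulf_neq0 //.
    rewrite mulf_neq0 ?invr_eq0 // (vwp_num1E sqrtK q B0 b0 f0).
    by do 5 (apply: mulf_neq0; last exact: (proj1 (qpoch_neq0 _ _) _ _)); exact: (proj1 (qpoch_neq0 _ _) _ _).
  by rewrite expf_neq0 // mulf_neq0 ?invr_eq0 ?mulf_neq0 ?expf_neq0 ?mulf_neq0 ?expf_neq0 ?mulf_neq0.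
have : (fun _ : nat => 1 : K) @ \oo --> (0 : K).
  apply: (@nm_cvg_le _ _ _ A _ _ (fun m => M * nm (T1 m))).
    move=> m; rewrite subr0 -(mulVf (T_neq0 m)) (nmM A).
    by rewrite ler_wpM2r ?nmge0.
  have T0' : (fun m => nm (T1 m)) @ \oo --> (0 : R).
    move/(cvg_nm A) in T0; have E : (fun n => nm (T1 n - 0)) = fun n => nm (T1 n).
      by apply/funext => n; rewrite subr0.
    by rewrite E in T0.
  by rewrite -(mulr0 M); apply: cvgM => //; exact: cvg_cst.
have one : (fun _ : nat => 1 : K) @ \oo --> (1 : K) by exact: cvg_cst.
by move=> /(cvgK_unique one) /eqP; rewrite oner_eq0.
Qed.

Hypothesis C1 : vwp_abs_cvg sqrt k (params1 sqrt q a b k) (q ^+ 2) (a ^+ 2 * q ^+ 2 / k ^+ 2).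

(** Convergence of the left series excludes |q f| >= 1 unless a numerator factor
vanishes.  If a q^(2g+1) = 1, then k is not an integral power of q: exponents
up to 0 are excluded by the denominators 1 - k and (kq; q), positive ones by
(qf; q). *)
Lemma exchange_sum : exists T : K,
  series (left_term q B b f) n @[n --> \oo] --> T /\ series (right_term q B b f) n @[n --> \oo] --> T.
Proof.
have [HB|HB] := factor_dichotomy B q.
  have [j Bj] := HB.
  exact: (exchange_terminating A q1 f0 nonzero_k nonzero_bqf nonzero_Bqf nonzero_aqf nonzero_a
    (M0 := j) (or_introl Bj)).
have [[j bj]|Hb] := factor_dichotomy b q.
  exact: (exchange_terminating A q1 f0 nonzero_k nonzero_bqf nonzero_Bqf nonzero_aqf nonzero_a
    (M0 := j) (or_intror bj)).
have [f1|f1] := ltP (nm (q * f)) 1.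
  exact: (exchange_nonterminating A q1 f0 nonzero_k nonzero_bqf nonzero_Bqf nonzero_aqf nonzero_a f1).
have [[g ag]|Ha] := factor_dichotomy (a * q) (q ^+ 2).
  have {}ag : a * q ^+ g.*2.+1 = 1 by rewrite (exprS q) mulrA -mul2n exprM.
  apply: (exchange_degenerate A q1 q0 B0 b0 f0 ag _ nonzero_bqf nonzero_Bqf nonzero_aqf nonzero_a).
  move=> t j; rewrite -exprM; apply/eqP => /eqP; rewrite subr_eq0 eq_sym => /eqP E.
  have {}E : k * q ^+ j = q ^+ (t * 2).
    by rewrite -[RHS]mul1r -E [in RHS]mulrAC mulfVK // expf_neq0.
  have [tj|jt] := leqP (t * 2) j.
    have /eqP := nonzero_k (j - t * 2); apply; apply/eqP; rewrite subr_eq0 eq_sym; apply/eqP.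
    apply: (@mulIf _ (q ^+ (t * 2))); first exact: expf_neq0.
    by rewrite mul1r -(mulrA k) -exprD subnK.
  have {}E : k = q ^+ (t * 2 - j).
    apply: (@mulIf _ (q ^+ j)); first exact: expf_neq0.
    by rewrite E -exprD subnK // ltnW.
  have /eqP := qf1 (g.*2 + (t * 2 - j)); apply; apply/eqP; rewrite subr_eq0 eq_sym; apply/eqP.
  by rewrite exprD -E -ag (exprS q); ring.
have [[j ej]|He] := factor_dichotomy (f^-1 ^+ 2) (q ^+ 2).
  suff : nm (q * f) < 1 by rewrite ltNge f1.
  have E : (q * f) ^+ 2 = (q ^+ j.+1) ^+ 2.
    rewrite -[LHS]mulr1 -ej expr_sqr (exprS q); move: (q ^+ j) => u; field; exact: f0.
  have /eqP := congr1 nm E; rewrite !(nmX A) eqrXn2 ?exprn_ge0 ?nmge0 // => /eqP ->.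
  by rewrite exprn_ilt1 ?nmge0.
by case: (left_diverges f1 HB Hb Ha He); exact: (nm_normed_series A).
Qed.

Hypothesis C2 : vwp_abs_cvg sqrt a (params2 sqrt q a b k) (q ^+ 2) (q ^+ 2 * a ^+ 2 / k ^+ 2).
Hypothesis C3 : vwp_abs_cvg sqrt (a * q ^+ 2) (params3 sqrt q a b k) (q ^+ 2)
  (q ^+ 2 * a ^+ 2 / k ^+ 2).
Local Notation T2 := (vwp_term sqrt a (params2 sqrt q a b k) (q ^+ 2)
  (q ^+ 2 * a ^+ 2 / k ^+ 2)).
Local Notation T3 := (vwp_term sqrt (a * q ^+ 2) (params3 sqrt q a b k) (q ^+ 2)
  (q ^+ 2 * a ^+ 2 / k ^+ 2)).

Local Notation W1 := (vwp sqrt k (params1 sqrt q a b k) (q ^+ 2)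
  (a ^+ 2 * q ^+ 2 / k ^+ 2)).
Local Notation W2 := (vwp sqrt a (params2 sqrt q a b k) (q ^+ 2)
  (q ^+ 2 * a ^+ 2 / k ^+ 2)).
Local Notation W3 := (vwp sqrt (a * q ^+ 2) (params3 sqrt q a b k) (q ^+ 2)
  (q ^+ 2 * a ^+ 2 / k ^+ 2)).

Lemma series_parity (u v w : nat -> K) (x y X Y : K) :
  (forall m, u m.*2 = x * v m) -> (forall m, u m.*2.+1 = y * w m) ->
  series v n @[n --> \oo] --> X -> series w n @[n --> \oo] --> Y ->
  series u n.*2 @[n --> \oo] --> (x * X + y * Y : K).
Proof.
move=> ev od vX wY.
have L : (x * series v n + y * series w n) @[n --> \oo] --> (x * X + y * Y : K).
  by apply: cvgD; apply: cvgM => //; exact: cvg_cst.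
apply: (@cvg_eventually _ _ _ _ 0%N _ L) => n _; rewrite !seriesE.
elim: n => [|n IH]; first by rewrite !big_ord0 !mulr0 addr0.
by rewrite doubleS !big_ord_recr /= ev od IH; ring.
Qed.

(** Along partial sums of even length the odd terms of the left series contribute 0
and those of the right series make up the third series. *)
Lemma vwp_identity :
  left_const q B b f * P (B * b * q) * W1 =
  Q (- q) * Q (k * q)
    * (P (B * q) * P (b * q) * P (b * q ^+ 2 * f ^+ 2) * P (B * q ^+ 2 * f ^+ 2)) * W2
  + Q (- q) * Q (k * q)
    * (q * f * ((1 - a * q ^+ 2) * (1 - f^-1) / ((1 - q) * (1 - k * q)))
       * (P B * P b * P (b * f ^+ 2 * q ^+ 3) * P (B * f ^+ 2 * q ^+ 3))) * W3.
Proof.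
have [T [cl cr]] := exchange_sum.
have dbl n : (n <= n.*2)%N by rewrite -addnn leq_addr.
have V1 : series T1 n @[n --> \oo] --> W1 := nm_normed_series A C1.
have V2 : series T2 n @[n --> \oo] --> W2 := nm_normed_series A C2.
have V3 : series T3 n @[n --> \oo] --> W3 := nm_normed_series A C3.
have cl' := cvg_subseq dbl cl; have cr' := cvg_subseq dbl cr.
have lo m : left_term q B b f m.*2.+1 = 0 * T1 m by rewrite left_term_odd mul0r.
have := cvgK_unique cl' (series_parity left_term_even lo V1 V1); rewrite mul0r addr0 => <-.
by have := cvgK_unique cr' (series_parity right_term_even right_term_odd V2 V3).
Qed.

(** The constants are compared by (x; q)_oo (-x; q)_oo = (x^2; q^2)_oo for
x = qf, and by Euler's identity, which cancels (-q; q)_oo against (q; q^2)_oo. *)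
Lemma transformation_reparametrized :
  Q (b * q * f) * Q (B * q * f) * (P q * (P (B * b * q) * (P (a * q ^+ 2) * P ((q * f) ^+ 2))))
  / (Q (k * q) * Q (q * f)) * W1 =
  P (B * q) * (P (b * q) * (P (b * q ^+ 2 * f ^+ 2) * P (B * q ^+ 2 * f ^+ 2))) * W2
  + q * f * ((1 - a * q ^+ 2) * (1 - f^-1) / ((1 - q) * (1 - k * q)))
    * (P B * (P b * (P (b * f ^+ 2 * q ^+ 3) * P (B * f ^+ 2 * q ^+ 3)))) * W3.
Proof.
have Qk : Q (k * q) != 0 by exact: (qpoch_inf_neq0 A q1).
have Qf : Q (q * f) != 0 by exact: (qpoch_inf_neq0 A q1).
have := vwp_identity; have := euler_odd A q1.
rewrite -(qpoch_inf_mulN A q1) /left_const mulNr.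
move: W1 W2 W3 => V1 V2 V3.
move: (Q (k * q)) Qk (Q (q * f)) Qf (Q (- q)) (P q) => c1 c10 c2 c20 x y xy E.
(* x y = 1 is Euler's identity; it supplies the factor (-q; q)_oo on the right. *)
have mulxy z : z = x * y * z by rewrite xy mul1r.
rewrite [RHS]mulxy; apply: (mulfI c10).
move: (P B) (P b) (q * f * _) => p1 p2 p3 in E *.
move: (Q (b * q * f)) (Q (B * q * f)) (P (B * b * q)) (P (a * q ^+ 2)) => p4 p5 p6 p7 in E *.
move: (P (B * q)) (P (b * q)) (P (b * q ^+ 2 * f ^+ 2)) (P (B * q ^+ 2 * f ^+ 2)) => r1 r2 r3 r4 in E *.
move: (P (b * f ^+ 2 * q ^+ 3)) (P (B * f ^+ 2 * q ^+ 3)) (Q (- (q * f))) => r5 r6 r7 in E *.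
transitivity (y * (r7 * p4 * p5 * p7 * p6 * V1)).
  by field; rewrite c10 c20.
by rewrite E; ring.
Qed.
End Match.

(** * The transformation *)
Lemma qpochs_inf2 (K : numFieldType) (x y p : K) :
  qpochs_inf [:: x; y] p = qpoch_inf x p * qpoch_inf y p.
Proof. by rewrite /qpochs_inf !big_cons big_nil mulr1. Qed.

Lemma qpochs_inf4 (K : numFieldType) (x y z w p : K) :
  qpochs_inf [:: x; y; z; w] p
  = qpoch_inf x p * (qpoch_inf y p * (qpoch_inf z p * qpoch_inf w p)).
Proof. by rewrite /qpochs_inf !big_cons big_nil mulr1. Qed.

Theorem corollary7 (R : realType)
  (sqrt : R[i] -> R[i]) (sqrtK : forall z : R[i], sqrt z ^+ 2 = z)
  (q a b k : R[i])
  (q_neq0 : q != 0) (a_neq0 : a != 0) (b_neq0 : b != 0) (k_neq0 : k != 0)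
  (q_lt1 : `|q| < 1)
  (den_inf : forall n : nat, qpochs [:: k * q; q * a / k] q n != 0)
  (den_coef : (1 - q) * (1 - k * q) != 0)
  (def1 : vwp_defined sqrt k (params1 sqrt q a b k) (q ^+ 2))
  (def2 : vwp_defined sqrt a (params2 sqrt q a b k) (q ^+ 2))
  (def3 : vwp_defined sqrt (a * q ^+ 2) (params3 sqrt q a b k) (q ^+ 2))
  (cvg1 : vwp_abs_cvg sqrt k (params1 sqrt q a b k) (q ^+ 2)
            (a ^+ 2 * q ^+ 2 / k ^+ 2))
  (cvg2 : vwp_abs_cvg sqrt a (params2 sqrt q a b k) (q ^+ 2)
            (q ^+ 2 * a ^+ 2 / k ^+ 2))
  (cvg3 : vwp_abs_cvg sqrt (a * q ^+ 2) (params3 sqrt q a b k) (q ^+ 2)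
            (q ^+ 2 * a ^+ 2 / k ^+ 2)) :
  qpochs_inf [:: q * a * b / k; k * q / b] q
    * qpochs_inf [:: q; k ^+ 2 * q / a; q ^+ 2 * a;
                     q ^+ 2 * a ^+ 2 / k ^+ 2] (q ^+ 2)
    / qpochs_inf [:: k * q; q * a / k] q
    * vwp sqrt k (params1 sqrt q a b k) (q ^+ 2) (a ^+ 2 * q ^+ 2 / k ^+ 2)
  = qpochs_inf [:: k ^+ 2 * q / (a * b); b * q;
                   a ^+ 2 * b * q ^+ 2 / k ^+ 2; q ^+ 2 * a / b] (q ^+ 2)
      * vwp sqrt a (params2 sqrt q a b k) (q ^+ 2) (q ^+ 2 * a ^+ 2 / k ^+ 2)
    + q * a / k * ((1 - a * q ^+ 2) * (1 - k / a) / ((1 - q) * (1 - k * q)))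
      * qpochs_inf [:: k ^+ 2 / (a * b); b; a ^+ 2 * b * q ^+ 3 / k ^+ 2;
                       q ^+ 3 * a / b] (q ^+ 2)
      * vwp sqrt (a * q ^+ 2) (params3 sqrt q a b k) (q ^+ 2)
          (q ^+ 2 * a ^+ 2 / k ^+ 2).
Proof.
have A := complex_complete_abs R.
have [B0 f0] : k ^+ 2 / (a * b) != 0 /\ a / k != 0.
  by rewrite !mulf_neq0 ?invr_eq0 ?expf_neq0 ?mulf_neq0.
have kE : k = k ^+ 2 / (a * b) * b * (a / k) by field; rewrite k_neq0 b_neq0 a_neq0.
have aE : a = k ^+ 2 / (a * b) * b * (a / k) ^+ 2 by field; rewrite k_neq0 b_neq0 a_neq0.
move: (k ^+ 2 / (a * b)) (a / k) B0 f0 kE aE => B f B0 f0 kE aE; subst k a.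
have q1 : Normc.normc q < 1 by rewrite -(nm_lt1 A).
have := transformation_reparametrized A sqrtK q_neq0 q1 B0 b_neq0 f0 den_inf def1 def2 def3 cvg1 cvg2 cvg3.
rewrite !qpochs_inf2 !qpochs_inf4.
have -> : q * (B * b * f ^+ 2) * b / (B * b * f) = b * q * f by field; rewrite B0 b_neq0 f0.
have -> : B * b * f * q / b = B * q * f by field.
have -> : (B * b * f) ^+ 2 * q / (B * b * f ^+ 2) = B * b * q by field; rewrite B0 b_neq0 f0.
have -> : q ^+ 2 * (B * b * f ^+ 2) = B * b * f ^+ 2 * q ^+ 2 by ring.
have -> : q * (B * b * f ^+ 2) / (B * b * f) = q * f by field; rewrite B0 b_neq0 f0.
have -> : (B * b * f) ^+ 2 * q / (B * b * f ^+ 2 * b) = B * q by field; rewrite B0 b_neq0 f0.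
have -> : (B * b * f ^+ 2) ^+ 2 * b * q ^+ 2 / (B * b * f) ^+ 2 = b * q ^+ 2 * f ^+ 2.
  by field; rewrite B0 b_neq0 f0.
have -> : B * b * f ^+ 2 * q ^+ 2 / b = B * q ^+ 2 * f ^+ 2 by field.
have -> : B * b * f / (B * b * f ^+ 2) = f^-1 by field; rewrite B0 b_neq0 f0.
have -> : (B * b * f ^+ 2) ^+ 2 * b * q ^+ 3 / (B * b * f) ^+ 2 = b * f ^+ 2 * q ^+ 3.
  by field; rewrite B0 b_neq0 f0.
have -> : q ^+ 3 * (B * b * f ^+ 2) / b = B * f ^+ 2 * q ^+ 3 by field.
move: (vwp _ _ _ _ _) (vwp _ _ _ _ _) (vwp _ _ _ _ _) => V1 V2 V3.
have -> : q ^+ 2 * (B * b * f ^+ 2) ^+ 2 / (B * b * f) ^+ 2 = (q * f) ^+ 2.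
  by field; rewrite B0 b_neq0 f0.
exact.
Qed.
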